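(* Let $(K,v)$ be a henselian valued field and $(K(x)|K,v)$ an extension of valued fields with $x$ transcendental over $K$. Assume that there is a tame extension $(L'|K,v)$ such that for some extension of $v$ from $K(x)$ to $L'(x)$, the extension $(L'(x)|L',v)$ is weakly pure. Then there exist monic irreducible polynomials $\{Q_i\}_{i\in S}$ and $\{Q_\nu\}_{\nu\in\Omega}$ over $K$, where $S$ is an initial segment of $\mathbb{N}$ and $\Omega=\emptyset$ or $\Omega=\{\nu\mid\nu<\lambda\}$ for some limit ordinal $\lambda$, having the following properties: (i) $\{Q_i\}_{i\in S}\cup\{Q_\nu\}_{\nu\in\Omega}$ forms a complete sequence of key polynomials for $(K(x)|K,v)$; (ii) $\deg Q_1=1$; (iii) there exist unique maximal roots $a_i$ of $Q_i$ ($i\in S$) and $z_\nu$ of $Q_\nu$ ($\nu\in\Omega$); (iv) $K(a_{i-1})\subsetneq K(a_i)$ and $\deg Q_{i-1}<\deg Q_i$ for $1<i\in S$; (v) $v(x-a_i)>v(x-a_{i-1})$ for $1<i\in S$; (vi) $v(x-a_i)=\max v(x-K(a_i))$ if $i\in S$ is not its last element or $\Omega=\emptyset$; (vii) $v(x-a_n)=\max v(x-\widetilde{K})$ if $S=\{1,\dots,n\}$ and $\Omega=\emptyset$; (viii) if $\Omega\neq\emptyset$, then $S$ is finite, and if $n$ is its last element, then $(z_\nu)_{\nu<\lambda}$ is a pseudo Cauchy sequence of transcendental type in $(K(a_n),v)$ and $\deg Q_n=\deg Q_\nu$ for all $\nu\in\Omega$; (ix) $\mathrm{IC}(K(x)|K,v)=K(a_i\mid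 i\in S)$, which is equal to $K(a_n)$ if $S=\{1,\dots,n\}$; (x) for each $k\in S$, $\{Q_i\}_{1\leq i\leq k}$ forms a complete sequence of key polynomials for $(K(a_k)|K,v)$. With $L:=\mathrm{IC}(K(x)|K,v)$, the extension $(L(x)|L,v)$ is weakly pure. The extension $(K(x)|K,v)$ is valuation algebraic if and only if $S=\mathbb{N}$ or $\Omega\neq\emptyset$. In both cases ($S=\mathbb N$ or $\Omega\ne\emptyset$), the extension $(L(x)|L,v)$ is immediate. In the case of $S=\mathbb{N}$, $(a_i)_{i\in\mathbb{N}}$ is a pseudo Cauchy sequence in $(L,v)$ of transcendental type with $x$ as its limit. Moreover, $\mathrm{IC}(K(x)|K,v)\subseteq L'$.
   Context: Valuations are Krull valuations written additively, $v(0)=\infty$. For a valued field $(L,v)$, $vL$ is the value group and $Lv$ the residue field. $\widetilde K$ is the algebraic closure of $K$. $\mathbb N=\{1,2,\dots\}$; an initial segment of $\mathbb N$ is $\mathbb N$ or $\{1,\dots,n\}$ with $n\in\mathbb N$. We have $L'\subseteq\widetilde K\subseteq\widetilde{K(x)}$, and an extension of the valuation $v$ from $L'(x)$ to $\widetilde{K(x)}$ is fixed; all values below and henselizations are taken with respect to it. For a set $M\subseteq\widetilde{K}$, $v(x-M)=\{v(x-c)\mid c\in M\}$. Tame: an algebraic extension $(L|K,v)$ is unibranched if the extension of $v$ from $K$ to $L$ is unique; it is tame if it is unibranched and every finite subextension $E|K$ satisfies: the ramification index $(vE:vK)$ is not divisible by $\mathrm{char}\,Kv$; $Ev|Kv$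 is separable; and $[E:K]=(vE:vK)[Ev:Kv]$. Pseudo Cauchy sequences: for a limit ordinal $\lambda$, $(z_\nu)_{\nu<\lambda}$ is a pseudo Cauchy sequence in $(K,v)$ if all $z_\nu\in K$ and $v(z_\tau-z_\sigma)>v(z_\sigma-z_\rho)$ whenever $\rho<\sigma<\tau<\lambda$; $y$ is a limit of it if $v(y-z_\nu)=v(z_{\nu+1}-z_\nu)$ for all $\nu<\lambda$; it is of transcendental type in $(K,v)$ if for every $f\in K[X]$ the value $vf(z_\nu)$ is eventually constant. $(K(x)|K,v)$ with $x$ transcendental is weakly pure (in $x$) if there is $a\in K$ with $v(x-a)=\max v(x-\widetilde K)$, or $x$ is limit of a pseudo Cauchy sequence in $(K,v)$ of transcendental type. It is valuation algebraic if $vK(x)/vK$ is a torsion group and $K(x)v|Kv$ is algebraic. An extension is immediate if value group and residue field do not change. Key polynomials (for an arbitrary simple extension $(K(x)|K,v)$, $x$ algebraic or transcendental): for nonconstant $f\in K[X]$ put $\delta(f)=\max\{v(x-a)\mid a\text{ a root of }f\}$ (and $\delta(f)=-\infty$ if $f$ has no roots). A root $a$ of $f$ with $\delta(f)=v(x-a)$ is a maximal root of $f$. A monic $Q\in K[X]$ is a key polynomial for $(K(x)|K,v)$ if for all $f\in K[X]$, $\deg f<\deg Q$ implies $\delta(f)<\delta(Q)$. A family of key polynomials $(Q_i)_{i\in I}$ is complete if for every nonconstant $f\in K[X]$ there is $i\in I$ with $\deg Q_i\leq\deg f$ and $\delta(f)\leq\delta(Q_i)$. For $(K(a_k)|K,v)$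 these notions are taken with $a_k$ in place of $x$. For an extension $(F|K,v)$, the implicit constant field $\mathrm{IC}(F|K,v)$ is the relative algebraic closure of $K$ in a fixed henselization of $(F,v)$ (here: the henselization inside $(\widetilde{K(x)},v)$). *)

(* Defs.v *)
From HB Require Import structures.
From mathcomp Require Import all_boot all_order all_algebra separable.
From mathcomp Require Import generic_quotient ring_quotient.
From mathcomp Require Import all_classical wochoice.

(* Conventions.  The whole configuration lives inside one algebraically closed
   field F (the algebraic closure of K(x)) carrying one valuation v; every field
   E that occurs is a subfield of F, given as a set, with the restriction of v.
   Its value group vE is a subset of the value group of v, its residue field Ev
   a subset of the residue field of (F, v), and the algebraic closure of E is
   the relative algebraic closure of E in F. *)

Set Implicit Arguments.
Unset Strict Implicit.
Unset Printing Implicit Defensive.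
Import Order.TTheory GRing.Theory Num.Theory.
Local Open Scope classical_set_scope.
Local Open Scope ring_scope.

(* Totality is a field of the mixin because RealDomain already joins Zmodule and
   Order.Total, which prevents Hierarchy Builder from declaring that join here. *)
HB.mixin Record isOrderedAbelianGroup G of Num.POrderedZmodule G := {
  oag_total : forall a b : G, (a <= b) || (b <= a);
  oag_leD2l : forall a b c : G, b <= c -> a + b <= a + c
}.

#[short(type="oagType")]
HB.structure Definition OrderedAbelianGroup :=
  { G of isOrderedAbelianGroup G & Num.POrderedZmodule G }.

Section Value.
Variable G : Type.

(* VNInf is never the value of a field element; it only serves as the degree
   of closeness [delta] of a polynomial without roots. *)
Variant value := VNInf | VFin of G | VInf.

Definition value_code (a : value) : G + bool :=
  match a with VNInf => inr false | VFin g => inl g | VInf => inr true end.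
Definition value_decode (c : G + bool) : value :=
  match c with inl g => VFin g | inr b => if b then VInf else VNInf end.
Lemma value_codeK : cancel value_code value_decode.
Proof. by case. Qed.
End Value.
Arguments VNInf {G}.
Arguments VInf {G}.

HB.instance Definition _ (G : choiceType) :=
  Choice.copy (value G) (can_type (@value_codeK G)).

Section ValueOrder.
Variable G : oagType.
Implicit Types a b c : value G.

Definition value_le a b :=
  match a, b with
  | VNInf, _ | _, VInf => true
  | VFin g, VFin h => g <= h
  | _, _ => false
  end.

Definition value_lt a b := (b != a) && value_le a b.

Lemma value_lt_def a b : value_lt a b = (b != a) && value_le a b.
Proof. by []. Qed.

Lemma value_le_refl : reflexive value_le.
Proof. by case=> //= g; rewrite lexx. Qed.

Lemma value_le_anti : antisymmetric value_le.
Proof. by case=> [|g|] [|h|] //= /le_anti ->. Qed.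

Lemma value_le_trans : transitive value_le.
Proof. by case=> [|g|] [|h|] [|k|] //=; apply: le_trans. Qed.

HB.instance Definition _ := Order.isPOrder.Build ring_display (value G)
  value_lt_def value_le_refl value_le_anti value_le_trans.

Lemma value_le_total : total (<=%O : rel (value G)).
Proof. by case=> [|g|] [|h|]; rewrite /Order.le //=; apply: oag_total. Qed.

HB.instance Definition _ :=
  Order.POrder_isTotal.Build ring_display (value G) value_le_total.

Definition value_add a b : value G :=
  match a, b with
  | VNInf, _ | _, VNInf => VNInf
  | VFin g, VFin h => VFin (g + h)
  | _, _ => VInf
  end.
End ValueOrder.

Definition is_max (G : oagType) (A : set (value G)) (m : value G) : Prop :=
  A m /\ ubound A m.

Section Fields.
Variable F : fieldType.
Implicit Types (K E L A : set F) (y : F) (p q : {poly F}).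

Definition subfield E : Prop := GRing.divring_closed (mem E).

(* K(A) *)
Definition adjoin K A : set F := smallest subfield (K `|` A).

Definition algebraic_over K y : Prop :=
  exists2 p, p \is a polyOver (mem K) /\ p != 0 & root p y.

Definition alg_closure K : set F := [set y | algebraic_over K y].

Definition irreducible_over K q : Prop :=
  [/\ q \is a polyOver (mem K), (1 < size q)%N
    & forall p1 p2, p1 \is a polyOver (mem K) -> p2 \is a polyOver (mem K) ->
        q = p1 * p2 -> size p1 = 1%N \/ size p2 = 1%N].

Definition is_minpoly K y p : Prop :=
  [/\ p \is monic, p \is a polyOver (mem K), root p y
    & forall q, q \is a polyOver (mem K) -> q != 0 -> root q y ->
        (size p <= size q)%N].

Definition separable_ext K E : Prop :=
  forall y, E y -> exists2 p, is_minpoly K y p & separable_poly p.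

(* [E : K] = n *)
Definition ext_degree K E (n : nat) : Prop :=
  exists b : 'I_n -> F, (forall i, E (b i)) /\
    forall y, E y -> exists! c : {ffun 'I_n -> F},
      (forall i, K (c i)) /\ y = \sum_i c i * b i.
End Fields.

(* (H : H') = n for subgroups H' of H; g lists representatives of the cosets. *)
Definition group_index (G : zmodType) (H' H : set G) (n : nat) : Prop :=
  exists g : 'I_n -> G, (forall i, H (g i)) /\
    forall h, H h -> exists! i, H' (h - g i).

Section Valuations.
Variables (F : fieldType) (G : oagType).

Definition valuation_on (L : set F) (w : F -> value G) : Prop :=
  [/\ forall y, L y -> w y = VInf <-> y = 0,
      forall y, L y -> w y <> VNInf,
      forall y z, L y -> L z -> w (y * z) = value_add (w y) (w z)
    & forall y z, L y -> L z -> Order.min (w y) (w z) <= w (y + z)].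

Record valuation := Valuation {
  vfun :> F -> value G;
  valuationP : valuation_on setT vfun
}.
End Valuations.

Definition equivalent_on (F : fieldType) (G G' : oagType) (L : set F)
    (w : F -> value G) (w' : F -> value G') : Prop :=
  forall y z, L y -> L z -> (w y <= w z) = (w' y <= w' z).

Section ResidueField.
Variables (F : fieldType) (G : oagType) (v : valuation F G).
Implicit Types y z : F.

Lemma val_eqInf y : v y = VInf <-> y = 0.
Proof. by case: (valuationP v) => h _ _ _; apply: h. Qed.

Lemma val_neqNInf y : v y <> VNInf.
Proof. by case: (valuationP v) => _ h _ _; apply: h. Qed.

Lemma valM y z : v (y * z) = value_add (v y) (v z).
Proof. by case: (valuationP v) => _ _ h _; apply: h. Qed.

Lemma valD y z : Order.min (v y) (v z) <= v (y + z).
Proof. by case: (valuationP v) => _ _ _ h; apply: h. Qed.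

Lemma val0 : v 0 = VInf.
Proof. by apply/val_eqInf. Qed.

Lemma val_fin y : y != 0 -> exists g, v y = VFin g.
Proof.
move=> y0; case e: (v y) => [|g|]; [by case: (val_neqNInf e) | by exists g |].
by move/val_eqInf: e y0 => ->; rewrite eqxx.
Qed.

Lemma val1 : v 1 = VFin 0.
Proof.
have [g e] := val_fin (oner_neq0 F).
have := valM 1 1; rewrite mulr1 e /= => -[] /eqP.
by rewrite -subr_eq subrr => /eqP <-.
Qed.

Lemma oag_leD2r (a b c : G) : b <= c -> b + a <= c + a.
Proof. by rewrite ![_ + a]addrC; apply: oag_leD2l. Qed.

Lemma oag_double0 (g : G) : g + g = 0 -> g = 0.
Proof.
move=> e; apply: le_anti; apply/andP.
by case/orP: (oag_total g 0) => h; have := oag_leD2l g _ _ h; rewrite addr0 e.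
Qed.

Lemma valN1 : v (-1) = VFin 0.
Proof.
have n0 : (-1 : F) != 0 by rewrite oppr_eq0 oner_neq0.
have [g e] := val_fin n0.
have := valM (-1) (-1); rewrite mulrNN mulr1 val1 e /= => -[] h.
by rewrite (oag_double0 (esym h)).
Qed.

Lemma valN y : v (- y) = v y.
Proof.
rewrite -mulN1r valM valN1; case e: (v y) => [|g|] //=.
by rewrite add0r.
Qed.

Definition vring_pred : {pred F} := [pred y | VFin 0 <= v y].

Lemma vring_subring : subring_closed vring_pred.
Proof.
split=> [|y z yO zO|y z]; rewrite ?inE.
- by rewrite val1 lexx.
- by apply: le_trans (valD _ _); rewrite valN le_min; apply/andP.
rewrite valM; case: (v y) => [|g|]; case: (v z) => [|h|] //.
rewrite /Order.le /= => g0 h0.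
by apply: le_trans g0 _; rewrite -[X in X <= _]addr0; apply: oag_leD2l.
Qed.

HB.instance Definition _ := GRing.isSubringClosed.Build F vring_pred vring_subring.

Record vring := VRing { vring_val : F; vring_valP : vring_val \in vring_pred }.
HB.instance Definition _ := [isSub for vring_val].
HB.instance Definition _ := [Choice of vring by <:].
HB.instance Definition _ := [SubChoice_isSubComNzRing of vring by <:].

Definition vmax : {pred vring} := [pred y | VFin 0 < v (val y)].

Lemma vmax_ideal : idealr_closed vmax.
Proof.
split=> [||a y z yM zM]; rewrite ?inE.
- by rewrite /= val0.
- by rewrite /= val1 ltxx.
rewrite inE in yM; rewrite inE in zM.
rewrite rmorphD rmorphM /=; apply: lt_le_trans (valD _ _).
rewrite lt_min; apply/andP; split=> //.
rewrite valM; have := valP a; rewrite inE.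
case: (v (val a)) => [|g|] //; case: (v (val y)) yM => [|h|] //.
rewrite /Order.lt /Order.le /= /value_lt => /andP[h0 hle] gle.
rewrite /= in hle gle *.
have le_h : h <= g + h by rewrite -[X in X <= _]add0r; apply: oag_leD2r.
rewrite (le_trans hle le_h) andbT.
apply/negP => /eqP[] e; rewrite e in le_h.
by move/negP: h0; apply; apply/eqP; congr VFin; apply: le_anti; rewrite hle le_h.
Qed.

HB.instance Definition _ := isIdealr.Build vring vmax vmax_ideal.

Definition residue := {ideal_quot vmax}.
HB.instance Definition _ := GRing.ComNzRing.on residue.

(* 0 by convention outside the valuation ring *)
Definition residue_map y : residue :=
  (\pi_({ideal_quot vmax}) (insubd (0 : vring) y))%qT.

Lemma pi_residue_eq0 (a : vring) :
  ((\pi_({ideal_quot vmax}) a)%qT == 0 :> {ideal_quot vmax}) =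
  (VFin 0 < v (val a)).
Proof. by rewrite -(rmorph0 \pi_({ideal_quot vmax})%qT) -Quotient.idealrBE subr0. Qed.

Definition residue_inv (r : {ideal_quot vmax}) : {ideal_quot vmax} :=
  if r == 0 then 0 else residue_map (val (repr r))^-1.

Lemma residue_mulVf (r : {ideal_quot vmax}) : r != 0 -> residue_inv r * r = 1.
Proof.
rewrite /residue_inv => r0; rewrite (negPf r0).
rewrite -[X in _ * X]reprK; move: r0; rewrite -{1}[r]reprK pi_residue_eq0.
move: (repr r) => a; rewrite -leNgt => va_le0.
have va : v (val a) = VFin 0.
  by apply: le_anti; rewrite va_le0; have := valP a; rewrite inE => ->.
have a0 : val a != 0 by apply/eqP => a0; rewrite a0 val0 in va.
have vV : (val a)^-1 \in vring_pred.
  have [g e] := val_fin (invr_neq0 a0).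
  have := valM (val a) (val a)^-1; rewrite divff // val1 va e /= add0r => -[] g0.
  by rewrite inE e g0 lexx.
rewrite /residue_map -rmorphM -(rmorph1 \pi_({ideal_quot vmax})%qT).
by congr (\pi_({ideal_quot vmax})%qT _); apply: val_inj; rewrite /= insubdK // mulVf.
Qed.

Lemma residue_inv0 : residue_inv 0 = 0.
Proof. by rewrite /residue_inv eqxx. Qed.

HB.instance Definition _ :=
  GRing.ComNzRing_isField.Build residue residue_mulVf residue_inv0.
End ResidueField.

Section ValuedExtensions.
Variables (F : fieldType) (G : oagType) (v : valuation F G).
Implicit Types (K L E : set F) (y : F).

Definition value_group L : set G := [set g | exists2 y, L y & v y = VFin g].

Definition residue_field L : set (residue v) :=
  residue_map v @` (L `&` [set y | VFin 0 <= v y]).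

(* Valuations are identified up to equivalence, so an extension of v from K to L
   is a valuation w of L, with any value group, equivalent to v on K. *)
Definition unibranched K L : Prop :=
  forall (G' : oagType) (w : F -> value G'),
    valuation_on L w -> equivalent_on K w v -> equivalent_on L w v.

Definition henselian K : Prop := unibranched K (alg_closure K).

Definition tame K L : Prop :=
  [/\ subfield K, subfield L, K `<=` L, L `<=` alg_closure K & unibranched K L]
  /\ forall E n, subfield E -> K `<=` E -> E `<=` L -> ext_degree K E n ->
     exists e f : nat,
       [/\ group_index (value_group K) (value_group E) e,
           ext_degree (residue_field K) (residue_field E) f,
           forall p, p \in [pchar (residue v)] -> ~~ (p %| e)%N,
           separable_ext (residue_field K) (residue_field E)
         & n = (e * f)%N].

(* When F is algebraically closed, the henselian subfields of (F, v) that
   contain E have a smallest element, the henselization of (E, v) in (F, v). *)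
Definition henselization E : set F :=
  smallest [set E' | subfield E' /\ henselian E'] E.

(* IC(E|K, v) *)
Definition implicit_constant_field E K : set F :=
  henselization E `&` alg_closure K.

Definition immediate K L : Prop :=
  value_group L = value_group K /\ residue_field L = residue_field K.

Definition valuation_algebraic K L : Prop :=
  (forall g, value_group L g -> exists2 n, (0 < n)%N & value_group K (g *+ n))
  /\ residue_field L `<=` alg_closure (residue_field K).

(* v(y - M) *)
Definition vdist y (M : set F) : set (value G) := [set v (y - c) | c in M].
End ValuedExtensions.

(* An ordinal is represented by a type I well-ordered by le : rel I. *)
Definition wlt (I : Type) (le : rel I) (i j : I) : bool := ~~ le j i.

Section PseudoCauchy.
Variables (F : fieldType) (G : oagType) (v : valuation F G).
Variables (I : Type) (le : rel I).
Implicit Types (K : set F) (z : I -> F) (y : F).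

Local Notation lt := (wlt le).

Definition limit_ordinal : Prop :=
  [/\ well_order le, inhabited I & forall i, exists j, lt i j].

Definition is_succ (i j : I) : Prop := lt i j /\ forall k, lt i k -> le j k.

Definition pseudo_cauchy K z : Prop :=
  [/\ limit_ordinal, forall i, K (z i)
    & forall i j k, lt i j -> lt j k -> v (z j - z i) < v (z k - z j)].

Definition pc_limit z y : Prop :=
  forall i j, is_succ i j -> v (y - z i) = v (z j - z i).

Definition transcendental_type K z : Prop :=
  forall f : {poly F}, f \is a polyOver (mem K) ->
    exists i g, forall j, le i j -> v f.[z j] = g.
End PseudoCauchy.

Definition weakly_pure (F : fieldType) (G : oagType) (v : valuation F G)
    (K : set F) (x : F) : Prop :=
  (exists2 a, K a & is_max (vdist v x (alg_closure K)) (v (x - a)))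
  \/ exists (I : Type) (le : rel I) (z : I -> F),
       [/\ pseudo_cauchy v le K z, transcendental_type v le K z
         & pc_limit v le z x].

Section KeyPolynomials.
Variables (F : closedFieldType) (G : oagType) (v : valuation F G).
Implicit Types (K : set F) (y a : F) (f q : {poly F}).

(* The sequence of roots is meaningful for f != 0 only. *)
Definition delta y f : value G :=
  \big[Order.max/VNInf]_(a <- sval (closed_field_poly_normal f)) v (y - a).

Definition maximal_root y f a : Prop := root f a /\ delta y f = v (y - a).

Definition unique_maximal_root y f a : Prop :=
  maximal_root y f a /\ forall b, maximal_root y f b -> b = a.

(* Q is a key polynomial for (K(y)|K, v). *)
Definition key_polynomial K y (Q : {poly F}) : Prop :=
  [/\ Q \is monic, Q \is a polyOver (mem K)
    & forall f, f \is a polyOver (mem K) -> f != 0 -> (size f < size Q)%N ->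
        delta y f < delta y Q].

Definition complete_key_polynomials K y (P : set {poly F}) : Prop :=
  P `<=` key_polynomial K y /\
  forall f, f \is a polyOver (mem K) -> (1 < size f)%N ->
    exists Q, [/\ P Q, (size Q <= size f)%N & delta y f <= delta y Q].
End KeyPolynomials.

(* {1, ..., n} *)
Definition segment (n : nat) : set nat := [set i | (0 < i <= n)%N].

Definition initial_segment (S : set nat) : Prop :=
  S = [set i | (0 < i)%N] \/ exists2 n, (0 < n)%N & S = segment n.

(* Main.v *)
Require Import Defs.
From HB Require Import structures.
From mathcomp Require Import all_boot all_order all_algebra separable.
From mathcomp Require Import generic_quotient ring_quotient.
From mathcomp Require Import all_classical wochoice zify.
Import Order.TTheory GRing.Theory Num.Theory.
Local Open Scope classical_set_scope.
Local Open Scope ring_scope.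

Set Implicit Arguments.
Unset Strict Implicit.
Unset Printing Implicit Defensive.

(** Call an element c algebraic over K minimal if every algebraic element of smaller
    degree over K is strictly farther from x. The minimal polynomials of minimal
    elements are key polynomials, and every algebraic element is dominated by a minimal
    one of at most its degree. The sequence sought consists of the best minimal elements
    a_i of the successive degrees that occur, followed, when the last degree has no best
    minimal element, by a cofinal sequence of minimal elements z_nu of that degree. What
    has to be shown is that minimal elements have no equally close conjugates, that they
    generate an increasing tower of fields, and that only the last degree can lack a
    best element. This is where tameness and weak purity come in.

    The trace. If K(a) is tame over K, some integral element s(a) of K(a) has unit trace
    (trace_unit). Group the conjugates of a in blocks that induce the same homomorphism
    on the residue field. By Dedekind independence (dedekind), the sum over the blocks
    of these homomorphisms is not zero. The size of a block divides the ramification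
    index, hence is a unit (block_size_unit): the stabilizer of a block cuts out of K(a)
    a subfield with the same residue field.

    Descent. Weak purity says that every ball around x that meets the algebraic closure
    of K meets L' (weakly_pure_dom). The average of the conjugates of a that lie in a
    given ball around a, with the conjugates of s(a) as weights, is a point of the ball
    that is fixed by all embeddings preserving the ball (descend). So every ball around
    x that meets the algebraic closure of K has a centre b in L' with K(b) contained in
    K(c) for all algebraic c in the ball (center). For the smallest ball around x
    containing a minimal c, this gives K(b) = K(c); thus c belongs to L', is the only
    one of its conjugates in the ball, and K(c) is contained in K(c') for all c' at
    least as close to x (minimal_props). For the intersection of the balls belonging to
    a degree without best minimal element, the centre lies in K(c) for some minimal c of
    this degree, because its finitely many other conjugates are separated from it by one
    of the balls. So the intersection contains no algebraic element, and the degree is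
    the last one (top_exists). The records of a well-ordering then provide the z_nu
    (record_sequence).

    The implicit constant field is L0 = K(a_i | i). An embedding that preserves v and
    fixes x fixes every a_i, by a Krasner-type argument, so every henselian field
    containing K(x) contains the a_i (IC_sup). Conversely (IC_inf), an embedding over
    L0(x) preserves v on all polynomials in x that split over the algebraic closure of
    K, because v(x - c) is determined by an element of L0 close to x (val_Ktx). As the
    extensions of a valuation are conjugate (val_conj), it can be corrected to an
    embedding that preserves v everywhere and has the same effect on the algebraic
    closure of K. So an algebraic element of the decomposition field of K(x) is fixed by
    all embeddings over L0(x), and it remains to remove a purely inseparable extension.

    If S is infinite or there are z_nu, every algebraic element is surpassed by an
    element of L0. Then f(x) / f(b) is a one-unit for b in L0 close to x, which makes
    L0(x) an immediate extension (immediate_cof). Otherwise x has a best algebraic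
    approximation, and the extension is not valuation algebraic
    (not_valuation_algebraic). In either case x is weakly pure over L0 by construction.

    Galois theory is expressed by ring endomorphisms of F that fix a subfield (fixes).
    It requires F to be algebraic over the subfield and is therefore applied over E(x)
    to fields E algebraic over K; passing from E to E(x) changes neither minimal
    polynomials nor the set of algebraic elements contained in the field (minp_trans,
    adjoin_trans_alg). *)

(** * Arithmetic of values *)

Section ValueAlgebra.
Variable G : oagType.
Implicit Types g h : G.

Lemma oag_ltD2l g h k : h < k -> g + h < g + k.
Proof.
move=> hk; rewrite lt_neqAle oag_leD2l ?(ltW hk) // andbT.
by apply: contraTneq hk => /addrI ->; rewrite ltxx.
Qed.

Lemma oag_ltD2r g h k : h < k -> h + g < k + g.
Proof. by rewrite ![_ + g]addrC; apply: oag_ltD2l. Qed.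

End ValueAlgebra.

Section ValuationTheory.
Variables (F : fieldType) (G : oagType) (v : valuation F G).
Implicit Types (y z t : F).
Local Notation v0 := (VFin 0 : value G).

Lemma vVInf_max (a : value G) : a <= VInf. Proof. by case: a. Qed.

Lemma vVNInf_min (a : value G) : VNInf <= a. Proof. by case: a. Qed.

Lemma vlt_Inf y : (v y < VInf) = (y != 0).
Proof.
rewrite lt_neqAle vVInf_max andbT; congr (~~ _).
by apply/eqP/eqP; rewrite val_eqInf.
Qed.

Lemma vgtNInf y : VNInf < v y.
Proof.
by rewrite lt_neqAle vVNInf_min andbT eq_sym; apply/eqP; apply: val_neqNInf.
Qed.

Lemma vleM2l t y z : v y <= v z -> v (t * y) <= v (t * z).
Proof.
rewrite !Defs.valM.
case: (v t) => [|g|]; case: (v y) => [|h|]; case: (v z) => [|k|] //.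
exact: oag_leD2l.
Qed.

Lemma vltM2l t y z : t != 0 -> v y < v z -> v (t * y) < v (t * z).
Proof.
move=> t0 lt_yz; rewrite lt_neqAle (vleM2l t (ltW lt_yz)) andbT.
apply: contraTneq lt_yz => /eqP e.
suff: v y = v z by move=> ->; rewrite ltxx.
have /eqP e' := e.
have le1 : v (t^-1 * (t * y)) <= v (t^-1 * (t * z)) by apply: vleM2l; rewrite e'.
have le2 : v (t^-1 * (t * z)) <= v (t^-1 * (t * y)) by apply: vleM2l; rewrite e'.
by rewrite !mulKf // in le1 le2; apply: le_anti; rewrite le1.
Qed.

Lemma vleM2lE t y z : t != 0 -> (v (t * y) <= v (t * z)) = (v y <= v z).
Proof.
move=> t0; apply/idP/idP; last exact: vleM2l.
by apply: contraTT; rewrite -!ltNge; apply: vltM2l.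
Qed.

Lemma vltM2lE t y z : t != 0 -> (v (t * y) < v (t * z)) = (v y < v z).
Proof. by move=> t0; rewrite !ltNge vleM2lE. Qed.

Lemma vM2l_inj t y z : t != 0 -> v (t * y) = v (t * z) -> v y = v z.
Proof.
move=> t0 e; apply/eqP.
by rewrite eq_le -(vleM2lE y z t0) -(vleM2lE z y t0) e lexx.
Qed.

Lemma vleM a b c d : v a <= v b -> v c <= v d -> v (a * c) <= v (b * d).
Proof.
move=> ab cd; apply: le_trans (vleM2l b cd).
by rewrite ![_ * c]mulrC; apply: vleM2l.
Qed.

Lemma veqM a b c d : v a = v b -> v c = v d -> v (a * c) = v (b * d).
Proof. by move=> e1 e2; rewrite !Defs.valM e1 e2. Qed.

Lemma vltM a b c d : v a <= v b -> v c < v d -> a != 0 -> v (a * c) < v (b * d).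
Proof.
move=> ab cd a0; apply: lt_le_trans (vltM2l a0 cd) _.
by rewrite ![_ * d]mulrC; apply: vleM2l.
Qed.

Lemma vM_ge0 y z : v0 <= v y -> v0 <= v z -> v0 <= v (y * z).
Proof. by rewrite -(Defs.val1 v) => h1 h2; rewrite -[1]mulr1; apply: vleM. Qed.

Lemma vM_gt0l y z : v0 < v y -> v0 <= v z -> v0 < v (y * z).
Proof.
rewrite -(Defs.val1 v) => h1 h2; rewrite mulrC -[1]mulr1.
by apply: vltM => //; apply: oner_neq0.
Qed.

Lemma vM_gt0r y z : v0 <= v y -> v0 < v z -> v0 < v (y * z).
Proof. by move=> h1 h2; rewrite mulrC; apply: vM_gt0l. Qed.

Lemma vM_eq0 y z : v y = v0 -> v z = v0 -> v (y * z) = v0.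
Proof. by move=> h1 h2; rewrite Defs.valM h1 h2 /= addr0. Qed.

Lemma vM0l y z : v y = v0 -> v (y * z) = v z.
Proof. by rewrite -(Defs.val1 v) => e; rewrite -[z in RHS]mul1r; apply: veqM. Qed.

Lemma vleMr t y : v0 <= v t -> v y <= v (t * y).
Proof. by rewrite -(Defs.val1 v) => h; rewrite -{1}[y]mul1r; apply: vleM. Qed.

Lemma vneq0 y (g : G) : v y = VFin g -> y != 0.
Proof. by move=> e; apply/eqP => y0; rewrite y0 Defs.val0 in e. Qed.

Lemma vneq0_le y z : v y <= v z -> z != 0 -> y != 0.
Proof. by rewrite -!vlt_Inf; apply: le_lt_trans. Qed.

Lemma vneq0_lt y (a : value G) : v y < a -> y != 0.
Proof. by move=> h; rewrite -vlt_Inf; apply: lt_le_trans h (vVInf_max _). Qed.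

Lemma vV_le y z : z != 0 -> v y <= v z -> v z^-1 <= v y^-1.
Proof.
move=> z0 h; have y0 := vneq0_le h z0.
have := vleM2l (y^-1 * z^-1) h.
by rewrite mulrAC mulVf // mul1r -mulrA mulVf // mulr1.
Qed.

Lemma vV_eq y z : v y = v z -> v y^-1 = v z^-1.
Proof.
case: (eqVneq z 0) => [->|z0].
  by rewrite Defs.val0 => /val_eqInf ->.
move=> e; apply: le_anti.
have y0 : y != 0 by rewrite -vlt_Inf e vlt_Inf.
by rewrite !vV_le ?e.
Qed.

Lemma vV0 y : v y = v0 -> v y^-1 = v0.
Proof. by rewrite -(Defs.val1 v) => /vV_eq ->; rewrite invr1. Qed.

Lemma vdiv_ge0 y z : z != 0 -> (v0 <= v (y / z)) = (v z <= v y).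
Proof.
by move=> z0; rewrite -(Defs.val1 v) -(@vleM2lE z) // mulr1 mulrC divfK.
Qed.

Lemma vdiv_gt0 y z : z != 0 -> (v0 < v (y / z)) = (v z < v y).
Proof.
by move=> z0; rewrite -(Defs.val1 v) -(@vltM2lE z) // mulr1 mulrC divfK.
Qed.

Lemma vdiv_eq0 y z : z != 0 -> v (y / z) = v0 <-> v y = v z.
Proof.
move=> z0; split=> e.
  by rewrite -[y](divfK z0) vM0l.
by rewrite -(Defs.val1 v) -(divff z0); apply: veqM.
Qed.

Lemma vV_lt0 y : y != 0 -> (v0 < v y^-1) = (v y < v0).
Proof. by move=> y0; rewrite -[y^-1]mul1r vdiv_gt0 // Defs.val1. Qed.

Lemma vV_le0 y : y != 0 -> (v0 <= v y^-1) = (v y <= v0).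
Proof. by move=> y0; rewrite -[y^-1]mul1r vdiv_ge0 // Defs.val1. Qed.

Lemma vX_ge0 y n : v0 <= v y -> v0 <= v (y ^+ n).
Proof.
move=> h; elim: n => [|n IH]; first by rewrite expr0 Defs.val1.
by rewrite exprS vM_ge0.
Qed.

Lemma vX_eq y z n : v y = v z -> v (y ^+ n) = v (z ^+ n).
Proof.
by move=> h; elim: n => [//|n IH]; rewrite !exprS; apply: veqM.
Qed.

Lemma vX_le y z n : v y <= v z -> v (y ^+ n) <= v (z ^+ n).
Proof.
by move=> h; elim: n => [//|n IH]; rewrite !exprS; apply: vleM.
Qed.

Lemma vX_lt y z n : (0 < n)%N -> v y < v z -> v (y ^+ n) < v (z ^+ n).
Proof.
case: n => // n _ h; have y0 := vneq0_lt h.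
rewrite !exprSr; apply: vltM => //; last by rewrite expf_neq0.
by apply: vX_le (ltW h).
Qed.

Lemma vX_inj y z n : (0 < n)%N -> v (y ^+ n) = v (z ^+ n) -> v y = v z.
Proof.
move=> n0 e; case: (ltgtP (v y) (v z)) => // /(vX_lt n0).
all: by rewrite e ltxx.
Qed.

Lemma vX_gt0 y n : (0 < n)%N -> (v0 < v (y ^+ n)) = (v0 < v y).
Proof.
move=> n0; apply/idP/idP; rewrite -(Defs.val1 v); last first.
  by rewrite -{2}(expr1n F n); apply: vX_lt.
apply: contraTT; rewrite -!leNgt -{2}(expr1n F n).
exact: vX_le.
Qed.

Lemma vX_VFin y g n : v y = VFin g -> v (y ^+ n) = VFin (g *+ n).
Proof.
move=> e; elim: n => [|n IH]; first by rewrite expr0 mulr0n Defs.val1.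
by rewrite exprS Defs.valM e IH /= mulrS.
Qed.

Lemma vV_VFin y g : v y = VFin g -> v y^-1 = VFin (- g).
Proof.
move=> e; have y0 := vneq0 e; have [h eh] := val_fin v (invr_neq0 y0).
have := Defs.valM v y y^-1; rewrite divff // Defs.val1 e eh /= => -[] /esym/eqP.
by rewrite addrC addr_eq0 => /eqP ->.
Qed.

Lemma vD_ge a y z : a <= v y -> a <= v z -> a <= v (y + z).
Proof. by move=> h1 h2; apply: le_trans (Defs.valD v y z); rewrite le_min h1. Qed.

Lemma vD_gt a y z : a < v y -> a < v z -> a < v (y + z).
Proof. by move=> h1 h2; apply: lt_le_trans (Defs.valD v y z); rewrite lt_min h1. Qed.

Lemma vB_ge a y z : a <= v y -> a <= v z -> a <= v (y - z).
Proof. by move=> h1 h2; apply: vD_ge; rewrite ?Defs.valN. Qed.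

Lemma vB_gt a y z : a < v y -> a < v z -> a < v (y - z).
Proof. by move=> h1 h2; apply: vD_gt; rewrite ?Defs.valN. Qed.

Lemma vD_ltl y z : v y < v z -> v (y + z) = v y.
Proof.
move=> h; apply: le_anti; rewrite vD_ge ?(ltW h) // andbT.
rewrite leNgt; apply/negP => h'.
have := vB_gt h' h; by rewrite addrK ltxx.
Qed.

Lemma vD_ltr y z : v z < v y -> v (y + z) = v z.
Proof. by move=> h; rewrite addrC vD_ltl. Qed.

Lemma vBC y z : v (y - z) = v (z - y).
Proof. by rewrite -Defs.valN opprB. Qed.

(** The ultrametric inequality for three points; this and the two lemmas below are used
    throughout for moving the centre of a ball. *)
Lemma vtri_ge a y z t : a <= v (y - z) -> a <= v (z - t) -> a <= v (y - t).
Proof. by move=> h1 h2; have -> : y - t = (y - z) + (z - t) by [rewrite addrA subrK]; apply: vD_ge. Qed.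

Lemma vtri_gt a y z t : a < v (y - z) -> a < v (z - t) -> a < v (y - t).
Proof. by move=> h1 h2; have -> : y - t = (y - z) + (z - t) by [rewrite addrA subrK]; apply: vD_gt. Qed.

Lemma vtri_eq y z t : v (y - z) < v (z - t) -> v (y - t) = v (y - z).
Proof.
have -> : y - t = (y - z) + (z - t) by rewrite addrA subrK.
exact: vD_ltl. Qed.

Lemma vsum_ge (I : Type) (r : seq I) (P : pred I) (f : I -> F) a :
  (forall i, P i -> a <= v (f i)) -> a <= v (\sum_(i <- r | P i) f i).
Proof.
move=> h; elim/big_ind: _ => //; first by rewrite Defs.val0 vVInf_max.
by move=> y z; apply: vD_ge.
Qed.

Lemma vsum_gt (I : Type) (r : seq I) (P : pred I) (f : I -> F) a :
  a < VInf -> (forall i, P i -> a < v (f i)) -> a < v (\sum_(i <- r | P i) f i).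
Proof.
move=> a0 h; elim/big_ind: _ => //; first by rewrite Defs.val0.
by move=> y z; apply: vD_gt.
Qed.

Lemma vsum_ge_in (T : eqType) (r : seq T) (f : T -> F) a :
  (forall i, i \in r -> a <= v (f i)) -> a <= v (\sum_(i <- r) f i).
Proof. by move=> h; rewrite big_seq; apply: vsum_ge. Qed.

Lemma vsum_gt_in (T : eqType) (r : seq T) (f : T -> F) a :
  a < VInf -> (forall i, i \in r -> a < v (f i)) -> a < v (\sum_(i <- r) f i).
Proof. by move=> h0 h; rewrite big_seq; apply: vsum_gt. Qed.

Lemma v0_lt_Inf : v0 < VInf. Proof. by rewrite -(Defs.val1 v) vlt_Inf oner_neq0. Qed.

Lemma vprod_eq (T : eqType) (r : seq T) (f g : T -> F) :
  (forall i, i \in r -> v (f i) = v (g i)) ->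
  v (\prod_(i <- r) f i) = v (\prod_(i <- r) g i).
Proof.
elim: r => [|i r IH] h; first by rewrite !big_nil.
rewrite !big_cons; apply: veqM; first by apply: h; rewrite mem_head.
by apply: IH => j jr; apply: h; rewrite inE jr orbT.
Qed.

Lemma vprod_le (T : eqType) (r : seq T) (f g : T -> F) :
  (forall i, i \in r -> v (f i) <= v (g i)) ->
  v (\prod_(i <- r) f i) <= v (\prod_(i <- r) g i).
Proof.
elim: r => [|i r IH] h; first by rewrite !big_nil.
rewrite !big_cons; apply: vleM; first by apply: h; rewrite mem_head.
by apply: IH => j jr; apply: h; rewrite inE jr orbT.
Qed.

Lemma vprod_lt (T : eqType) (r : seq T) (f g : T -> F) k : k \in r ->
  (forall i, i \in r -> f i != 0) ->
  (forall i, i \in r -> v (f i) <= v (g i)) -> v (f k) < v (g k) ->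
  v (\prod_(i <- r) f i) < v (\prod_(i <- r) g i).
Proof.
move=> kr f0 h hk.
rewrite !(perm_big _ (perm_to_rem kr)) /= !big_cons ![_ k * _]mulrC.
have sub i : i \in rem k r -> i \in r by apply: mem_rem.
apply: vltM => //; first by apply: vprod_le => i /sub; apply: h.
by rewrite prodf_seq_neq0; apply/allP => i /sub /f0.
Qed.

End ValuationTheory.

(** * Subfields, adjunction and minimal polynomials *)

Section SubfieldType.
Variables (F : fieldType) (E : set F).

(** A subfield given as a set is turned into a field type, so that the theory of
    polynomials, matrices and algebraic elements over a field type becomes available
    over it. *)
Definition sfpred (hE : subfield E) : {pred F} := mem E.

Section Closed.
Variable hE : subfield E.
HB.instance Definition _ := GRing.isDivringClosed.Build F (sfpred hE) hE.

Record sf := Sf { sf_val : F; sf_valP : sf_val \in sfpred hE }.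
HB.instance Definition _ := [isSub of sf for sf_val].
HB.instance Definition _ := [Choice of sf by <:].
HB.instance Definition _ := [SubChoice_isSubIntegralDomain of sf by <:].
HB.instance Definition _ := [SubIntegralDomain_isSubField of sf by <:].

Lemma sfE y : (y \in sfpred hE) = (y \in E). Proof. by []. Qed.

Lemma sf_in (a : sf) : E (val a).
Proof. by have := valP a; rewrite sfE in_setE. Qed.

Definition to_sf y (Ey : E y) : sf := Sf (mem_set Ey : y \in sfpred hE).

Lemma sf1 : E 1. Proof. by apply/set_mem; apply: (rpred1 (sfpred hE)). Qed.
Lemma sf0 : E 0. Proof. by apply/set_mem; apply: (rpred0 (sfpred hE)). Qed.
Lemma sfD y z : E y -> E z -> E (y + z).
Proof. by move=> h1 h2; apply/set_mem/(@rpredD _ (sfpred hE)); apply/mem_set. Qed.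
Lemma sfN y : E y -> E (- y).
Proof. by move=> h1; apply/set_mem; rewrite -sfE rpredN sfE; apply/mem_set. Qed.
Lemma sfB y z : E y -> E z -> E (y - z).
Proof. by move=> h1 h2; apply: sfD => //; apply: sfN. Qed.
Lemma sfM y z : E y -> E z -> E (y * z).
Proof. by move=> h1 h2; apply/set_mem/(@rpredM _ (sfpred hE)); apply/mem_set. Qed.
Lemma sfV y : E y -> E y^-1.
Proof. by move=> h1; apply/set_mem; rewrite -sfE rpredV sfE; apply/mem_set. Qed.
Lemma sf_div y z : E y -> E z -> E (y / z).
Proof. by move=> h1 h2; apply: sfM => //; apply: sfV. Qed.
Lemma sfX y n : E y -> E (y ^+ n).
Proof. by move=> h1; apply/set_mem/(@rpredX _ (sfpred hE)); apply/mem_set. Qed.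
Lemma sf_nat n : E n%:R.
Proof. by apply/set_mem; apply: (rpred_nat (sfpred hE)). Qed.
Lemma sf_sum (T : eqType) (r : seq T) (f : T -> F) :
  (forall i, i \in r -> E (f i)) -> E (\sum_(i <- r) f i).
Proof.
move=> h; rewrite big_seq; elim/big_ind: _ => //; [exact: sf0 | exact: sfD].
Qed.
Lemma sf_prod (T : eqType) (r : seq T) (f : T -> F) :
  (forall i, i \in r -> E (f i)) -> E (\prod_(i <- r) f i).
Proof.
move=> h; rewrite big_seq; elim/big_ind: _ => //; [exact: sf1 | exact: sfM].
Qed.

Lemma polyE p : p \is a polyOver (mem E) <-> forall i, E p`_i.
Proof.
split=> [/(@polyOverP _ (sfpred hE)) h i|h]; first by apply/set_mem; apply: h.
by apply/(@polyOverP _ (sfpred hE)) => i; apply/mem_set.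
Qed.

Lemma pol_sf p : (p \is a polyOver (mem E)) = (p \is a polyOver (sfpred hE)).
Proof. by []. Qed.

Lemma pol_map (g : {poly sf}) : map_poly val g \is a polyOver (mem E).
Proof. by apply/polyE => i; rewrite coef_map; apply: sf_in. Qed.

Lemma pol_lift p : p \is a polyOver (mem E) -> exists g : {poly sf}, p = map_poly val g.
Proof.
move=> /polyE h; exists (\poly_(i < size p) to_sf (h i)).
apply/polyP => i; rewrite coef_map coef_poly.
by case: ltnP => // le; rewrite nth_default // rmorph0.
Qed.

Lemma pol0 : (0 : {poly F}) \is a polyOver (mem E).
Proof. by rewrite pol_sf rpred0. Qed.
Lemma pol1 : (1 : {poly F}) \is a polyOver (mem E).
Proof. by rewrite pol_sf rpred1. Qed.
Lemma polX : ('X : {poly F}) \is a polyOver (mem E).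
Proof. by rewrite pol_sf polyOverX. Qed.
Lemma polC c : E c -> (c%:P : {poly F}) \is a polyOver (mem E).
Proof. by move=> Ec; rewrite pol_sf polyOverC sfE; apply/mem_set. Qed.
Lemma polB p q : p \is a polyOver (mem E) -> q \is a polyOver (mem E) ->
  p - q \is a polyOver (mem E).
Proof. by rewrite !pol_sf; apply: rpredB. Qed.
Lemma polM p q : p \is a polyOver (mem E) -> q \is a polyOver (mem E) ->
  p * q \is a polyOver (mem E).
Proof. by rewrite !pol_sf; apply: rpredM. Qed.
Lemma polXn p n : p \is a polyOver (mem E) -> p ^+ n \is a polyOver (mem E).
Proof. by rewrite !pol_sf; apply: rpredX. Qed.
Lemma polZ c p : E c -> p \is a polyOver (mem E) -> c *: p \is a polyOver (mem E).
Proof. by move=> Ec h; rewrite -mul_polyC; apply: polM => //; apply: polC. Qed.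
Lemma pol_modp p q : p \is a polyOver (mem E) -> q \is a polyOver (mem E) ->
  p %% q \is a polyOver (mem E).
Proof.
by case/pol_lift => g ->; case/pol_lift => h ->; rewrite -map_modp pol_map.
Qed.
Lemma pol_divp p q : p \is a polyOver (mem E) -> q \is a polyOver (mem E) ->
  p %/ q \is a polyOver (mem E).
Proof.
by case/pol_lift => g ->; case/pol_lift => h ->; rewrite -map_divp pol_map.
Qed.
Lemma pol_horner p y : p \is a polyOver (mem E) -> E y -> E p.[y].
Proof.
rewrite pol_sf => h Ey; apply/set_mem; rewrite -sfE.
by apply: rpred_horner => //; apply/mem_set.
Qed.

Lemma alg_sfP y : algebraic_over E y <-> algebraicOver (val : sf -> F) y.
Proof.
split=> [[p [/pol_lift[g ->] n0] r0]|[g g0 rg]].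
  by exists g => //; apply: contraNneq n0 => ->; rewrite rmorph0.
exists (map_poly val g) => //; split; first exact: pol_map.
by rewrite map_poly_eq0.
Qed.

End Closed.

Lemma subfieldP : E 1 -> (forall y z, E y -> E z -> E (y - z)) ->
  (forall y z, E y -> E z -> E (y / z)) -> subfield E.
Proof.
by move=> h1 hB hM; split; rewrite ?in_setE // => y z; rewrite !in_setE; auto.
Qed.

End SubfieldType.

Section Algebraic.
Variable F : fieldType.
Implicit Types (E K A : set F) (y z : F) (p q : {poly F}).

Lemma alg_sub E : subfield E -> E `<=` alg_closure E.
Proof.
move=> hE y Ey; exists ('X - y%:P); last by rewrite root_XsubC.
split; last by rewrite polyXsubC_eq0.
by apply: (polB hE); [apply: polX | apply: polC].
Qed.

Lemma pol_mono E E' p : E `<=` E' -> p \is a polyOver (mem E) ->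
  p \is a polyOver (mem E').
Proof.
by move=> sub; rewrite !qualifE; apply: sub_all => z /set_mem/sub/mem_set.
Qed.

Lemma algebraic_mono E E' y : E `<=` E' -> algebraic_over E y -> algebraic_over E' y.
Proof.
by move=> sub [p [pE p0] rp]; exists p => //; split=> //; apply: pol_mono pE.
Qed.

Lemma alg_closure_subfield E : subfield E -> subfield (alg_closure E).
Proof.
move=> hE; apply: subfieldP => [|y z|y z] /=.
- by apply/(alg_sfP hE)/algebraic1.
- by move=> /(alg_sfP hE) h1 /(alg_sfP hE) h2; apply/(alg_sfP hE)/algebraic_sub.
- by move=> /(alg_sfP hE) h1 /(alg_sfP hE) h2; apply/(alg_sfP hE)/algebraic_div.
Qed.

Lemma alg_trans E y : subfield E -> algebraic_over (alg_closure E) y ->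
  algebraic_over E y.
Proof.
move=> hE [p [pE p0] rp]; apply/(alg_sfP hE)/integral_algebraic.
apply: integral_root p0 rp _; apply/integral_poly => i.
apply/integral_algebraic/(alg_sfP hE).
by move/(polyE (alg_closure_subfield hE)): pE; apply.
Qed.

Lemma adjoin_subfield E A : subfield (adjoin E A).
Proof.
apply: subfieldP => [M [hM _]|y z Ey Ez M hM|y z Ey Ez M hM].
- exact: (sf1 hM).
- by case: (hM) => h _; apply: (sfB h); [apply: Ey | apply: Ez].
- by case: (hM) => h _; apply: (sf_div h); [apply: Ey | apply: Ez].
Qed.

Lemma adjoin_base E A : E `<=` adjoin E A.
Proof. by move=> y Ey M [_]; apply; left. Qed.

Lemma adjoin_gen E A : A `<=` adjoin E A.
Proof. by move=> y Ay M [_]; apply; right. Qed.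

Lemma adjoin_elt E y : adjoin E [set y] y.
Proof. exact: adjoin_gen. Qed.

Lemma adjoin_min E A M : subfield M -> E `<=` M -> A `<=` M -> adjoin E A `<=` M.
Proof.
by move=> hM h1 h2 y; apply; split=> // z [/h1|/h2].
Qed.

Lemma adjoin1_min E y M : subfield M -> E `<=` M -> M y -> adjoin E [set y] `<=` M.
Proof. by move=> hM h1 h2; apply: adjoin_min => // z ->. Qed.

Lemma adjoin_mono E E' A A' : E `<=` E' -> A `<=` A' -> adjoin E A `<=` adjoin E' A'.
Proof.
move=> h1 h2; apply: adjoin_min; first exact: adjoin_subfield.
- by move=> y /h1; apply: adjoin_base.
- by move=> y /h2; apply: adjoin_gen.
Qed.

Lemma adjoin_frac E y z : subfield E -> adjoin E [set y] z ->
  exists p q, [/\ p \is a polyOver (mem E), q \is a polyOver (mem E),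
    q.[y] != 0 & z = p.[y] / q.[y]].
Proof.
move=> hE; pose M := [set z | exists p q, [/\ p \is a polyOver (mem E),
  q \is a polyOver (mem E), q.[y] != 0 & z = p.[y] / q.[y]]].
suff: adjoin E [set y] `<=` M by apply.
apply: adjoin1_min.
- apply: subfieldP => [|u w [p [q [pE qE q0 ->]]] [p' [q' [pE' qE' q0' ->]]]|
     u w [p [q [pE qE q0 ->]]] [p' [q' [pE' qE' q0' ->]]]].
  + exists 1, 1; split; [exact: pol1|exact: pol1|by rewrite hornerC oner_neq0|].
    by rewrite divff // hornerC oner_neq0.
  + exists (p * q' - p' * q), (q * q'); split.
    * by apply: (polB hE); apply: (polM hE).
    * exact: (polM hE).
    * by rewrite hornerM mulf_neq0.
    * by rewrite hornerD hornerN !hornerM -mulNr addf_div // mulNr.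
  + have [->|p0'] := eqVneq p'.[y] 0.
      exists 0, 1; split; [exact: pol0|exact: pol1|by rewrite hornerC oner_neq0|].
      by rewrite mul0r invr0 mulr0 horner0 mul0r.
    exists (p * q'), (q * p'); split; [exact: (polM hE)|exact: (polM hE)| |].
      by rewrite hornerM mulf_neq0.
    by rewrite !hornerM invf_div invfM mulrACA.
- move=> u Eu; exists u%:P, 1; split; [exact: (polC hE)|exact: pol1| |].
    by rewrite hornerC oner_neq0.
  by rewrite !hornerC divr1.
- exists 'X, 1; split; [exact: polX|exact: pol1| |].
    by rewrite hornerC oner_neq0.
  by rewrite hornerX hornerC divr1.
Qed.

(** From c q(x) = p(x) with p, q over E and x transcendental over E(c), the polynomials
    p and c q coincide, so c is a quotient of coefficients. *)
Lemma adjoin_trans_alg K E x c : subfield K -> subfield E -> E `<=` alg_closure K ->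
  ~ algebraic_over K x -> alg_closure K c -> adjoin E [set x] c -> E c.
Proof.
move=> hK hE sE trx cK /(adjoin_frac hE) [p [q [pE qE q0 ce]]].
have hA := alg_closure_subfield hK.
have e : p - c *: q = 0.
  apply/eqP; apply: contra_notT trx => n0; apply: (alg_trans hK).
  exists (p - c *: q).
    split=> //; apply: (polB hA); first exact: pol_mono pE.
    by apply: (polZ hA) => //; apply: pol_mono qE.
  by rewrite rootE hornerD hornerN hornerZ ce divfK // subrr.
have qn0 : q != 0 by apply: contraNneq q0 => ->; rewrite horner0.
move/eqP: e; rewrite subr_eq0 => /eqP e.
have ec : p`_(size q).-1 = c * lead_coef q by rewrite e coefZ.
have -> : c = p`_(size q).-1 / lead_coef q.
  by rewrite ec mulfK // lead_coef_eq0.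
by apply: (sf_div hE); [move/(polyE hE): pE | move/(polyE hE): qE]; apply.
Qed.

Lemma minpoly_ex E y : subfield E -> algebraic_over E y -> exists p, is_minpoly E y p.
Proof.
move=> hE [p0 [pE pn0] rp].
pose P n := `[< exists p, [/\ p \is a polyOver (mem E), p != 0, root p y & size p = n] >].
have exP : exists n, P n by exists (size p0); apply/asboolP; exists p0.
case: (ex_minnP exP) => n /asboolP [p [pE' pn0' rp' sp]] minp.
have lc0 : lead_coef p != 0 by rewrite lead_coef_eq0.
exists ((lead_coef p)^-1 *: p); split.
- by rewrite monicE lead_coefZ mulVf.
- apply: (polZ hE) => //; apply: (sfV hE).
  by move/(polyE hE): pE'; apply.
- by rewrite rootZ // invr_eq0.
- move=> q qE q0 rq; rewrite size_scale ?invr_eq0 // sp; apply: minp.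
  by apply/asboolP; exists q.
Qed.

Section Minpoly.
Variables (E : set F) (y : F) (p : {poly F}).
Hypotheses (hE : subfield E) (hp : is_minpoly E y p).

Lemma minpoly_monic : p \is monic. Proof. by case: hp. Qed.
Lemma minpoly_over : p \is a polyOver (mem E). Proof. by case: hp. Qed.
Lemma minpoly_root : root p y. Proof. by case: hp. Qed.
Lemma minpoly_neq0 : p != 0. Proof. exact: monic_neq0 minpoly_monic. Qed.

Lemma minpoly_size : (1 < size p)%N.
Proof. exact: (root_size_gt1 minpoly_neq0 minpoly_root). Qed.

Lemma minpoly_dvd q : q \is a polyOver (mem E) -> root q y -> p %| q.
Proof.
case: hp => pm pE rp minp qE rq; rewrite /dvdp; apply/negPn/negP => n0.
have := minp (q %% p) (pol_modp hE qE pE) n0.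
rewrite leqNgt ltn_modp minpoly_neq0 => /(_ _)/negP; apply=> //.
rewrite rootE; have := rootP rq; rewrite {1}(divp_eq q p) hornerD hornerM.
by rewrite (rootP rp) mulr0 add0r => ->.
Qed.

Lemma minpoly_eq q : q \is monic -> q \is a polyOver (mem E) -> root q y ->
  (size q <= size p)%N -> q = p.
Proof.
move=> qm qE rq sq; have d := minpoly_dvd qE rq.
apply/eqP; rewrite -eqp_monic ?minpoly_monic // eqp_sym -dvdp_size_eqp //.
by rewrite eqn_leq sq dvdp_leq // monic_neq0.
Qed.

Lemma minpoly_irr : irreducible_over E p.
Proof.
split; [exact: minpoly_over | exact: minpoly_size |] => p1 p2 p1E p2E e.
have := minpoly_root; rewrite e rootM; have n0 := minpoly_neq0.
move: n0; rewrite e mulf_eq0 negb_or => /andP[p10 p20].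
have sz : (size p).+1 = (size p1 + size p2)%N.
  by rewrite e size_mul // prednK // addn_gt0 size_poly_gt0 p10.
case: hp => _ _ _ minp; case/orP => r.
- right; have := minp _ p1E p10 r; have : (0 < size p2)%N by rewrite size_poly_gt0.
  move: sz; lia.
- left; have := minp _ p2E p20 r; have : (0 < size p1)%N by rewrite size_poly_gt0.
  move: sz; lia.
Qed.
End Minpoly.

(** The value is 0 when y is transcendental over E. *)
Definition minp E y : {poly F} := xget 0 [set p | is_minpoly E y p].
Definition deg E y : nat := (size (minp E y)).-1.

Lemma minpP E y : subfield E -> algebraic_over E y -> is_minpoly E y (minp E y).
Proof. by move=> hE ya; apply: (xgetPex 0 (minpoly_ex hE ya)). Qed.

Lemma size_minp E y : subfield E -> algebraic_over E y -> size (minp E y) = (deg E y).+1.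
Proof.
by move=> hE ya; rewrite /deg prednK // (ltn_trans _ (minpoly_size (minpP hE ya))).
Qed.

Lemma deg_gt0 E y : subfield E -> algebraic_over E y -> (0 < deg E y)%N.
Proof. by move=> hE ya; rewrite -ltnS -size_minp // (minpoly_size (minpP hE ya)). Qed.

Lemma deg_root E y p : subfield E -> p \is a polyOver (mem E) -> p != 0 -> root p y ->
  (deg E y < size p)%N.
Proof.
move=> hE pE p0 rp; have ya : algebraic_over E y by exists p.
by rewrite -size_minp //; case: (minpP hE ya) => _ _ _; apply.
Qed.

Lemma deg1 E y : subfield E -> E y -> deg E y = 1%N.
Proof.
move=> hE Ey; have ya := alg_sub hE Ey.
have := @deg_root E y ('X - y%:P) hE (polB hE (polX hE) (polC hE Ey)).
rewrite polyXsubC_eq0 root_XsubC eqxx size_XsubC => /(_ isT isT).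
have := deg_gt0 hE ya; lia.
Qed.

Lemma deg1_in E y : subfield E -> algebraic_over E y -> deg E y = 1%N -> E y.
Proof.
move=> hE ya d1; have hp := minpP hE ya.
have [pm pE rp _] := hp.
have e : minp E y = 'X + ((minp E y)`_0)%:P.
  apply/polyP => -[|[|i]]; rewrite coefD coefX coefC /= ?add0r ?addr0 //.
    have /monicP := pm; by rewrite lead_coefE size_minp // d1.
  by rewrite nth_default // size_minp // d1.
have -> : y = - (minp E y)`_0.
  by apply/eqP; rewrite -addr_eq0; move: rp; rewrite {1}e rootE hornerD hornerX hornerC.
by apply: (sfN hE); move/(polyE hE): pE; apply.
Qed.

(** The inverse of q(y) is a polynomial in y by a Bezout relation between q and the
    minimal polynomial of y, which is irreducible. *)
Lemma adjoin_alg E y z : subfield E -> algebraic_over E y -> adjoin E [set y] z ->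
  exists p, [/\ p \is a polyOver (mem E), (size p <= deg E y)%N & z = p.[y]].
Proof.
move=> hE ya; have hp := minpP hE ya; set m := minp E y in hp.
pose M := [set z | exists p, p \is a polyOver (mem E) /\ z = p.[y]].
have inv q : q \is a polyOver (mem E) -> q.[y] != 0 -> M (q.[y])^-1.
  move=> qE q0; have cop : coprimep m q.
    case: (minpoly_irr hp) => mE ms irr.
    have gE : gcdp m q \is a polyOver (mem E).
      by case/(pol_lift hE): mE => a ->; case/(pol_lift hE): qE => b ->; rewrite -gcdp_map pol_map.
    have [|s1|s2] := irr (m %/ gcdp m q) (gcdp m q) (pol_divp hE mE gE) gE.
    - by rewrite divpK // dvdp_gcdl.
    - have /size_poly1P[c c0 ec] : size (m %/ gcdp m q) == 1%N by rewrite s1.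
      have em : m = c *: gcdp m q by rewrite -mul_polyC -ec divpK // dvdp_gcdl.
      have /dvdpP[r er] : m %| q by rewrite {1}em dvdpZl // dvdp_gcdr.
      by case/negP: q0; rewrite er hornerM (rootP (minpoly_root hp)) mulr0.
    - by rewrite /coprimep s2.
  case/Bezout_coprimepP: cop => -[a b] /= /eqpP[[c d] /= /andP[c0 d0] e].
  case: (pol_lift hE (minpoly_over hp)) => m' em; case: (pol_lift hE qE) => q' eq'.
  have : coprimep m' q'.
    rewrite -(coprimep_map (val : {rmorphism sf hE -> F})) -em -eq'.
    by apply/Bezout_coprimepP; exists (a, b); apply/eqpP; exists (c, d) => //=; rewrite c0.
  case/Bezout_eq1_coprimepP => -[a' b'] /= e'.
  exists (map_poly val b'); split; first exact: pol_map.
  have := congr1 (fun r => (map_poly val r : {poly F}).[y]) e'.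
  rewrite rmorphD !rmorphM rmorph1 /= hornerD !hornerM -em -eq' hornerC.
  rewrite (rootP (minpoly_root hp)) mulr0 add0r => e''.
  by apply: (mulIf q0); rewrite mulVf // e''.
move=> /(adjoin_frac hE) [p [q [pE qE q0 ->]]].
have [r [rE er]] := inv q qE q0.
have mE := minpoly_over hp.
exists ((p * r) %% m); split.
- by apply: (pol_modp hE) => //; apply: (polM hE).
- by rewrite -ltnS -size_minp // ltn_modp (minpoly_neq0 hp).
rewrite er -hornerM {1}(divp_eq (p * r) m) hornerD hornerM.
by rewrite (rootP (minpoly_root hp)) mulr0 add0r.
Qed.

End Algebraic.

(** * Degrees of simple extensions and indices of groups *)

Section Degree.
Variable F : fieldType.
Implicit Types (E K A : set F) (y z : F) (p q : {poly F}).

Lemma poly_vanish E y p : subfield E -> algebraic_over E y -> p \is a polyOver (mem E) ->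
  (size p <= deg E y)%N -> p.[y] = 0 -> p = 0.
Proof.
move=> hE ya pE sp /rootP ry; apply/eqP; apply/negP => /negP n0.
by have := deg_root hE pE n0 ry; rewrite ltnNge sp.
Qed.

(** Write the powers of z in the basis 1, y, y^2, ... of E(y) over E: the relations
    among them are the left kernel of the matrix of coordinates, and when there is none
    the matrix is invertible and expresses y in terms of the powers of z. *)
Section Powers.
Variables (E : set F) (y z : F).
Hypotheses (hE : subfield E) (ya : algebraic_over E y) (zy : adjoin E [set y] z).
Local Notation d := (deg E y).

Let coord u : adjoin E [set y] u ->
  {r : 'rV[sf hE]_d | u = \sum_j val (r 0 j) * y ^+ j}.
Proof.
move=> uy; apply: cid; have [p [pE sp ->]] := adjoin_alg hE ya uy.
case: (pol_lift hE pE) sp => g -> sp; exists (\row_j g`_j).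
rewrite (horner_coef_wide _ sp); apply: eq_bigr => j _.
by rewrite mxE coef_map.
Qed.

Let zX n : adjoin E [set y] (z ^+ n).
Proof. exact: (sfX (adjoin_subfield E [set y])). Qed.

Let rowsum m (r : 'rV[sf hE]_m) (p := \poly_(i < m) (if insub i is Some j then r 0 j else 0)) :
  (map_poly val p).[z] = \sum_i val (r 0 i) * z ^+ i.
Proof.
rewrite (@horner_coef_wide _ m); last by rewrite size_map_poly size_poly.
by apply: eq_bigr => i _; rewrite coef_map coef_poly ltn_ord valK.
Qed.

Let powmx m : 'M[sf hE]_(m, d) := \matrix_(i < m) sval (coord (zX i)).

Let powmxE m (r : 'rV[sf hE]_m) :
  \sum_j val ((r *m powmx m) 0 j) * y ^+ j = \sum_i val (r 0 i) * z ^+ i.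
Proof.
transitivity (\sum_j \sum_i val (r 0 i) * (val (powmx m i j) * y ^+ j)).
  apply: eq_bigr => j _; rewrite mxE rmorph_sum mulr_suml /=.
  by apply: eq_bigr => i _; rewrite mulrA.
rewrite exchange_big; apply: eq_bigr => i _; rewrite -mulr_sumr; congr (_ * _).
by rewrite [RHS](svalP (coord (zX i))); apply: eq_bigr => j _; rewrite mxE.
Qed.

Let relation m (r : 'rV[sf hE]_m) : r != 0 -> r *m powmx m = 0 ->
  exists p, [/\ p \is a polyOver (mem E), p != 0, (size p <= m)%N & root p z].
Proof.
move=> r0 e; pose p := \poly_(i < m) (if insub i is Some j then r 0 j else 0 : sf hE).
exists (map_poly val p); split; first exact: pol_map.
- rewrite map_poly_eq0; apply: contraNneq r0 => p0; apply/eqP/rowP => i.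
  by have := congr1 (fun q : {poly _} => q`_i) p0; rewrite coef_poly ltn_ord valK coef0 mxE.
- by rewrite size_map_poly size_poly.
rewrite rootE rowsum -powmxE e big1 // => j _.
by rewrite mxE rmorph0 mul0r.
Qed.

Let not_free m : ~~ row_free (powmx m) -> exists2 r : 'rV[sf hE]_m, r != 0 & r *m powmx m = 0.
Proof.
rewrite -kermx_eq0 => /rowV0Pn [r rk r0]; exists r => //.
exact/sub_kermxP.
Qed.

Lemma deg_adjoin_le : (deg E z <= deg E y)%N.
Proof.
have : ~~ row_free (powmx d.+1).
  by rewrite /row_free neq_ltn ltnS rank_leq_col.
case/not_free => r r0 e; have [p [pE p0 sp rp]] := relation r0 e.
by rewrite -ltnS (leq_trans (deg_root hE pE p0 rp)).
Qed.

Lemma adjoin_deg_eq : (deg E y <= deg E z)%N -> adjoin E [set y] `<=` adjoin E [set z].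
Proof.
move=> le; have : row_free (powmx d).
  apply/negPn/negP => /not_free [r r0 e].
  have [p [pE p0 sp rp]] := relation r0 e.
  by have := deg_root hE pE p0 rp; rewrite ltnNge (leq_trans sp).
rewrite row_free_unit => U u uy.
have [s es] := coord uy.
have := powmxE (s *m invmx (powmx d)); rewrite mulmxKV // -es => ->.
have hz := adjoin_subfield E [set z].
apply: (sf_sum hz) => i _; apply: (sfM hz).
  by apply: adjoin_base; apply: sf_in.
by apply: (sfX hz); apply: adjoin_elt.
Qed.
End Powers.

Lemma ext_degree_adjoin E y : subfield E -> algebraic_over E y ->
  ext_degree E (adjoin E [set y]) (deg E y).
Proof.
move=> hE ya; exists (fun i : 'I__ => y ^+ i); split=> [i|z zy].
  by apply: (sfX (adjoin_subfield E [set y])); apply: adjoin_elt.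
have [p [pE sp ez]] := adjoin_alg hE ya zy.
exists [ffun i : 'I_(deg E y) => p`_i]; split.
  split=> [i|]; first by rewrite ffunE; move/(polyE hE): pE; apply.
  by rewrite ez (horner_coef_wide _ sp); apply: eq_bigr => i _; rewrite ffunE.
move=> c [cE ec].
pose q := \poly_(i < deg E y) (if insub i is Some j then c j else 0).
have sq : (size q <= deg E y)%N by apply: size_poly.
have qE : q \is a polyOver (mem E).
  apply/(polyE hE) => i; rewrite coef_poly; case: ifP => // _; last exact: sf0.
  by case: insub => [j|]; [apply: cE | exact: sf0].
have eq0 : p - q = 0.
  apply: (poly_vanish hE ya) => //; first exact: (polB hE).
    by rewrite (leq_trans (size_polyD _ _)) // size_polyN geq_max sp.
  rewrite hornerD hornerN -ez ec (horner_coef_wide _ sq) -sumrB big1 // => i _.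
  by rewrite coef_poly ltn_ord valK subrr.
apply/ffunP => i; rewrite ffunE.
have := congr1 (fun r : {poly F} => r`_i) eq0; rewrite coefB coef0 coef_poly ltn_ord valK.
by move/eqP; rewrite subr_eq0 => /eqP.
Qed.

Lemma ext_degree_le E M n m : subfield E -> ext_degree E M n -> ext_degree E M m ->
  (n <= m)%N.
Proof.
move=> hE [b [bM hb]] [b' [bM' hb']].
pose A := \matrix_(i < n, j < m) (sval (cid (hb' _ (bM i)))) j.
pose B := \matrix_(i < m, j < n) (sval (cid (hb _ (bM' i)))) j.
have AP i : (forall j, E (A i j)) /\ b i = \sum_j A i j * b' j.
  have [[h1 h2] _] := svalP (cid (hb' _ (bM i))).
  by split=> [j|]; [rewrite mxE | rewrite [LHS]h2; apply: eq_bigr => j _; rewrite mxE].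
have BP i : (forall j, E (B i j)) /\ b' i = \sum_j B i j * b j.
  have [[h1 h2] _] := svalP (cid (hb _ (bM' i))).
  by split=> [j|]; [rewrite mxE | rewrite [LHS]h2; apply: eq_bigr => j _; rewrite mxE].
have AB : A *m B = 1%:M.
  apply/matrixP => i k.
  have [c [_ cu]] := hb _ (bM i).
  have e1 : c = [ffun k => (A *m B) i k].
    apply: cu; split=> [j|].
      rewrite ffunE mxE; apply: (sf_sum hE) => l _; apply: (sfM hE).
        by case: (AP i).
      by case: (BP l).
    rewrite {1}(AP i).2.
    under eq_bigr do rewrite (BP _).2 mulr_sumr.
    rewrite exchange_big; apply: eq_bigr => j _; rewrite ffunE mxE mulr_suml.
    by apply: eq_bigr => l _; rewrite mulrA.
  have e2 : c = [ffun k => (i == k)%:R].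
    apply: cu; split=> [j|]; first by rewrite ffunE; apply: (sf_nat hE).
    rewrite (bigD1 i) //= ffunE eqxx mul1r big1 ?addr0 // => j ji.
    by rewrite ffunE eq_sym (negPf ji) mul0r.
  have := congr1 (fun f : {ffun _ -> _} => f k) (etrans (esym e1) e2).
  by rewrite !ffunE => ->; rewrite mxE.
have := mxrankM_maxl A B; rewrite AB mxrank1 => h.
by apply: leq_trans h _; apply: rank_leq_col.
Qed.

Lemma ext_degree_uniq E M n m : subfield E -> ext_degree E M n -> ext_degree E M m ->
  n = m.
Proof. by move=> hE h1 h2; apply/eqP; rewrite eqn_leq !(ext_degree_le hE (M := M)). Qed.

Lemma group_index_le (G : zmodType) (H' H : set G) n m :
  (forall g h, H' g -> H' h -> H' (g - h)) ->
  group_index H' H n -> group_index H' H m -> (n <= m)%N.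
Proof.
move=> H'B [g [gH hg]] [g' [gH' hg']].
pose s i := sval (cid (hg' _ (gH i))).
have sP i : H' (g i - g' (s i)) by have [h _] := svalP (cid (hg' _ (gH i))).
have inj : injective s.
  move=> i j e; have [k [_ ku]] := hg _ (gH i).
  have h0 : H' 0 by rewrite -(subrr (g i - g' (s i))); apply: H'B.
  rewrite -(ku i) ?subrr //; apply: esym; rewrite -(ku j) //.
  have -> : g i - g j = (g i - g' (s i)) - (g j - g' (s j)).
    by rewrite e opprB addrA subrK.
  exact: H'B.
by have := leq_card s inj; rewrite !card_ord.
Qed.

(** Translation by h permutes the cosets, so the sum of the representatives changes by n
    h modulo H'. *)
Lemma group_index_mul (G : zmodType) (H' H : set G) n h :
  (forall g h, H' g -> H' h -> H' (g - h)) ->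
  (forall g h, H g -> H h -> H (g - h)) ->
  group_index H' H n -> H h -> H' (h *+ n).
Proof.
move=> H'B cH [g [gH hg]] Hh.
have HD a b : H a -> H b -> H (a + b).
  move=> ha hb; have h0 : H 0 by rewrite -(subrr a); apply: cH.
  by rewrite -[b]opprK -[- b]add0r; apply: (cH) => //; apply: (cH).
case: (posnP n) => [n0|n_gt0].
  move: (g) (gH) (hg _ Hh) => _ _ [i _]; by case: i => i; rewrite n0.
have h'0 : H' 0.
  have [i [hi _]] := hg _ Hh; rewrite -(subrr (h - g i)); exact: H'B.
have H'D a b : H' a -> H' b -> H' (a + b).
  by move=> ha hb; rewrite -[b]opprK -[- b]add0r; apply: (H'B) => //; apply: (H'B).
pose s i := sval (cid (hg _ (HD _ _ Hh (gH i)))).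
have sP i : H' (h + g i - g (s i)) by have [hi _] := svalP (cid (hg _ (HD _ _ Hh (gH i)))).
have inj : injective s.
  move=> i j e; have [k [_ ku]] := hg _ (gH i).
  rewrite -(ku i) ?subrr //; apply: esym; rewrite -(ku j) //.
  have -> : g i - g j = (h + g i - g (s i)) - (h + g j - g (s j)).
    by rewrite e opprB addrA subrK opprD addrACA subrr add0r.
  exact: H'B.
have : H' (\sum_i (h + g i - g (s i))).
  by elim/big_ind: _ => // i _; apply: sP.
rewrite sumrB big_split /= sumr_const card_ord.
by rewrite [X in X - _](_ : _ = h *+ n + \sum_i g (s i)) ?addrK // [\sum_i g i](reindex_inj inj).
Qed.
End Degree.

(** * Embeddings and conjugates *)

Definition hom_on (F : fieldType) (M : set F) (phi : F -> F) : Prop :=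
  phi 1 = 1 /\ forall y z, M y -> M z ->
    phi (y - z) = phi y - phi z /\ phi (y * z) = phi y * phi z.

Section HomOn.
Variables (F : fieldType) (M : set F) (hM : subfield M) (phi : F -> F).

Definition sfhom of hom_on M phi := fun u : sf hM => phi (val u).

Section WithHom.
Hypothesis hphi : hom_on M phi.

Lemma sfhom_zmod : zmod_morphism (sfhom hphi).
Proof. by move=> u w; have [_ /(_ _ _ (sf_in u) (sf_in w)) []] := hphi. Qed.
Lemma sfhom_monoid : monoid_morphism (sfhom hphi).
Proof.
split; first by have [] := hphi.
by move=> u w; have [_ /(_ _ _ (sf_in u) (sf_in w)) []] := hphi.
Qed.
HB.instance Definition _ := GRing.isZmodMorphism.Build (sf hM) F (sfhom hphi) sfhom_zmod.
HB.instance Definition _ := GRing.isMonoidMorphism.Build (sf hM) F (sfhom hphi) sfhom_monoid.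

Lemma hom_on0 : phi 0 = 0.
Proof. exact: (rmorph0 (sfhom hphi)). Qed.

Lemma hom_map (g : {poly sf hM}) :
  map_poly phi (map_poly val g) = map_poly (sfhom hphi) g.
Proof.
by apply/polyP => i; rewrite coef_map_id0 ?hom_on0 // !coef_map.
Qed.

Lemma hom_mapB p q : p \is a polyOver (mem M) -> q \is a polyOver (mem M) ->
  map_poly phi (p - q) = map_poly phi p - map_poly phi q.
Proof.
case/(pol_lift hM) => g ->; case/(pol_lift hM) => h ->.
by rewrite -rmorphB /= !hom_map rmorphB.
Qed.

Lemma hom_mapM p q : p \is a polyOver (mem M) -> q \is a polyOver (mem M) ->
  map_poly phi (p * q) = map_poly phi p * map_poly phi q.
Proof.
case/(pol_lift hM) => g ->; case/(pol_lift hM) => h ->.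
by rewrite -rmorphM /= !hom_map rmorphM.
Qed.

Lemma hom_mapC c : map_poly phi c%:P = (phi c)%:P.
Proof.
apply/polyP => i; rewrite coef_map_id0 ?hom_on0 // !coefC.
by case: eqP => // _; rewrite hom_on0.
Qed.

Lemma hom_size p : p \is a polyOver (mem M) -> size (map_poly phi p) = size p.
Proof. by case/(pol_lift hM) => g ->; rewrite hom_map !size_map_poly. Qed.

End WithHom.
End HomOn.

Lemma hom_onT (F : fieldType) (phi : F -> F) : hom_on setT phi ->
  exists rho : {rmorphism F -> F}, rho =1 phi.
Proof.
move=> [h1 h].
have hz : zmod_morphism phi by move=> y z; case: (h y z).
have hm : monoid_morphism phi by split=> // y z; case: (h y z).
pose A := GRing.isZmodMorphism.Build F F phi hz.
pose B := GRing.isMonoidMorphism.Build F F phi hm.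
by exists (HB.pack_for {rmorphism F -> F} phi A B).
Qed.

Lemma rmorph_hom_on (F : fieldType) (M : set F) (rho : {rmorphism F -> F}) : hom_on M rho.
Proof. by split=> [|y z _ _]; rewrite ?rmorph1 // rmorphB rmorphM. Qed.

(** Zorn's lemma for embeddings that are subject to a pointwise constraint Q. Without
    constraint this extends embeddings to an algebraically closed field; with Q u u'
    stating that u and u' have the same value for two given valuations it produces
    embeddings that carry one valuation to the other. *)
Section HomExtension.
Variables (F : fieldType) (Q : F -> F -> Prop) (M0 : set F) (phi0 : F -> F).

Definition good_hom M phi : Prop :=
  [/\ subfield M, M0 `<=` M, hom_on M phi, forall u, M0 u -> phi u = phi0 u
    & forall u, M u -> Q u (phi u)].

Hypothesis good0 : good_hom M0 phi0.
Hypothesis step : forall M phi, good_hom M phi -> forall y, ~ M y ->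
  exists M' phi', [/\ good_hom M' phi', M `<=` M', M' y
    & forall u, M u -> phi' u = phi u].

Let T := {s : set F * (F -> F) | good_hom s.1 s.2}.
Let R (s t : T) : bool := `[< (sval s).1 `<=` (sval t).1 /\
  forall u, (sval s).1 u -> (sval t).2 u = (sval s).2 u >].

Let chain_bound (A : set T) : total_on A R -> exists t, forall s, A s -> R s t.
Proof.
move=> tot; case: (pselect (exists s, A s)) => [[s0 As0]|n]; last first.
  by exists (exist _ (M0, phi0) good0) => s As; case: n; exists s.
pose M u := exists s, A s /\ (sval s).1 u.
pose phi u := if pselect (M u) is left h then (sval (sval (cid h))).2 u else 0.
have phiE s u : A s -> (sval s).1 u -> phi u = (sval s).2 u.
  move=> As su; rewrite /phi; case: pselect => [h|[]]; last by exists s.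
  case: (cid h) => t [At tu] /=.
  by case: (tot s t As At) => /asboolP[_ ->].
have pair u w : M u -> M w -> exists s, [/\ A s, (sval s).1 u & (sval s).1 w].
  move=> [s [As su]] [t [At tw]]; case: (tot s t As At) => /asboolP[sub _].
    by exists t; split=> //; apply: sub.
  by exists s; split=> //; apply: sub.
have g : good_hom M phi.
  split.
  - apply: subfieldP => [|y z /pair h /h [s [As sy sz]]|y z /pair h /h [s [As sy sz]]].
    + by exists s0; split=> //; case: (svalP s0) => h _ _ _ _; apply: sf1.
    + by exists s; split=> //; case: (svalP s) => h' _ _ _ _; apply: sfB.
    + by exists s; split=> //; case: (svalP s) => h' _ _ _ _; apply: sf_div.
  - by move=> u u0; exists s0; split=> //; case: (svalP s0) => _ h _ _ _; apply: h.
  - split=> [|y z /pair h /h [s [As sy sz]]].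
      case: (svalP s0) => h _ [h1 _] _ _; rewrite (phiE s0) //; exact: sf1.
    case: (svalP s) => h' _ [_ hs] _ _.
    rewrite !(phiE s) //; [exact: hs | exact: sfM | exact: sfB].
  - move=> u u0; case: (svalP s0) => _ h _ h1 _; rewrite (phiE s0) ?h1 //; exact: h.
  - move=> u [s [As su]]; rewrite (phiE s) //.
    by case: (svalP s) => _ _ _ _; apply.
exists (exist _ (M, phi) g) => s As; apply/asboolP; split=> /= [u su|u su]; last exact: phiE.
by exists s.
Qed.

Theorem hom_extend : exists rho : {rmorphism F -> F},
  (forall u, M0 u -> rho u = phi0 u) /\ forall u, Q u (rho u).
Proof.
have [|||t tmax] := @ZL_preorder T (exist _ (M0, phi0) good0) R.
- by move=> s; apply/asboolP; split.
- move=> r s t /asboolP[h1 e1] /asboolP[h2 e2]; apply/asboolP; split=> [u ru|u ru]; first by apply: h2; apply: h1.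
  by rewrite e2 ?e1 //; apply: h1.
- exact: chain_bound.
case: (t) tmax => -[M phi] /= g tmax.
have MT : M = setT.
  apply/seteqP; split=> // y _; apply/not_notP => ny.
  have [M' [phi' [g' sub My e]]] := step g ny.
  have /asboolP[h _] := tmax (exist _ (M', phi') g') (introT (asboolP _) (conj sub e)).
  by apply: ny; apply: h.
case: (g) => _ _; rewrite MT => /hom_onT[rho er] h0 hQ.
exists rho; split=> u; rewrite ?er; [exact: h0 | exact: hQ].
Qed.
End HomExtension.

Section SimpleExtension.
Variables (F : fieldType) (M : set F) (hM : subfield M) (phi : F -> F).
Hypothesis hphi : hom_on M phi.
Variables (y y' : F).
Hypothesis ya : algebraic_over M y.
Hypothesis hy : forall p, p \is a polyOver (mem M) -> p.[y] = 0 -> (map_poly phi p).[y'] = 0.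

Lemma hom_simple : exists phi',
  [/\ hom_on (adjoin M [set y]) phi', forall u, M u -> phi' u = phi u
    & forall p, p \is a polyOver (mem M) -> phi' p.[y] = (map_poly phi p).[y']].
Proof.
pose phi' u := if pselect (exists p, p \is a polyOver (mem M) /\ u = p.[y]) is left h
  then (map_poly phi (sval (cid h))).[y'] else 0.
have phiE p : p \is a polyOver (mem M) -> phi' p.[y] = (map_poly phi p).[y'].
  move=> pM; rewrite /phi'; case: pselect => [h|[]]; last by exists p.
  case: (cid h) => q [qM e] /=; apply/eqP.
  rewrite -subr_eq0 -hornerN -hornerD -(hom_mapB hM hphi) //; apply/eqP/hy.
    exact: (polB hM).
  by rewrite hornerD hornerN e subrr.
exists phi'; split=> //.
- split.
    rewrite -(hornerC 1 y) phiE ?(pol1 hM) // (hom_mapC hM hphi).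
    by rewrite !hornerC; case: hphi.
  move=> u w /(adjoin_alg hM ya)[p [pM _ ->]] /(adjoin_alg hM ya)[q [qM _ ->]].
  rewrite -hornerN -hornerD -hornerM !phiE ?(polB hM) ?(polM hM) //.
  by rewrite (hom_mapB hM hphi) // (hom_mapM hM hphi) // hornerD hornerN hornerM.
- move=> u uM; rewrite -(hornerC u y) phiE ?(polC hM) //.
  by rewrite (hom_mapC hM hphi) !hornerC.
Qed.
End SimpleExtension.

(** Endomorphisms of F that fix M play the role of the Galois group of M: when F is
    algebraic over M they act on conjugates by permutations. *)
Definition fixes (F : fieldType) (M : set F) (rho : {rmorphism F -> F}) : Prop :=
  forall u, M u -> rho u = u.

Definition sep_over (F : fieldType) (M : set F) (y : F) : Prop :=
  exists p, [/\ p \is a polyOver (mem M), root p y & separable_poly p].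

Lemma sep_over_mono (F : fieldType) (M M' : set F) y :
  M `<=` M' -> sep_over M y -> sep_over M' y.
Proof. by move=> sub [p [pM rp sp]]; exists p; split=> //; apply: pol_mono pM. Qed.

Lemma fixes_mono (F : fieldType) (M M' : set F) rho :
  M `<=` M' -> fixes M' rho -> fixes M rho.
Proof. by move=> sub h u /sub /h. Qed.

Lemma perm_map_closed (T : eqType) (f : T -> T) (s : seq T) : uniq s -> injective f ->
  (forall c, c \in s -> f c \in s) -> perm_eq (map f s) s.
Proof.
move=> us fi fs; have us' : uniq (map f s) by rewrite map_inj_uniq.
apply: uniq_perm => //; have [||_ //] := uniq_min_size us' (s2 := s).
  by move=> c /mapP[d ds ->]; apply: fs.
by rewrite size_map.
Qed.

Lemma fixes_map (F : fieldType) (M : set F) (rho : {rmorphism F -> F}) p :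
  subfield M -> fixes M rho -> p \is a polyOver (mem M) -> map_poly rho p = p.
Proof.
by move=> hM h /(polyE hM) pM; apply/polyP => i; rewrite coef_map /= h.
Qed.

Lemma fixes_horner (F : fieldType) (M : set F) (rho : {rmorphism F -> F}) p y :
  subfield M -> fixes M rho -> p \is a polyOver (mem M) -> rho p.[y] = p.[rho y].
Proof. by move=> hM h pM; rewrite -horner_map (fixes_map hM). Qed.

Lemma fixes_root (F : fieldType) (M : set F) (rho : {rmorphism F -> F}) p y :
  subfield M -> fixes M rho -> p \is a polyOver (mem M) -> root p y -> root p (rho y).
Proof.
by move=> hM h pM /rootP r; rewrite rootE -(fixes_horner y hM h pM) r rmorph0.
Qed.

Lemma closed_splits (F : closedFieldType) (p : {poly F}) : p \is monic ->
  exists r : seq F, p = \prod_(z <- r) ('X - z%:P).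
Proof.
move=> /monicP pm; have [r e] := closed_field_poly_normal p.
by exists r; rewrite e pm scale1r.
Qed.

Lemma hom_extend_alg (F : closedFieldType) (M : set F) (phi : F -> F) :
  subfield M -> (forall y, algebraic_over M y) -> hom_on M phi ->
  exists rho : {rmorphism F -> F}, forall u, M u -> rho u = phi u.
Proof.
move=> hM algM hphi; have [||rho [h _]] := @hom_extend F (fun _ _ => True) M phi; last by exists rho.
  by split.
move=> N psi [hN sub hpsi e _] y _.
have ya := algebraic_mono sub (algM y).
have hm := minpP hN ya.
have [y' ry'] : exists y', root (map_poly psi (minp N y)) y'.
  apply/closed_rootP; rewrite (hom_size hN hpsi) ?(minpoly_over hm) //.
  by have := minpoly_size hm; case: (size _) => [|[|]].
have [p pN p0|psi' [h1 h2 _]] := @hom_simple F N hN psi hpsi y y' ya.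
  have /dvdpP[q eq] := minpoly_dvd hN hm pN (introT rootP p0).
  have qN : q \is a polyOver (mem N).
    have -> : q = p %/ minp N y by rewrite eq mulpK // (minpoly_neq0 hm).
    by apply: pol_divp => //; apply: minpoly_over hm.
  rewrite eq (hom_mapM hN hpsi) ?(minpoly_over hm) // hornerM (rootP ry').
  by rewrite mulr0.
exists (adjoin N [set y]), psi'; split=> //.
- split=> //; first exact: adjoin_subfield.
    by move=> u /sub; apply: adjoin_base.
  by move=> u Mu; rewrite h2 ?e //; apply: sub.
- exact: adjoin_base.
- exact: adjoin_elt.
Qed.

Section Galois.
Variables (F : closedFieldType) (M : set F).
Hypothesis hM : subfield M.
Hypothesis algM : forall y, algebraic_over M y.
Implicit Types (y z c u : F).

Lemma conj_exists y y' : root (minp M y) y' ->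
  exists2 rho : {rmorphism F -> F}, fixes M rho & rho y = y'.
Proof.
move=> ry'; have hm := minpP hM (algM y).
have hid : hom_on M id by split.
have [p pM p0|phi [h1 h2 h3]] := @hom_simple F M hM id hid y y' (algM y).
  rewrite map_poly_id //.
  have /dvdpP[q ->] := minpoly_dvd hM hm pM (introT rootP p0).
  by rewrite hornerM (rootP ry') mulr0.
have hA := adjoin_subfield M [set y].
have sub := @adjoin_base F M [set y].
have [|rho h] := @hom_extend_alg F (adjoin M [set y]) phi hA _ h1.
  by move=> z; apply: algebraic_mono (algM z).
exists rho; first by move=> u Mu; rewrite h ?h2 //; apply: sub.
rewrite h; last exact: adjoin_elt.
by have := h3 'X (polX hM); rewrite map_poly_id // !hornerX.
Qed.

Definition conjugates y : seq F := undup (sval (closed_field_poly_normal (minp M y))).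

Lemma conj_root y c : (c \in conjugates y) = root (minp M y) c.
Proof.
rewrite mem_undup; case: closed_field_poly_normal => r /= e.
have hm := minpP hM (algM y); have /monicP lc := minpoly_monic hm.
by rewrite e lc scale1r root_prod_XsubC.
Qed.

Lemma conj_uniq y : uniq (conjugates y). Proof. exact: undup_uniq. Qed.

Lemma conj_self y : y \in conjugates y.
Proof. by rewrite conj_root; apply: minpoly_root (minpP hM (algM y)). Qed.

Lemma conj_hom y c rho : fixes M rho -> c \in conjugates y -> rho c \in conjugates y.
Proof.
rewrite !conj_root => h; apply: fixes_root hM h _.
exact: minpoly_over (minpP hM (algM y)).
Qed.

Lemma conjP y c : c \in conjugates y -> exists2 rho : {rmorphism F -> F}, fixes M rho & rho y = c.
Proof. by rewrite conj_root => /conj_exists. Qed.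

Lemma conj_perm y rho : fixes M rho -> perm_eq (map rho (conjugates y)) (conjugates y).
Proof.
move=> h; apply: perm_map_closed; [exact: conj_uniq | exact: fmorph_inj |].
by move=> c; apply: conj_hom.
Qed.

(** Every root of the minimal polynomial of y is the image of y under some embedding
    over M, so y is its only root. *)
Lemma fixed_minp y : (forall rho, fixes M rho -> rho y = y) ->
  minp M y = ('X - y%:P) ^+ deg M y.
Proof.
move=> fy; have hm := minpP hM (algM y).
have [r e] := closed_splits (minpoly_monic hm).
have er : r = nseq (size r) y.
  apply/all_pred1P/allP => c cr /=; apply/eqP.
  have [|rho h <-] := @conjP y c; last exact: fy.
  by rewrite conj_root e root_prod_XsubC.
have sr : deg M y = size r by rewrite /deg e size_prod_XsubC.
by rewrite sr e er size_nseq big_nseq iter_mulr_1.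
Qed.

Lemma fixed_power y : (forall rho, fixes M rho -> rho y = y) ->
  exists2 n, (0 < n)%N & M (y ^+ n).
Proof.
move=> fy; exists (deg M y); first exact: deg_gt0.
have /(polyE hM)/(_ 0%N) := minpoly_over (minpP hM (algM y)).
rewrite (fixed_minp fy) -horner_coef0 horner_exp hornerD hornerN hornerX hornerC sub0r exprNn => h.
suff -> : y ^+ deg M y = (- 1) ^+ deg M y * ((- 1) ^+ deg M y * y ^+ deg M y).
  by apply: (sfM hM) h; apply: (sfX hM); apply: (sfN hM); apply: sf1.
by rewrite mulrA -exprMn mulrNN mulr1 expr1n mul1r.
Qed.

Lemma sep_minp y : sep_over M y -> separable_poly (minp M y).
Proof.
case=> p [pM rp]; apply: dvdp_separable.
by have := minpoly_dvd hM (minpP hM (algM y)) pM rp.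
Qed.

Lemma sep_conj y : sep_over M y -> minp M y = \prod_(c <- conjugates y) ('X - c%:P).
Proof.
move=> /sep_minp; rewrite /conjugates; case: closed_field_poly_normal => r /= e.
have hm := minpP hM (algM y); have /monicP lc := minpoly_monic hm.
move: e; rewrite lc scale1r => e; rewrite {1}e separable_prod_XsubC => ur.
by rewrite undup_id.
Qed.

Lemma sep_size_conj y : sep_over M y -> size (conjugates y) = deg M y.
Proof. by move=> /sep_conj e; rewrite /deg e size_prod_XsubC. Qed.

(** Write u = h(c) with deg h smaller than the degree of c. Every conjugate of c is a
    root of h - u, which is too many roots unless h is constant. *)
Lemma fixed_simple c u : sep_over M c -> adjoin M [set c] u ->
  (forall rho, fixes M rho -> rho u = u) -> M u.
Proof.
move=> sc uc fu; have [h [hM' sh eu]] := adjoin_alg hM (algM c) uc.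
have e0 : h - u%:P = 0.
  apply/eqP/negP => /negP n0.
  have := max_poly_roots n0 _ (conj_uniq c); rewrite sep_size_conj //.
  have -> : all (root (h - u%:P)) (conjugates c).
    apply/allP => d /conjP [rho hr <-].
    by rewrite rootE hornerD hornerN hornerC -(fixes_horner c hM hr hM') -eu fu // subrr.
  move=> /(_ isT); rewrite ltnNge => /negP; apply.
  apply: leq_trans (size_polyD _ _) _; rewrite size_polyN geq_max sh /=.
  by apply: leq_trans (size_polyC_leq1 _) _; apply: deg_gt0.
have -> : u = h`_0.
  by move/eqP: e0; rewrite subr_eq0 => /eqP ->; rewrite coefC.
by move/(polyE hM): hM'; apply.
Qed.

Lemma fixed_sep u : sep_over M u -> (forall rho, fixes M rho -> rho u = u) -> M u.
Proof. by move=> su; apply: (fixed_simple su); apply: adjoin_elt. Qed.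

(** The minimal polynomial of an inseparable element has zero derivative, hence is a
    polynomial in X^q, q the characteristic. *)
Lemma insep_power y : ~ sep_over M y ->
  exists2 q, q \in [pchar F] & (deg M (y ^+ q) < deg M y)%N.
Proof.
move=> ns; have hm := minpP hM (algM y); set m := minp M y in hm.
have mM := minpoly_over hm.
have d0 : m^`() = 0.
  apply/eqP/negP => /negP n0; apply: ns; exists m; split=> //; first exact: minpoly_root hm.
  rewrite unlock /coprimep; have [_ ms irr] := minpoly_irr hm.
  have gM : gcdp m m^`() \is a polyOver (mem M).
    case/(pol_lift hM): mM => g ->; rewrite deriv_map -gcdp_map; exact: pol_map.
  have em : m = m %/ gcdp m m^`() * gcdp m m^`() by rewrite divpK // dvdp_gcdl.
  case: (irr _ _ (pol_divp hM mM gM) gM em) => [s1|->] //.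
  have /size_poly1P[c c0 ec] : size (m %/ gcdp m m^`()) == 1%N by rewrite s1.
  have : m %| m^`().
    by rewrite [in X in X %| _]em ec mul_polyC dvdpZl // dvdp_gcdr.
  move/(dvdp_leq n0); rewrite leqNgt lt_size_deriv //; exact: minpoly_neq0 hm.
have lcn : (deg M y)%:R = 0 :> F.
  have := congr1 (fun p : {poly F} => p`_(deg M y).-1) d0.
  rewrite coef_deriv coef0 prednK ?deg_gt0 // => h.
  have /monicP := minpoly_monic hm; rewrite lead_coefE -/(deg M y) => lc.
  by rewrite lc in h.
have [q qc] : exists q, q \in [pchar F].
  by apply: natf0_pchar (deg_gt0 hM (algM y)) _; apply/eqP.
(* R is the polynomial with minp M y = R(X^q), so that R annihilates y^q. *)
exists q => //; have qp := pcharf_prime qc.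
pose R := \poly_(i < (deg M y %/ q).+1) m`_(q * i).
have mR : m = R \Po 'X^q.
  apply/polyP => i; rewrite coef_comp_poly_Xn ?prime_gt0 //.
  rewrite coef_poly; case: ifP => [/dvdnP[j ->]|nd].
    rewrite mulnK ?prime_gt0 // mulnC ltnS; case: leqP => // lt.
    rewrite nth_default // size_minp // -/m.
    by rewrite mulnC -ltn_divLR ?prime_gt0.
  case: i nd => [|i nd]; first by rewrite dvdn0.
  have := congr1 (fun p : {poly F} => p`_i) d0; rewrite coef_deriv coef0 -mulr_natr.
  move/eqP; rewrite mulf_eq0 -(dvdn_pcharf qc) nd orbF => /eqP ->.
  by [].
have RM : R \is a polyOver (mem M).
  apply/(polyE hM) => i; rewrite coef_poly; case: ifP => _; last exact: sf0.
  by move/(polyE hM): mM; apply.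
have R0 : R != 0.
  by apply: contraTneq (minpoly_neq0 hm) => R0; rewrite mR R0 comp_poly0 eqxx.
have rR : root R (y ^+ q).
  have := minpoly_root hm; rewrite mR !rootE horner_comp hornerXn //.
have lt := deg_root hM RM R0 rR.
have sR : (size R <= (deg M y %/ q).+1)%N by apply: size_poly.
have l2 : (deg M y %/ q < deg M y)%N.
  by rewrite ltn_Pdiv ?prime_gt1 ?deg_gt0.
by apply: leq_ltn_trans l2; rewrite -ltnS (leq_trans lt sR).
Qed.
End Galois.

(** The case of several separable generators reduces to that of a single one by
    adjoining them in turn. *)
Lemma fixed_in (F : closedFieldType) (M : set F) (cs : seq F) u : subfield M ->
  (forall y, algebraic_over M y) -> (forall c, c \in cs -> sep_over M c) ->
  adjoin M [set c | c \in cs] u -> (forall rho, fixes M rho -> rho u = u) -> M u.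
Proof.
move=> hM algM; elim: cs u => [|c cs IH] u sc uc fu.
  by move: u uc {fu}; apply: adjoin_min => //; move=> z.
have hA := adjoin_subfield M [set c | c \in cs].
apply: IH => // [d dc|]; first by apply: sc; rewrite inE dc orbT.
apply: (@fixed_simple F _ hA _ c).
- by move=> y; apply: algebraic_mono (algM y); apply: adjoin_base.
- by apply: sep_over_mono (sc c (mem_head _ _)); apply: adjoin_base.
- move: u uc {fu}; apply: adjoin_min; first exact: adjoin_subfield.
    by move=> z Mz; do 2!apply: adjoin_base.
  move=> z /=; rewrite inE => /orP[/eqP ->|zc]; first exact: adjoin_elt.
  by apply: adjoin_base; apply: adjoin_gen.
- by move=> rho h; apply: fu; apply: fixes_mono h; apply: adjoin_base.
Qed.

(** * Base change to a transcendental element *)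

Section TranscendentalBase.
Variables (F : closedFieldType) (K E : set F) (x : F).
Hypotheses (hK : subfield K) (trx : ~ algebraic_over K x).
Hypotheses (hE : subfield E) (sKE : K `<=` E) (sE : E `<=` alg_closure K).
Local Notation Ex := (adjoin E [set x]).

Lemma alg_closure_inter : alg_closure E = alg_closure K.
Proof.
apply/seteqP; split=> y /=; last exact: algebraic_mono.
by move=> yE; apply: (alg_trans hK); apply: algebraic_mono yE.
Qed.

Lemma adjoin_trans_in c : alg_closure K c -> Ex c -> E c.
Proof. exact: adjoin_trans_alg. Qed.

(** The roots of the minimal polynomial of c over E(x) are algebraic over K, hence so
    are its coefficients; being in E(x), they lie in E. This makes it possible to apply
    Galois theory, which requires F to be algebraic over the base field, to fields that
    are algebraic over K. *)
Lemma minp_trans c : alg_closure K c -> minp Ex c = minp E c.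
Proof.
move=> cK; have hEx := adjoin_subfield E [set x].
have cE : algebraic_over E c by apply: algebraic_mono cK.
have cEx : algebraic_over Ex c by apply: algebraic_mono cE; apply: adjoin_base.
have hm := minpP hE cE; have hm' := minpP hEx cEx.
have d : minp Ex c %| minp E c.
  apply: (minpoly_dvd hEx hm'); last exact: minpoly_root hm.
  by apply: pol_mono (minpoly_over hm); apply: adjoin_base.
have hA := alg_closure_subfield hK.
have mA : minp Ex c \is a polyOver (mem (alg_closure K)).
  have [r e] := closed_splits (minpoly_monic hm'); rewrite e.
  have : forall z, z \in r -> alg_closure K z.
    move=> z zr; rewrite -alg_closure_inter; exists (minp E c).
      by split; [exact: minpoly_over hm | exact: minpoly_neq0 hm].
    by case/dvdpP: d => a ->; rewrite rootM e root_prod_XsubC zr orbT.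
  elim: (r) => [|z s IH] h; first by rewrite big_nil; apply: pol1.
  rewrite big_cons; apply: (polM hA); last by apply: IH => y ys; apply: h; rewrite inE ys orbT.
  by apply: (polB hA); [exact: polX | apply: (polC hA); apply: h; rewrite mem_head].
apply: (minpoly_eq hE hm).
- exact: minpoly_monic hm'.
- apply/(polyE hE) => i; apply: adjoin_trans_in.
    by move/(polyE hA): mA; apply.
  by move/(polyE hEx): (minpoly_over hm'); apply.
- exact: minpoly_root hm'.
- by apply: dvdp_leq d; apply: minpoly_neq0 hm.
Qed.

Lemma deg_trans c : alg_closure K c -> deg Ex c = deg E c.
Proof. by move=> cK; rewrite /deg minp_trans. Qed.

End TranscendentalBase.

(** * Valuations on algebraic extensions *)

Section ValuationGalois.
Variables (F : fieldType) (G : oagType) (v : valuation F G).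
Local Notation v0 := (VFin 0 : value G).

(** In a relation p(y) = 0 the least value is attained by two of the terms a_i y^i and
    a_j y^j, and v(y^(j-i)) = v(a_i / a_j). *)
Lemma val_torsion (M : set F) y : subfield M -> algebraic_over M y -> y != 0 ->
  exists k d, [/\ (0 < k)%N, M d, d != 0 & v (y ^+ k) = v d].
Proof.
move=> hM [p [pM p0] /rootP rp] y0.
have sp : (0 < size p)%N by rewrite size_poly_gt0.
pose t (i : 'I_(size p)) := p`_i * y ^+ i.
have last_lt : ((size p).-1 < size p)%N by rewrite prednK.
pose il := Ordinal last_lt.
have tl : t il != 0 by rewrite mulf_neq0 ?expf_neq0 // -lead_coefE lead_coef_eq0.
pose i0 := [arg min_(i < il) v (t i)]%O.
have i0min j : v (t i0) <= v (t j).
  by rewrite /i0; case: (@arg_minP _ _ _ il xpredT (fun i => v (t i))) => //= i _; apply.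
have t0 : t i0 != 0 by apply: vneq0_le (i0min il) tl.
have [j ji ej] : exists2 j, j != i0 & v (t j) = v (t i0).
  apply/not_exists2P => h.
  have : v (t i0) < v (\sum_(j | j != i0) t j).
    apply: vsum_gt => [|j ji]; first by rewrite vlt_Inf.
    rewrite lt_neqAle i0min andbT; case: (h j) => // /eqP; by rewrite eq_sym.
  rewrite horner_coef (bigD1 i0) //= in rp.
  move/eqP: rp; rewrite addrC addr_eq0 => /eqP ->.
  by rewrite Defs.valN ltxx.
have tj : t j != 0 by rewrite -(vlt_Inf v) ej vlt_Inf.
have key (a b : 'I_(size p)) : v (t a) = v (t b) -> t a != 0 -> t b != 0 -> (a < b)%N ->
    exists k d, [/\ (0 < k)%N, M d, d != 0 & v (y ^+ k) = v d].
  move=> e ta tb ab; exists (b - a)%N, (p`_a / p`_b).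
  have pa : p`_a != 0 by apply: contraNneq ta; rewrite /t => ->; rewrite mul0r.
  have pb : p`_b != 0 by apply: contraNneq tb; rewrite /t => ->; rewrite mul0r.
  split; first by rewrite subn_gt0.
  - by apply: (sf_div hM); move/(polyE hM): pM; apply.
  - by rewrite mulf_neq0 ?invr_eq0.
  have n0 : p`_b * y ^+ a != 0 by rewrite mulf_neq0 ?expf_neq0.
  apply: (vM2l_inj n0).
  have -> : p`_b * y ^+ a * y ^+ (b - a) = t b by rewrite -mulrA -exprD subnKC // ltnW.
  have -> : p`_b * y ^+ a * (p`_a / p`_b) = t a by rewrite mulrC mulrA divfK.
  by rewrite e.
case: (ltngtP j i0) => [lt|gt|/val_inj e].
- exact: key ej tj t0 lt.
- exact: key (esym ej) t0 tj gt.
- by rewrite e eqxx in ji.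
Qed.

(** Divide by a coefficient of least value. *)
Lemma primitive_multiple (M : set F) p : subfield M -> p \is a polyOver (mem M) -> p != 0 ->
  exists c, [/\ M c, c != 0, forall i, v0 <= v (c *: p)`_i &
    exists2 i, (i < size p)%N & (c *: p)`_i = 1].
Proof.
move=> hM pM p0.
have last_lt : ((size p).-1 < size p)%N by rewrite prednK // size_poly_gt0.
pose il := Ordinal last_lt.
pose i0 := [arg min_(i < il) v p`_i]%O.
have i0min (j : 'I_(size p)) : v p`_i0 <= v p`_j.
  by rewrite /i0; case: (@arg_minP _ _ _ il xpredT (fun i : 'I__ => v p`_i)) => //= i _; apply.
have n0 : p`_i0 != 0.
  by apply: vneq0_le (i0min il) _; rewrite -lead_coefE lead_coef_eq0.
exists (p`_i0)^-1; split; last by exists i0; rewrite // coefZ mulVf.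
- by apply: (sfV hM); move/(polyE hM): pM; apply.
- by rewrite invr_eq0.
move=> i; rewrite coefZ mulrC vdiv_ge0 //; case: (ltnP i (size p)) => [lt|ge].
  exact: (i0min (Ordinal lt)).
by rewrite [X in _ <= v X]nth_default // Defs.val0 vVInf_max.
Qed.

Lemma prod_XsubC_ge0 (s : seq F) : (forall r, r \in s -> v0 <= v r) ->
  forall i, v0 <= v (\prod_(r <- s) ('X - r%:P))`_i.
Proof.
elim: s => [|r s IH] h i.
  by rewrite big_nil coef1; case: eqP; rewrite ?Defs.val1 ?Defs.val0 ?lexx ?vVInf_max.
rewrite big_cons mulrBl coefB coefXM coefCM; apply: vB_ge.
  case: i => [|i] /=; first by rewrite Defs.val0 vVInf_max.
  by apply: IH => z zs; apply: h; rewrite inE zs orbT.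
apply: vM_ge0; first by apply: h; rewrite mem_head.
by apply: IH => z zs; apply: h; rewrite inE zs orbT.
Qed.

Lemma prod_XsubC_gt0 (s : seq F) : (forall r, r \in s -> v0 < v r) ->
  forall i, (i < size s)%N -> v0 < v (\prod_(r <- s) ('X - r%:P))`_i.
Proof.
elim: s => [//|r s IH] h i /= lt.
have hs z : z \in s -> v0 < v z by move=> zs; apply: h; rewrite inE zs orbT.
rewrite big_cons mulrBl coefB coefXM coefCM; apply: vB_gt.
  case: i lt => [|i] lt /=; first by rewrite Defs.val0 (v0_lt_Inf v).
  exact: IH.
apply: vM_gt0l; first by apply: h; rewrite mem_head.
by apply: prod_XsubC_ge0 => z /hs /ltW.
Qed.

Lemma integral_root_ge0 p u : p \is monic -> (forall i, v0 <= v p`_i) -> root p u ->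
  v0 <= v u.
Proof.
move=> pm h /rootP rp; rewrite leNgt; apply/negP => lt.
have u0 : u != 0 by apply: vneq0_lt lt.
have sp : size p = (size p).-1.+1.
  by rewrite prednK // size_poly_gt0 monic_neq0.
move: rp; rewrite horner_coef sp big_ord_recr /= -lead_coefE (monicP pm) mul1r.
move/eqP; rewrite addrC addr_eq0 => /eqP e.
have : v (u ^+ (size p).-1) < v (\sum_(i < (size p).-1) p`_i * u ^+ i).
  apply: vsum_gt => [|i _]; first by rewrite vlt_Inf expf_neq0.
  apply: lt_le_trans (vleMr _ (h i)).
  have -> : u ^+ i = u ^- ((size p).-1 - i) * u ^+ (size p).-1.
    by rewrite -[X in _ * u ^+ X](subnK (ltnW (ltn_ord i))) exprD mulKf ?expf_neq0.
  rewrite -{1}[u ^+ _]mul1r ![_ * u ^+ (size p).-1]mulrC.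
  rewrite vltM2lE ?expf_neq0 // Defs.val1 -exprVn vX_gt0 ?subn_gt0 //.
  by rewrite vV_lt0.
by rewrite e Defs.valN ltxx.
Qed.

Lemma integral_root_gt0 p u : p \is monic ->
  (forall i, (i < (size p).-1)%N -> v0 < v p`_i) -> (1 < size p)%N -> root p u -> v0 < v u.
Proof.
move=> pm h s1 /rootP rp; rewrite ltNge; apply/negP => le.
have u0 : u != 0 by apply: (@vneq0_le _ _ v _ 1); rewrite ?oner_neq0 ?Defs.val1.
have sp : size p = (size p).-1.+1.
  by rewrite prednK // size_poly_gt0 monic_neq0.
move: rp; rewrite horner_coef sp big_ord_recr /= -lead_coefE (monicP pm) mul1r.
move/eqP; rewrite addrC addr_eq0 => /eqP e.
have : v (u ^+ (size p).-1) < v (\sum_(i < (size p).-1) p`_i * u ^+ i).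
  apply: vsum_gt => [|i _]; first by rewrite vlt_Inf expf_neq0.
  have : v (u ^+ (size p).-1) <= v (u ^+ i).
    have -> : u ^+ i = u ^- ((size p).-1 - i) * u ^+ (size p).-1.
      by rewrite -[X in _ * u ^+ X](subnK (ltnW (ltn_ord i))) exprD mulKf ?expf_neq0.
    apply: vleMr; rewrite -exprVn; apply: vX_ge0; by rewrite vV_le0.
  move/le_lt_trans; apply.
  rewrite -{1}[u ^+ i]mul1r ![_ * u ^+ i]mulrC vltM2lE ?expf_neq0 // Defs.val1.
  exact: h.
by rewrite e Defs.valN ltxx.
Qed.

Definition pullback_val (rho : {rmorphism F -> F}) : F -> value G := fun u => v (rho u).

Lemma pullback_valP rho L : valuation_on L (pullback_val rho).
Proof.
rewrite /pullback_val; split=> [y _|y _|y z _ _|y z _ _].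
- split; first by move/val_eqInf/eqP; rewrite fmorph_eq0 => /eqP.
  by move=> ->; rewrite rmorph0 Defs.val0.
- exact: val_neqNInf.
- by rewrite rmorphM Defs.valM.
- by rewrite rmorphD; apply: Defs.valD.
Qed.

Definition pullback rho : valuation F G := Valuation (pullback_valP rho setT).

(** As v is unibranched on the algebraic closure of K, v o rho and v define the same
    order there. The values themselves agree because some power of u has the value of an
    element of K, which rho fixes. *)
Lemma henselian_fix K rho u : subfield K -> henselian v K -> fixes K rho ->
  alg_closure K u -> v (rho u) = v u.
Proof.
move=> hK hens fr uK; case: (eqVneq u 0) => [->|u0]; first by rewrite rmorph0.
have eqv := hens G (pullback_val rho) (pullback_valP rho _).
have {}eqv : equivalent_on (alg_closure K) (pullback_val rho) v.
  by apply: eqv => y z Ky Kz; rewrite /pullback_val !fr.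
have [k [d [k0 Kd d0 e]]] := val_torsion hK uK u0.
have hA := alg_closure_subfield hK.
have Au : alg_closure K (u ^+ k) by apply: (sfX hA).
have Ad : alg_closure K d by apply: alg_sub.
apply: (vX_inj k0); rewrite -rmorphXn /=.
apply: le_anti; move: (eqv _ _ Au Ad) (eqv _ _ Ad Au).
rewrite /pullback_val (fr d) // e lexx => h1 h2. by rewrite h1 h2.
Qed.
End ValuationGalois.

(** When all conjugates of u have the same value, the minimal polynomial of an integral
    u has integral coefficients, by Vieta. These are integral for every other extension
    w of v from E as well, hence so is u: the valuation ring of v lies in that of w, and
    likewise for the maximal ideals. *)
Lemma henselian_crit (F : closedFieldType) (G : oagType) (v : valuation F G) (E : set F) :
  subfield E -> (forall y, algebraic_over E y) ->
  (forall rho u, fixes E rho -> v (rho u) = v u) -> henselian v E.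
Proof.
move=> hE algE inv G' w hw eqv.
have AT : alg_closure E = setT by apply/seteqP; split=> // y _; apply: algE.
rewrite AT in hw *; pose w' := Valuation hw.
have eqv' y z : E y -> E z -> (w' y <= w' z) = (v y <= v z) by apply: eqv.
have eqv2 y z : E y -> E z -> (w' y < w' z) = (v y < v z).
  by move=> Ey Ez; rewrite !ltNge eqv'.
have conjv u r : root (minp E u) r -> v r = v u.
  by case/(conj_exists hE algE) => rho h <-; apply: inv.
have E1 := sf1 hE.
have ge0 u : VFin 0 <= v u -> VFin 0 <= w' u.
  move=> h; have hm := minpP hE (algE u).
  apply: integral_root_ge0 (minpoly_monic hm) _ (minpoly_root hm) => i.
  rewrite -(Defs.val1 w') eqv' //; last by move/(polyE hE): (minpoly_over hm); apply.
  have [r e] := closed_splits (minpoly_monic hm).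
  rewrite Defs.val1 e; apply: prod_XsubC_ge0 => z zr.
  by rewrite (conjv u) // e root_prod_XsubC.
have gt0 u : VFin 0 < v u -> VFin 0 < w' u.
  move=> h; have hm := minpP hE (algE u).
  apply: integral_root_gt0 (minpoly_monic hm) _ (minpoly_size hm) (minpoly_root hm) => i.
  rewrite -(Defs.val1 w') eqv2 //; last by move/(polyE hE): (minpoly_over hm); apply.
  have [r e] := closed_splits (minpoly_monic hm).
  rewrite Defs.val1 e size_prod_XsubC => lt; apply: prod_XsubC_gt0 => // z zr.
  by rewrite (conjv u) // e root_prod_XsubC.
move=> y z _ _; rewrite -[w y]/(w' y) -[w z]/(w' z).
case: (eqVneq y 0) => [->|y0].
  rewrite !Defs.val0; apply/idP/idP => h.
    have z0 : w' z = VInf by apply: le_anti; rewrite vVInf_max.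
    by move/val_eqInf: z0 => ->; rewrite Defs.val0.
  have z0 : v z = VInf by apply: le_anti; rewrite vVInf_max.
  by move/val_eqInf: z0 => ->; rewrite Defs.val0.
rewrite -!vdiv_ge0 //; apply/idP/idP; last exact: ge0.
case: (eqVneq (z / y) 0) => [->|zy0]; first by rewrite !Defs.val0.
apply: contraTT; rewrite -!ltNge -!vV_lt0 //; exact: gt0.
Qed.

(** * Conjugacy of the extensions of a valuation *)

Lemma oag_mulrn_inj (G : oagType) (g h : G) k : (0 < k)%N -> g *+ k = h *+ k -> g = h.
Proof.
have lt (a b : G) : a < b -> forall n, a *+ n.+1 < b *+ n.+1.
  move=> ab; elim=> [|n IH]; first by rewrite !mulr1n.
  rewrite [a *+ _]mulrS [b *+ _]mulrS.
  exact: lt_trans (oag_ltD2l a IH) (oag_ltD2r _ ab).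
case: k => // k _ e; case/orP: (oag_total g h); rewrite le_eqVlt => /orP[/eqP//|] l.
  by have := lt _ _ l k; rewrite e ltxx.
by have := lt _ _ l k; rewrite e ltxx.
Qed.

Section Gauss.
Variables (F : fieldType) (G : oagType) (v : valuation F G).
Local Notation v0 := (VFin 0 : value G).
Implicit Types p q : {poly F}.

Definition int_poly p := forall i, v0 <= v p`_i.
Definition primitive p := int_poly p /\ exists i, v p`_i = v0.

Lemma int_polyM p q : int_poly p -> int_poly q -> int_poly (p * q).
Proof.
by move=> hp hq i; rewrite coefM; apply: vsum_ge => j _; apply: vM_ge0.
Qed.

(** Gauss's lemma: the product of the first unit coefficients of p and q is the only
    term of value 0 in a coefficient of p q. *)
Lemma gauss p q : primitive p -> primitive q -> primitive (p * q).
Proof.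
move=> [hp ep] [hq eq]; split; first exact: int_polyM.
have first_unit (r : {poly F}) : int_poly r -> (exists i, v r`_i = v0) ->
    exists i, v r`_i = v0 /\ forall j, (j < i)%N -> v0 < v r`_j.
  move=> hr [i ei]; have ex : exists i, v r`_i == v0 by exists i; apply/eqP.
  case: (ex_minnP ex) => k /eqP ek km; exists k; split=> // j jk.
  rewrite lt_neqAle hr andbT eq_sym; apply/negP => /km; by rewrite leqNgt jk.
have [i [ei li]] := first_unit _ hp ep; have [j [ej lj]] := first_unit _ hq eq.
exists (i + j)%N; rewrite coefM.
have hi : (i < (i + j).+1)%N by rewrite ltnS leq_addr.
rewrite (bigD1 (Ordinal hi)) //= addKn vD_ltl; first exact: vM_eq0.
rewrite (vM_eq0 ei ej); apply: vsum_gt; first exact: (v0_lt_Inf v).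
move=> l; rewrite -val_eqE /= neq_ltn => /orP[lt|gt].
  by apply: vM_gt0l; first exact: li.
apply: vM_gt0r => //; apply: lj; have := ltn_ord l; lia.
Qed.

Lemma gauss_prod (T : eqType) (s : seq T) (f : T -> {poly F}) :
  (forall c, c \in s -> primitive (f c)) -> primitive (\prod_(c <- s) f c).
Proof.
move=> h; rewrite big_seq; elim/big_ind: _ => //; last exact: gauss.
split=> [i|]; last by exists 0%N; rewrite coefC Defs.val1.
by rewrite coefC; case: eqP; rewrite ?Defs.val1 ?Defs.val0 ?lexx ?vVInf_max.
Qed.

Lemma int_poly_prod (T : eqType) (s : seq T) (f : T -> {poly F}) :
  (forall c, c \in s -> int_poly (f c)) -> int_poly (\prod_(c <- s) f c).
Proof.
move=> h; rewrite big_seq; elim/big_ind: _ => //; last exact: int_polyM.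
by move=> i; rewrite coefC; case: eqP; rewrite ?Defs.val1 ?Defs.val0 ?lexx ?vVInf_max.
Qed.

(** Let a_k be the last unit among the coefficients a_i of a primitive polynomial
    annihilating t, and put b = sum_(i >= k) a_i t^(i-k) = - sum_(i < k) a_i t^(i-k).
    The first expression is a unit for the extensions that are nonnegative at t, and the
    second has positive value for the others. Thus a single element of M(t) separates
    these two kinds of extensions of v from M. *)
Lemma locating_element (M : set F) t : subfield M -> algebraic_over M t ->
  exists b, adjoin M [set t] b /\ forall nu : valuation F G, (forall u, M u -> nu u = v u) ->
    (v0 <= nu t -> nu b = v0) /\ (nu t < v0 -> v0 < nu b).
Proof.
move=> hM [p [pM p0] /rootP rp].
have [c [Mc c0 a_ge0 [i0 i0s e1]]] := primitive_multiple v hM pM p0.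
pose a i := (c *: p)`_i.
have aM i : M (a i) by have /(polyE hM) := polZ hM Mc pM; apply.
have sum0 : \sum_(i < size p) a i * t ^+ i = 0.
  by have := horner_coef (c *: p) t; rewrite hornerZ rp mulr0 size_scale.
pose Pk i := (i < size p)%N && (v (a i) == v0).
have exP : exists i, Pk i.
  by exists i0; rewrite /Pk i0s /a e1 Defs.val1 eqxx.
have bP i : Pk i -> (i <= size p)%N by move=> /andP[/ltnW].
case: (ex_maxnP exP bP) => k /andP[ks /eqP ak] kmax.
have a_gt0 i : (k < i)%N -> v0 < v (a i).
  move=> ki; rewrite lt_neqAle a_ge0 andbT eq_sym; apply/negP => e.
  case: (ltnP i (size p)) => [lt|ge].
    by have := kmax i; rewrite /Pk lt e => /(_ isT); rewrite leqNgt ki.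
  have ai0 : a i = 0 by rewrite /a nth_default // size_scale.
  by move: e; rewrite ai0 (Defs.val0 v).
pose b := \sum_(k <= i < size p) a i * t ^+ (i - k).
have e : b * t ^+ k = - \sum_(0 <= i < k) a i * t ^+ i.
  apply/eqP; rewrite -addr_eq0 addrC; apply/eqP.
  rewrite -[RHS]sum0 -[RHS](big_mkord xpredT (fun i => a i * t ^+ i)).
  rewrite [RHS](@big_cat_nat _ _ _ k) //=; last exact: ltnW.
  congr (_ + _); rewrite /b mulr_suml; apply: eq_big_nat => i /andP[ki _].
  by rewrite -mulrA -exprD subnK.
have hA := adjoin_subfield M [set t].
exists b; split.
  rewrite /b; apply: (sf_sum hA) => i _; apply: (sfM hA); first exact: adjoin_base.
  by apply: (sfX hA); apply: adjoin_elt.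
move=> nu hnu; split=> h.
  have hk : nu (a k) = v0 by rewrite hnu.
  rewrite /b big_ltn // subnn expr0 mulr1 vD_ltl // hk big_seq.
  apply: vsum_gt; first exact: (v0_lt_Inf v).
  move=> i; rewrite mem_index_iota => /andP[ki _].
  by apply: vM_gt0l; [rewrite hnu // a_gt0 | apply: vX_ge0].
have t0 : t != 0 by apply: vneq0_lt h.
have -> : b = - \sum_(0 <= i < k) a i * t^-1 ^+ (k - i).
  apply: (mulIf (expf_neq0 k t0)); rewrite e mulNr mulr_suml; congr (- _).
  apply: eq_big_nat => i /andP[_ ik]; rewrite -[RHS]mulrA; congr (_ * _).
  have -> : t ^+ k = t ^+ (k - i) * t ^+ i by rewrite -exprD subnK // ltnW.
  by rewrite mulrA -exprMn mulVf // expr1n mul1r.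
rewrite Defs.valN big_seq; apply: vsum_gt; first exact: (v0_lt_Inf v).
move=> i; rewrite mem_index_iota => /andP[_ ik].
apply: vM_gt0r; first by rewrite hnu.
by rewrite vX_gt0 ?subn_gt0 // vV_lt0.
Qed.
End Gauss.

Section Conjugation.
Variables (F : closedFieldType) (G : oagType).
Local Notation v0 := (VFin 0 : value G).

Lemma fixes_agree (M : set F) y (r s : {rmorphism F -> F}) : fixes M r -> fixes M s ->
  r y = s y -> forall u, adjoin M [set y] u -> r u = s u.
Proof.
move=> hr hs e; pose N := [set u | r u = s u].
suff : adjoin M [set y] `<=` N by [].
apply: adjoin1_min => //; last by move=> u Mu; rewrite /N /= hr ?hs.
apply: subfieldP => [|u w|u w]; rewrite /N /=.
- by rewrite !rmorph1.
- by rewrite !rmorphB => -> ->.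
- by rewrite !fmorph_div => -> ->.
Qed.

(** If every nu-integral element of A were v-integral, the units for nu would be units
    for v. Since a power of every element has the value of an element of M, nu and v
    would then agree on A. *)
Lemma valuation_distinct (v nu : valuation F G) (M A : set F) : subfield M -> subfield A ->
  M `<=` A -> A `<=` alg_closure M -> (forall u, M u -> nu u = v u) ->
  ~ (forall u, A u -> nu u = v u) -> exists t, [/\ A t, v0 <= nu t & v t < v0].
Proof.
move=> hM hA MA AM agr nagr; apply/not_notP => nex; apply: nagr.
have dom t : A t -> v0 <= nu t -> v0 <= v t.
  by move=> At nt; rewrite leNgt; apply/negP => vt; apply: nex; exists t.
move=> u Au; case: (eqVneq u 0) => [->|u0]; first by rewrite !Defs.val0.
have [k [d [k0 Md d0 e]]] := val_torsion nu hM (AM _ Au) u0.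
have uk0 : u ^+ k != 0 by rewrite expf_neq0.
have ne : nu (u ^+ k / d) = v0 by apply/vdiv_eq0.
have Ae : A (u ^+ k / d) by apply: (sf_div hA); [apply: (sfX hA) | apply: MA].
have ve : v (u ^+ k / d) = v0.
  apply: le_anti; rewrite (dom _ Ae) ?ne // andbT -vV_le0 ?mulf_neq0 ?invr_eq0 //.
  by apply: dom; [apply: (sfV hA) | rewrite vV0].
move/vdiv_eq0: ve => /(_ d0) ve.
have [g eg] := val_fin nu u0; have [h eh] := val_fin v u0.
rewrite eg eh; congr VFin; apply: (oag_mulrn_inj k0).
have := etrans e (etrans (agr _ Md) (esym ve)).
by rewrite (vX_VFin _ eg) (vX_VFin _ eh) => -[].
Qed.

Variables (v w : valuation F G).

(** Suppose that w o T differs from v on M(y) for every embedding T over M. To the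
    conjugate c = T_c(y) of y there is then an element b_c of M(y) that is integral for
    all extensions of v from M, a unit for w o T_c, and of positive value for v. The
    polynomial Z with coefficients b_c is primitive for all w o T_c, so by Gauss's lemma
    the product of its conjugates is primitive for w. But its coefficients are
    invariant, so a power of each lies in M, where v and w agree, and they have positive
    value for v since the factor Z does: a contradiction. *)
Lemma val_conj_simple (M : set F) y : subfield M -> (forall y, algebraic_over M y) ->
  (forall u, M u -> w u = v u) ->
  exists tau, fixes M tau /\ forall u, adjoin M [set y] u -> w (tau u) = v u.
Proof.
move=> hM algM agr; apply/not_notP => nex.
set A := adjoin M [set y] in nex.
have hA : subfield A := adjoin_subfield _ _.
have MA : M `<=` A := @adjoin_base _ _ _.
pose C := conjugates M y.
have exT c : exists tau : {rmorphism F -> F}, c \in C -> fixes M tau /\ tau y = c.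
  case: (boolP (c \in C)) => [/(conjP hM algM)[tau h e]|_]; last by exists idfun.
  by exists tau.
pose T c := sval (cid (exT c)).
have TP c : c \in C -> fixes M (T c) /\ T c y = c by apply: (svalP (cid (exT c))).
have exb c : exists b, c \in C -> A b /\ forall nu : valuation F G,
    (forall u, M u -> nu u = v u) -> v0 <= nu b /\
    ((forall u, nu u = w (T c u)) -> nu b = v0) /\ ((forall u, A u -> nu u = v u) -> v0 < nu b).
  case: (boolP (c \in C)) => [cC|_]; last by exists 0.
  have [fT eT] := TP c cC.
  have [|||t [At nt vt]] := @valuation_distinct v (pullback w (T c)) M A hM hA MA.
  - by move=> u _; apply: algM.
  - by move=> u Mu; rewrite /= /pullback_val fT ?agr.
  - by move=> h; apply: nex; exists (T c).
  have [b [tb hb]] := locating_element v hM (algM t).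
  exists b => _; split.
    by apply: adjoin1_min tb.
  move=> nu hnu; have [h1 h2] := hb nu hnu; split; [|split].
  - by case: (leP v0 (nu t)) => [/h1 ->|/h2 /ltW //]; rewrite lexx.
  - by move=> e; apply: h1; rewrite e.
  - by move=> e; apply: h2; rewrite e.
pose b c := sval (cid (exb c)).
have bP c : c \in C -> _ := svalP (cid (exb c)).
(* Z stores the finite family of the b_c as coefficients; the order in which they appear
   is immaterial. *)
pose Z := \poly_(i < size C) b (nth 0 C i).
pose Zt c : {poly F} := map_poly (T c) Z.
pose P : {poly F} := \prod_(c <- C) Zt c.
have ZA i : A Z`_i.
  rewrite coef_poly; case: ifP => lt; last exact: sf0.
  by have [] := bP _ (mem_nth 0 lt).
have intT (nu : valuation F G) tau : (forall u, M u -> nu u = v u) -> fixes M tau ->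
    int_poly nu (map_poly tau Z).
  move=> hnu ft i; rewrite coef_map coef_poly /=; case: ifP => lt; last first.
    by rewrite rmorph0 Defs.val0 vVInf_max.
  have [_ /(_ (pullback nu tau))[|]] := bP _ (mem_nth 0 lt) => //.
  by move=> u Mu; rewrite /= /pullback_val ft ?hnu.
have [Pint [k ek]] : primitive w P.
  apply: gauss_prod => c cC; have [fT eT] := TP c cC.
  split; first exact: intT.
  exists (index c C); rewrite coef_map coef_poly index_mem cC nth_index //.
  have [_ /(_ (pullback w (T c)))[|_ [h _]]] := bP _ cC.
    by move=> u Mu; rewrite /= /pullback_val fT ?agr.
  exact: h.
have fP tau : fixes M tau -> tau P`_k = P`_k.
  move=> ft; rewrite -coef_map; suff -> : map_poly tau P = P by [].
  transitivity (\prod_(c <- map tau C) Zt c); last first.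
    have pe := conj_perm hM algM y ft.
    by rewrite (perm_big _ pe).
  rewrite rmorph_prod /= big_map; apply: eq_big_seq => c cC; rewrite /Zt -map_poly_comp.
  have [fT eT] := TP _ cC; have [fT' eT'] := TP _ (conj_hom hM algM ft cC).
  apply/polyP => i; rewrite !coef_map /=.
  apply: (@fixes_agree M y (tau \o T c : {rmorphism F -> F})) => //.
    by move=> u Mu; rewrite /= fT // ft.
    by rewrite /= eT eT'.
  exact: ZA.
have [n n0 Mn] := fixed_power hM algM fP.
have : v0 < v P`_k.
  rewrite /P (perm_big _ (perm_to_rem (conj_self hM algM y))) /= big_cons coefM.
  apply: vsum_gt; first exact: (v0_lt_Inf v).
  move=> i _; apply: vM_gt0l; last first.
    apply: int_poly_prod => c /mem_rem cC; apply: intT => //.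
    by have [] := TP _ cC.
  have yC := conj_self hM algM y; have [fT eT] := TP _ yC.
  have Tid u : A u -> T y u = u.
    by apply: (@fixes_agree M y (T y) idfun fT).
  rewrite coef_map /= Tid // coef_poly; case: ifP => lt; last by rewrite Defs.val0 (v0_lt_Inf v).
  by have [_ /(_ v)[//|_ [_ h]]] := bP _ (mem_nth 0 lt); apply: h.
rewrite -(vX_gt0 v _ n0) -agr // ltNge => /negP; apply.
rewrite le_eqVlt; apply/orP; left; apply/eqP.
have := vX_eq n (etrans ek (esym (Defs.val1 w))).
by rewrite expr1n Defs.val1.
Qed.
End Conjugation.

(** Any two extensions of a valuation to an algebraically closed field are conjugate
    over the base field. The simple extensions of the preceding lemma are put together
    by Zorn's lemma. *)
Theorem val_conj (F : closedFieldType) (G : oagType) (v w : valuation F G) (M : set F) :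
  subfield M -> (forall y, algebraic_over M y) -> (forall u, M u -> w u = v u) ->
  exists tau, fixes M tau /\ forall u, w (tau u) = v u.
Proof.
move=> hM algM agr.
have [||tau [h1 h2]] := @hom_extend F (fun u u' => w u' = v u) M id; last by exists tau.
  by split.
move=> N phi [hN sub hphi e hv] y _.
have algN z : algebraic_over N z by apply: algebraic_mono (algM z).
have [Phi hPhi] := hom_extend_alg hN algN hphi.
have [|tau [ft ht]] := @val_conj_simple F G v (pullback w Phi) N y hN algN.
  by move=> u Nu; rewrite /= /pullback_val hPhi // hv.
exists (adjoin N [set y]), (Phi \o tau); split.
- split.
  + exact: adjoin_subfield.
  + by move=> u /sub; apply: adjoin_base.
  + exact: (@rmorph_hom_on _ _ (Phi \o tau : {rmorphism F -> F})).
  + by move=> u Mu; rewrite /= ft ?hPhi ?e //; apply: sub.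
  + by move=> u uA; apply: (ht u uA).
- exact: adjoin_base.
- exact: adjoin_elt.
- by move=> u Nu; rewrite /= ft // hPhi.
Qed.

(** * Residue fields *)

Section Residue.
Variables (F : fieldType) (G : oagType) (v : valuation F G).
Local Notation v0 := (VFin 0 : value G).
Local Notation res := (residue_map v).

Lemma in_vring y : v0 <= v y -> y \in vring_pred v. Proof. by rewrite inE. Qed.

Lemma resE y (h : v0 <= v y) :
  res y = (\pi_({ideal_quot (@vmax F G v)}) (VRing (in_vring h)))%qT.
Proof.
rewrite /residue_map; congr (\pi_({ideal_quot (@vmax F G v)}) _)%qT.
by apply: val_inj; rewrite /= insubdK // in_vring.
Qed.

Lemma resB y z : v0 <= v y -> v0 <= v z -> res (y - z) = res y - res z.
Proof.
move=> hy hz; have h := vB_ge hy hz.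
rewrite (resE hy) (resE hz) (resE h) -[RHS]rmorphB.
by congr (\pi_({ideal_quot (@vmax F G v)}) _)%qT; apply: val_inj.
Qed.

Lemma resM y z : v0 <= v y -> v0 <= v z -> res (y * z) = res y * res z.
Proof.
move=> hy hz; have h := vM_ge0 hy hz.
rewrite (resE hy) (resE hz) (resE h) -[RHS]rmorphM.
by congr (\pi_({ideal_quot (@vmax F G v)}) _)%qT; apply: val_inj.
Qed.

Lemma v1_ge0 : v0 <= v 1. Proof. by rewrite Defs.val1. Qed.
Lemma v00_ge0 : v0 <= v 0. Proof. by rewrite Defs.val0. Qed.

Lemma res1 : res 1 = 1.
Proof.
rewrite (resE v1_ge0) -[RHS](rmorph1 (\pi_({ideal_quot (@vmax F G v)}))%qT).
by congr (\pi_({ideal_quot (@vmax F G v)}) _)%qT; apply: val_inj.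
Qed.

Lemma res_eq0 y : v0 <= v y -> (res y = 0) <-> (v0 < v y).
Proof.
move=> hy; rewrite (resE hy); split=> [/eqP|h].
  by rewrite (pi_residue_eq0 (VRing (in_vring hy))).
by apply/eqP; rewrite (pi_residue_eq0 (VRing (in_vring hy))).
Qed.

Lemma res0 : res 0 = 0.
Proof. by apply/res_eq0; [exact: v00_ge0 | rewrite Defs.val0 (v0_lt_Inf v)]. Qed.

Lemma res_eq y z : v0 <= v y -> v0 <= v z -> (res y = res z) <-> (v0 < v (y - z)).
Proof.
move=> hy hz; rewrite -(res_eq0 (vB_ge hy hz)) resB //.
by split=> [->|/eqP]; [rewrite subrr | rewrite subr_eq0 => /eqP].
Qed.

Lemma resD y z : v0 <= v y -> v0 <= v z -> res (y + z) = res y + res z.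
Proof.
move=> hy hz; rewrite -[z]opprK resB ?Defs.valN // -[in RHS](sub0r (- z)) resB ?Defs.valN //.
  by rewrite res0 sub0r.
exact: v00_ge0.
Qed.

Lemma resX y n : v0 <= v y -> res (y ^+ n) = res y ^+ n.
Proof.
move=> hy; elim: n => [|n IH]; first exact: res1.
by rewrite !exprS resM ?IH //; apply: vX_ge0.
Qed.

Lemma vnat_ge0 n : v0 <= v n%:R.
Proof.
elim: n => [|n IH]; first exact: v00_ge0.
by rewrite -addn1 natrD; apply: vD_ge => //; exact: v1_ge0.
Qed.

Lemma res_nat n : res n%:R = n%:R.
Proof.
elim: n => [|n IH]; first exact: res0.
by rewrite -addn1 !natrD resD ?vnat_ge0 ?v1_ge0 // IH res1.
Qed.

Lemma resV y : v y = v0 -> res y^-1 = (res y)^-1.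
Proof.
move=> hy; have hV := vV0 hy.
have n0 : res y != 0.
  by apply/eqP => /res_eq0; rewrite hy ltxx => /(_ (lexx _)).
apply: (mulIf n0); rewrite mulVf // -resM ?hV ?hy // mulVf ?res1 //.
exact: vneq0 hy.
Qed.

Lemma residue_subfield E : subfield E -> subfield (@residue_field F G v E).
Proof.
move=> hE; apply: subfieldP => [|_ _ [y [Ey hy] <-] [z [Ez hz] <-]|
    _ _ [y [Ey hy] <-] [z [Ez hz] <-]].
- exists 1; last exact: res1.
  by split; [exact: sf1 | exact: v1_ge0].
- exists (y - z); last exact: resB.
  by split; [exact: sfB | exact: vB_ge].
- move: hz; rewrite /= le_eqVlt => /orP[/eqP hz|hz].
    have hzV := vV0 (esym hz).
    exists (y / z); last by rewrite resM ?hzV // resV.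
    by split; [exact: sf_div | apply: vM_ge0 => //; rewrite hzV].
  have -> : res z = 0 by apply/res_eq0 => //; exact: ltW.
  rewrite invr0 mulr0; exists 0; last exact: res0.
  by split; [exact: sf0 | exact: v00_ge0].
Qed.

Lemma residue_field_mono E E' : E `<=` E' -> @residue_field F G v E `<=` @residue_field F G v E'.
Proof. by move=> sub _ [y [Ey hy] <-]; exists y => //; split=> //; apply: sub. Qed.

Lemma value_group_mono E E' : E `<=` E' -> value_group v E `<=` value_group v E'.
Proof. by move=> sub g [y Ey hy]; exists y => //; apply: sub. Qed.

Lemma value_groupB E g h : subfield E -> value_group v E g -> value_group v E h ->
  value_group v E (g - h).
Proof.
move=> hE [y Ey ey] [z Ez ez]; exists (y / z); first exact: sf_div.
by rewrite Defs.valM ey (vV_VFin ez).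
Qed.

Lemma res_pchar q : q \in [pchar F] -> q \in [pchar (residue v)].
Proof.
move=> qc; rewrite inE (pcharf_prime qc) /=.
by rewrite -res_nat (pcharf0 qc) res0.
Qed.

Lemma vnat_unit m : (forall p, p \in [pchar (residue v)] -> ~~ (p %| m)%N) -> (0 < m)%N ->
  v m%:R = v0.
Proof.
move=> h m0; apply: le_anti; rewrite vnat_ge0 andbT leNgt; apply/negP => lt.
have e : m%:R = 0 :> residue v.
  by rewrite -res_nat; apply/res_eq0 => //; exact: vnat_ge0.
have [p pc] : exists p, p \in [pchar (residue v)] by apply: natf0_pchar m0 _; apply/eqP.
by have := h p pc; rewrite (dvdn_pcharf pc) e eqxx.
Qed.

Lemma res_prod_XsubC (s : seq F) : (forall r, r \in s -> v0 <= v r) ->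
  map_poly res (\prod_(r <- s) ('X - r%:P)) = \prod_(r <- s) ('X - (res r)%:P).
Proof.
elim: s => [|r s IH] h.
  rewrite !big_nil; apply/polyP => i; rewrite coef_map_id0 ?res0 // !coef1.
  by case: eqP; rewrite ?res1 ?res0.
have hs z : z \in s -> v0 <= v z by move=> zs; apply: h; rewrite inE zs orbT.
have hr : v0 <= v r by apply: h; rewrite mem_head.
rewrite !big_cons -IH //; apply/polyP => i.
rewrite coef_map_id0 ?res0 // !mulrBl !coefB !coefXM !coefCM coef_map_id0 ?res0 //.
have ge := prod_XsubC_ge0 hs.
rewrite resB ?resM //; last exact: vM_ge0.
  by case: i => [|i] //=; rewrite ?res0 // coef_map_id0 ?res0.
by case: i => [|i] /=; [exact: v00_ge0 | exact: ge].
Qed.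
End Residue.

(** The minimal polynomial of y over k divides both a power of X - y and a separable
    polynomial, hence is X - y. *)
Lemma separable_insep_in (R : fieldType) (k : set R) (y : R) (P q : {poly R}) m :
  subfield k -> P \is a polyOver (mem k) -> P = ('X - y%:P) ^+ m -> (0 < m)%N ->
  q \is a polyOver (mem k) -> root q y -> separable_poly q -> k y.
Proof.
move=> hk Pk eP m0 qk rq sq.
have ya : algebraic_over k y by exists q => //; split=> //; apply: separable_poly_neq0.
have hm := minpP hk ya.
have dP : minp k y %| ('X - y%:P) ^+ m.
  rewrite -eP; apply: (minpoly_dvd hk hm Pk).
  by rewrite eP rootE horner_exp hornerXsubC subrr expr0n -leqn0 leqNgt m0.
have dq := minpoly_dvd hk hm qk rq.
case/dvdp_exp_XsubCP: dP => j _ ej.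
have j1 : (j <= 1)%N.
  rewrite leqNgt; apply/negP => j2.
  have := @separable_nosquare _ _ ('X - y%:P) j sq j2.
  rewrite size_XsubC => /(_ isT); rewrite -(eqp_dvdl _ ej) => h.
  by rewrite h in dq.
apply: deg1_in => //; rewrite /deg (eqp_size ej) size_exp_XsubC /=.
have := minpoly_size hm; rewrite (eqp_size ej) size_exp_XsubC ltnS => j0.
by apply/eqP; rewrite eqn_leq j1.
Qed.

(** * Lists cut into blocks, and enumerations *)

(** The relation e is an equivalence on the members of C only: it will be the closeness
    of conjugates of a given element, or the equality of the residues that they
    determine. *)
Section Blocks.
Variables (T : eqType) (C : seq T) (e : rel T).
Hypotheses (uC : uniq C) (e_refl : forall c, c \in C -> e c c).
Hypothesis e_sym : forall c d, c \in C -> d \in C -> e c d -> e d c.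
Hypothesis e_trans : forall b c d, b \in C -> c \in C -> d \in C -> e b c -> e c d -> e b d.

Definition blk c := [seq d <- C | e c d].
Definition brep c := head c (blk c).
Definition breps := undup (map brep C).

Lemma blk_eq c d : c \in C -> d \in C -> e c d -> blk c = blk d.
Proof.
move=> cC dC cd; apply: eq_in_filter => b bC; apply/idP/idP => h.
  by apply: e_trans h => //; apply: e_sym.
exact: e_trans h.
Qed.

Lemma blk_self c : c \in C -> c \in blk c.
Proof. by move=> cC; rewrite mem_filter e_refl. Qed.

Lemma brep_blk c : c \in C -> brep c \in blk c.
Proof.
by move=> /blk_self; rewrite /brep; case: (blk c) => //= d s _; rewrite mem_head.
Qed.

Lemma brepP c : c \in C -> brep c \in C /\ e c (brep c).
Proof. by move=> /brep_blk; rewrite mem_filter => /andP[]. Qed.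

Lemma brep_eq c d : c \in C -> d \in C -> (brep c == brep d) = e c d.
Proof.
move=> cC dC; have [rc ec] := brepP cC; have [rd ed] := brepP dC.
apply/eqP/idP => [eq|h].
  by apply: e_trans ec _ => //; rewrite eq; apply: e_sym.
rewrite /brep (blk_eq cC dC h).
have := blk_self dC; by case: (blk d).
Qed.

Lemma breps_sub r : r \in breps -> r \in C.
Proof. by rewrite mem_undup => /mapP[c cC ->]; have [] := brepP cC. Qed.

Lemma brep_id r : r \in breps -> brep r = r.
Proof.
rewrite mem_undup => /mapP[c cC ->]; have [rc ec] := brepP cC.
by apply/eqP; rewrite brep_eq //; apply: e_sym.
Qed.

Lemma brep_in c : c \in C -> brep c \in breps.
Proof. by move=> cC; rewrite mem_undup; apply: map_f. Qed.

Lemma breps_neq r r' : r \in breps -> r' \in breps -> e r r' -> r = r'.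
Proof.
move=> hr hr'; rewrite -brep_eq ?breps_sub // !brep_id //.
by move/eqP.
Qed.

Lemma big_blocks (V : Type) (idx : V) (op : Monoid.com_law idx) (f : T -> V) :
  \big[op/idx]_(c <- C) f c = \big[op/idx]_(r <- breps) \big[op/idx]_(c <- blk r) f c.
Proof.
transitivity (\big[op/idx]_(c <- C) \big[op/idx]_(r <- breps | r == brep c) f c).
  apply: eq_big_seq => c cC; rewrite -big_filter filter_pred1_uniq ?undup_uniq ?brep_in //.
  by rewrite big_seq1.
rewrite (exchange_big_dep xpredT) //= big_seq [RHS]big_seq; apply: eq_bigr => r hr.
rewrite big_filter big_seq_cond [RHS]big_seq_cond; apply: eq_bigl => c.
case: (boolP (c \in C)) => //= cC.
by rewrite -{1}(brep_id hr) brep_eq // breps_sub.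
Qed.

Lemma blk_map (g : T -> T) c : injective g -> perm_eq (map g C) C ->
  (forall c d, c \in C -> d \in C -> e (g c) (g d) = e c d) -> c \in C ->
  perm_eq (map g (blk c)) (blk (g c)).
Proof.
move=> gi pC ge cC.
have -> : map g (blk c) = [seq d <- map g C | e (g c) d].
  by rewrite filter_map; congr map; apply: eq_in_filter => d dC /=; rewrite ge.
exact: perm_filter.
Qed.
End Blocks.

(** The sequence en becomes constant when it reaches the largest element of D, if there
    is one; S is then the segment up to that point, and all positive integers otherwise. *)
Lemma enum_nat (D : nat -> Prop) : D 1%N -> (forall d, D d -> (0 < d)%N) ->
  exists (S : set nat) (en : nat -> nat),
  [/\ initial_segment S, S 1%N /\ en 1%N = 1%N, forall i, S i -> (0 < i)%N /\ D (en i),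
      forall i, S i -> (1 < i)%N -> S i.-1 /\ (en i.-1 < en i)%N
    & forall d, D d -> exists2 i, S i & en i = d].
Proof.
move=> D1 Dpos; pose above d e := `[< D e /\ (d < e)%N >].
pose nxt d := if pselect (exists e, above d e) is left h then ex_minn h else d.
pose en i := iter i.-1 nxt 1%N.
have nxtD d : D d -> D (nxt d).
  move=> Dd; rewrite /nxt; case: pselect => // h.
  by case: ex_minnP => e /asboolP[].
have nxt_lt d e : D e -> (d < e)%N -> (d < nxt d <= e)%N.
  move=> De de; rewrite /nxt; case: pselect => [h|[]]; last by exists e; apply/asboolP.
  case: ex_minnP => n /asboolP[_ ->] /= h'; apply: h'; exact/asboolP.
have enD i : D (en i) by rewrite /en; elim: i.-1 => //= k; apply: nxtD.
have enS i : (0 < i)%N -> en i.+1 = nxt (en i) by case: i.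
have surj d : D d -> exists2 i, (0 < i)%N & en i = d.
  elim/ltn_ind: d => d IH Dd; case: (eqVneq d 1%N) => [->|d1]; first by exists 1%N.
  have lt1 : (1 < d)%N by have := Dpos d Dd; case: (d) d1 => [|[|]].
  have exP : exists e, `[< D e /\ (e < d)%N >] by exists 1%N; apply/asboolP.
  have bP e : `[< D e /\ (e < d)%N >] -> (e <= d)%N by move=> /asboolP[_ /ltnW].
  case: (ex_maxnP exP bP) => e /asboolP[De ed] emax.
  have [i i0 ei] := IH e ed De; exists i.+1 => //; rewrite enS // ei.
  have /andP[l1 l2] := nxt_lt e d Dd ed.
  apply/eqP; rewrite eqn_leq l2 leqNgt; apply/negP => l3.
  have hP : `[< D (nxt e) /\ (nxt e < d)%N >] by apply/asboolP; split=> //; apply: nxtD.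
  by have := emax _ hP; rewrite leqNgt l1.
case: (pselect (forall d, D d -> exists2 e, D e & (d < e)%N)) => [unb|bd].
  exists [set i | (0 < i)%N], en; split=> //.
  - by left.
  - move=> [|[|i]] //= _ _; split=> //; have [e De lt] := unb _ (enD i.+1).
    by have /andP[] := nxt_lt _ _ De lt.
move: bd => /existsNP[M /not_implyP[DM maxM]].
have exn : exists i, (0 < i)%N && (en i == M).
  by have [i i0 ei] := surj M DM; exists i; rewrite i0 ei eqxx.
case: (ex_minnP exn) => n /andP[n0 /eqP en_n] nmin.
have maxD d : D d -> (d <= M)%N.
  by move=> Dd; rewrite leqNgt; apply/negP => lt; apply: maxM; exists d.
have lt i : (0 < i < n)%N -> (en i < M)%N.
  move=> /andP[i0 i_n]; rewrite ltn_neqAle maxD // andbT; apply/negP => e.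
  by have := nmin i; rewrite i0 e => /(_ isT); rewrite leqNgt i_n.
have stat k : en (n + k)%N = M.
  elim: k => [|k IH]; first by rewrite addn0.
  rewrite addnS enS ?addn_gt0 ?n0 // IH /nxt; case: pselect => // h.
  by have [e /asboolP[De]] := h; rewrite ltnNge maxD.
exists (segment n), en; split=> //.
- by right; exists n.
- by move=> i /andP[i0 _].
- move=> [|[|i]] //= /andP[_ i_n] _; split; first by rewrite /segment /= ltnW.
  have h : (en i.+1 < M)%N by apply: lt.
  by have /andP[] := nxt_lt _ _ DM h.
move=> d Dd; have [i i0 ei] := surj d Dd.
case: (leqP i n) => [le|gt]; first by exists i => //; rewrite /segment /= i0.
by exists n; rewrite /segment /= ?n0 ?leqnn // -ei -(subnKC (ltnW gt)) stat.
Qed.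

(** * Residues of algebraic elements *)

Section ResidueAlgebraic.
Variables (F : fieldType) (G : oagType) (v : valuation F G).
Local Notation v0 := (VFin 0 : value G).
Local Notation res := (residue_map v).

Lemma res_horner (p : {poly F}) u : int_poly v p -> v0 <= v u ->
  res p.[u] = (map_poly res p).[res u].
Proof.
move=> hp hu; rewrite horner_coef (@horner_coef_wide _ (size p)); last first.
  apply/leq_sizeP => j le; rewrite coef_map_id0 ?res0 // nth_default // res0 //.
suff key n : res (\sum_(i < n) p`_i * u ^+ i) =
    \sum_(i < n) (map_poly res p)`_i * res u ^+ i /\ v0 <= v (\sum_(i < n) p`_i * u ^+ i).
  by have [] := key (size p).
elim: n => [|n [IH h]]; first by rewrite !big_ord0 res0 Defs.val0.
have h' : v0 <= v (p`_n * u ^+ n) by apply: vM_ge0 => //; apply: vX_ge0.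
rewrite !big_ord_recr /=; split; last exact: vD_ge.
by rewrite resD // IH resM ?vX_ge0 // resX // coef_map_id0 ?res0.
Qed.

(** The reduction of a primitive polynomial annihilating u is nonzero and annihilates
    the residue of u. *)
Lemma res_alg (M : set F) u : subfield M -> algebraic_over M u -> v0 <= v u ->
  algebraic_over (@residue_field F G v M) (res u).
Proof.
move=> hM [p [pM p0] /rootP rp] hu.
have [c [Mc c0 qi [i0 _ e1]]] := primitive_multiple v hM pM p0.
have qM := polZ hM Mc pM; set q := c *: p in qi qM e1.
have hR := residue_subfield v hM.
exists (map_poly res q).
  split.
    apply/(polyE hR) => i; rewrite coef_map_id0 ?res0 //.
    by exists q`_i => //; split; [move/(polyE hM): qM; apply | apply: qi].
  apply/negP => /eqP/(congr1 (fun r : {poly _} => r`_i0)).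
  rewrite coef_map_id0 ?res0 // e1 res1 coef0 => /eqP.
  by rewrite oner_eq0.
by rewrite rootE -res_horner // hornerZ rp mulr0 res0.
Qed.

Lemma res_lift (M : set F) (P : {poly residue v}) : subfield M ->
  P \is a polyOver (mem (@residue_field F G v M)) ->
  exists f, [/\ f \is a polyOver (mem M), int_poly v f, size f = size P & map_poly res f = P].
Proof.
move=> hM /(polyE (residue_subfield v hM)) PM.
pose l i := if P`_i == 0 then 0 else s2val (cid2 (PM i)).
have lP i : [/\ M (l i), v0 <= v (l i) & res (l i) = P`_i].
  rewrite /l; case: eqP => [->|_]; first by split; rewrite ?res0 ?Defs.val0 //; apply: sf0.
  by case: (cid2 (PM i)) => y [h1 h2] h3.
have rP : map_poly res (\poly_(i < size P) l i) = P.
  apply/polyP => i; rewrite coef_map_id0 ?res0 // coef_poly.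
  by case: ltnP => [_|le]; [have [] := lP i | rewrite res0 nth_default].
exists (\poly_(i < size P) l i); split=> //.
- apply/(polyE hM) => i; rewrite coef_poly; case: ifP => _; last exact: sf0.
  by have [] := lP i.
- move=> i; rewrite coef_poly; case: ifP => _; first by have [] := lP i.
  by rewrite Defs.val0.
case: (posnP (size P)) => [->|sP]; first by apply/eqP; rewrite -leqn0 size_poly.
apply: size_poly_eq; have [_ _ e] := lP (size P).-1; apply: contraTneq sP => l0.
move: e; rewrite l0 res0 -lead_coefE => /esym/eqP; rewrite lead_coef_eq0 => /eqP ->.
by rewrite size_poly0.
Qed.
End ResidueAlgebraic.

(** * Well-orderings and pseudo Cauchy sequences *)

Section WellOrder.
Variables (I : Type) (le : rel I).
Hypothesis wo : well_order le.

Lemma wo_min (P : I -> Prop) : (exists i, P i) -> exists i, P i /\ forall j, P j -> le i j.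
Proof.
move=> [i Pi]; have [|m [[mP mmin] _]] := wo (A := fun i => `[< P i >]).
  by exists i; apply/asboolP.
by exists m; split=> [|j Pj]; [apply/asboolP | apply: mmin; apply/asboolP].
Qed.

Lemma wo_refl i : le i i.
Proof. by have [|m [-> ]] := @wo_min (fun j => j = i); [exists i | apply]. Qed.

Lemma wo_total i j : le i j || le j i.
Proof.
have [|m [[->|->] h]] := @wo_min (fun k => k = i \/ k = j); first by exists i; left.
  by rewrite h //; right.
by rewrite orbC h //; left.
Qed.

Lemma wo_anti i j : le i j -> le j i -> i = j.
Proof.
move=> ij ji; have [|m [_ mu]] := wo (A := fun k => `[< k = i \/ k = j >]).
  by exists i; apply/asboolP; left.
have hm k : k = i \/ k = j -> m = k.
  move=> hk; apply: mu; split; first exact/asboolP.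
  by move=> l /asboolP hl; case: hk hl => -> [] ->; rewrite ?ij ?ji ?wo_refl.
by apply: (etrans (esym (hm i _)) (hm j _)); [left | right].
Qed.

Lemma wo_trans i j k : le i j -> le j k -> le i k.
Proof.
move=> ij jk; have [|m [hm h]] := @wo_min (fun l => [\/ l = i, l = j | l = k]).
  by exists i; apply: Or31.
case: hm h => -> h.
- by apply: h; apply: Or33.
- by rewrite (wo_anti ij (h i (Or31 _ _ (erefl _)))).
- by rewrite -(wo_anti jk (h j (Or32 _ _ (erefl _)))).
Qed.

Lemma wltW i j : wlt le i j -> le i j.
Proof. by rewrite /wlt => n; have := wo_total i j; rewrite (negPf n) orbF. Qed.

Lemma wlt_le_trans i j k : wlt le i j -> le j k -> wlt le i k.
Proof. by rewrite /wlt => n jk; apply: contra n; apply: wo_trans. Qed.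

Lemma le_eq_wlt i j : le i j -> i = j \/ wlt le i j.
Proof.
move=> ij; case: (boolP (le j i)) => [ji|n]; first by left; apply: wo_anti.
by right.
Qed.

Lemma wo_max i j : exists k, le i k /\ le j k.
Proof.
by case/orP: (wo_total i j) => h; [exists j | exists i]; split=> //; apply: wo_refl.
Qed.

Lemma has_succ i : (exists j, wlt le i j) -> exists j, is_succ le i j.
Proof. by move/wo_min => [j [h1 h2]]; exists j. Qed.

End WellOrder.

Lemma limit_ordinal_nat : limit_ordinal leq.
Proof.
split; [|exact: (inhabits 0%N)|by move=> i; exists i.+1; rewrite /wlt -ltnNge].
apply: antisymmetric_well_order => [|A [n An]]; first exact: anti_leq.
case: (ex_minnP (ex_intro (fun n => n \in A) n An)) => m mA mmin.
by exists m; split=> // k; apply: mmin.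
Qed.

Section PseudoCauchySequences.
Variables (F : closedFieldType) (G : oagType) (v : valuation F G).
Variables (K L : set F) (x : F).
Hypotheses (hK : subfield K) (hL : subfield L) (KL : K `<=` L).
Hypothesis trx : ~ algebraic_over K x.
Local Notation Kt := (alg_closure K).

Lemma x_neq c : Kt c -> x - c != 0.
Proof. by move=> cK; rewrite subr_eq0; apply: contra_notN trx => /eqP ->. Qed.

Section Sequence.
Variables (I : Type) (le : rel I) (z : I -> F).
Hypothesis lim : limit_ordinal le.
Let wo : well_order le. Proof. by case: lim. Qed.
Let next i : exists j, wlt le i j. Proof. by case: lim => _ _; apply. Qed.

Lemma pc_increasing E : pseudo_cauchy v le E z -> pc_limit v le z x ->
  forall i j, wlt le i j -> v (x - z i) < v (x - z j).
Proof.
move=> [_ _ pc] pl i j ij.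
have [i' si] := has_succ wo (next i); have [j' sj] := has_succ wo (next j).
rewrite (pl _ _ si) (pl _ _ sj).
have -> : v (z i' - z i) = v (z j - z i); last by apply: pc ij _; case: sj.
have [ii' /(_ j ij) i'j] := si.
case: (le_eq_wlt wo i'j) => [-> //|lt].
have h := pc _ _ _ ii' lt.
by rewrite [RHS]vBC [LHS]vBC (vtri_eq (z := z i')) // vBC [X in _ < X]vBC.
Qed.

Section Increasing.
Hypothesis inc : forall i j, wlt le i j -> v (x - z i) < v (x - z j).

Lemma inc_le i j : le i j -> v (x - z i) <= v (x - z j).
Proof. by case/(le_eq_wlt wo) => [->|/inc /ltW]. Qed.

Lemma inc_diff i j : wlt le i j -> v (z j - z i) = v (x - z i).
Proof. by move=> /inc h; rewrite vBC (vtri_eq (z := x)) vBC. Qed.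

Lemma inc_pc E : (forall i, E (z i)) -> pseudo_cauchy v le E z.
Proof.
by move=> hz; split=> // i j k ij jk; rewrite !inc_diff //; apply: inc.
Qed.

Lemma inc_limit : pc_limit v le z x.
Proof. by move=> i j [ij _]; rewrite inc_diff. Qed.

(** If all roots c of f are eventually farther from x than z_nu, then v(z_nu - c) = v(x
    - c) eventually, and v(f(z_nu)) = v(f(x)). *)
Lemma inc_trans_type E : subfield E -> K `<=` E -> E `<=` Kt ->
  (forall c, Kt c -> exists i, v (x - c) < v (x - z i)) -> transcendental_type v le E z.
Proof.
move=> hE KE EK cof f fE.
have [->|f0] := eqVneq f 0.
  have [_ [i] _] := lim; exists i, VInf => j _.
  by rewrite horner0 Defs.val0.
have [r e] := closed_field_poly_normal f.
have rK c : c \in r -> Kt c.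
  move=> cr; apply: (alg_trans hK); exists f.
    by split=> //; apply: pol_mono fE.
  by rewrite e rootZ ?lead_coef_eq0 // root_prod_XsubC.
have [i hi] : exists i, forall j, le i j -> forall c, c \in r -> v (z j - c) = v (x - c).
  elim: (r) rK => [|c s IH] sK; first by have [_ [i] _] := lim; exists i.
  have [|i1 h1] := IH; first by move=> d ds; apply: sK; rewrite inE ds orbT.
  have [i2 h2] := cof c (sK c (mem_head _ _)).
  have [i [l1 l2]] := wo_max wo i1 i2; exists i => j ij d.
  rewrite inE => /orP[/eqP ->|]; last by apply: h1; apply: wo_trans ij.
  rewrite vBC [RHS]vBC; apply: vtri_eq; rewrite vBC.
  by apply: lt_le_trans h2 (inc_le _); apply: wo_trans ij.
exists i, (v f.[x]) => j ij; rewrite e !hornerZ !horner_prod; apply: veqM => //.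
by apply: vprod_eq => c cr; rewrite !hornerXsubC hi.
Qed.
End Increasing.

(** Suppose that c is closer to x than every z_nu. Then v(z_nu - c) = v(x - z_nu)
    increases strictly for ever, while for the other roots d of the minimal polynomial
    of c the values v(z_nu - d) eventually do not decrease; so the value of the minimal
    polynomial at z_nu never becomes constant. *)
Lemma trans_type_cofinal E c : pseudo_cauchy v le E z -> pc_limit v le z x -> K `<=` E ->
  transcendental_type v le E z -> Kt c -> exists i, v (x - c) <= v (x - z i).
Proof.
move=> pc pl KE tt cK; have inc := pc_increasing pc pl.
apply/not_existsP => h.
have far i : v (x - z i) < v (x - c) by rewrite ltNge; apply/negP; apply: h.
have hm := minpP hK cK; set f := minp K c in hm.
have [i1 [g hg]] := tt f (pol_mono KE (minpoly_over hm)).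
have [r e] := closed_splits (minpoly_monic hm).
have rK d : d \in r -> Kt d.
  move=> dr; exists f; first by split; [exact: minpoly_over hm | exact: minpoly_neq0 hm].
  by rewrite e root_prod_XsubC.
have cr : c \in r by rewrite -root_prod_XsubC -e; apply: minpoly_root hm.
have [i0 hi0] : exists i0, forall i j, le i0 i -> wlt le i j -> forall d, d \in r ->
    z i - d != 0 /\ v (z i - d) <= v (z j - d).
  elim: (r) rK => [|d s IH] sK; first by have [_ [i] _] := lim; exists i.
  have [|i2 h2] := IH; first by move=> d' ds; apply: sK; rewrite inE ds orbT.
  have dK := sK d (mem_head _ _).
  have [i3 h3] : exists i3, forall i j, le i3 i -> wlt le i j ->
      z i - d != 0 /\ v (z i - d) <= v (z j - d).
    case: (pselect (forall i, v (x - z i) < v (x - d))) => [hd|/existsNP[i3 /negP]].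
      exists i1 => i j _ ij.
      have eq k : v (z k - d) = v (x - z k) by rewrite (vtri_eq (z := x)) vBC.
      rewrite !eq; split; last by apply: ltW; apply: inc.
      by rewrite -(vlt_Inf v) eq; apply: lt_le_trans (inc _ _ ij) (vVInf_max _).
    rewrite -leNgt => le3; have [i4 l4] := next i3.
    exists i4 => i j l4i ij.
    have eq k : le i4 k -> v (z k - d) = v (x - d).
      move=> l; rewrite vBC [RHS]vBC; apply: vtri_eq; rewrite vBC.
      by apply: le_lt_trans le3 (inc _ _ (wlt_le_trans wo l4 l)).
    rewrite !eq //; last by apply: (wo_trans wo) l4i (wltW wo ij).
    by split=> //; rewrite -(vlt_Inf v) eq // vlt_Inf x_neq.
  have [i [l1 l2]] := wo_max wo i2 i3; exists i => k j ik kj d'.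
  rewrite inE => /orP[/eqP ->|ds]; first by apply: h3 kj; apply: wo_trans ik.
  by apply: h2 kj d' ds; apply: wo_trans ik.
have [i [l0 l1]] := wo_max wo i0 i1; have [j ij] := next i.
have l1j := wo_trans wo l1 (wltW wo ij).
have : v f.[z i] < v f.[z j].
  rewrite e !horner_prod; apply: (vprod_lt (k := c)) => //.
  - by move=> d dr; rewrite hornerXsubC; have [] := hi0 i j l0 ij d dr.
  - by move=> d dr; rewrite !hornerXsubC; have [] := hi0 i j l0 ij d dr.
  - have eq k : v (z k - c) = v (x - z k) by rewrite (vtri_eq (z := x)) vBC.
    by rewrite !hornerXsubC !eq; apply: inc.
by rewrite !hg // ltxx.
Qed.
End Sequence.

(** This is the only consequence of weak purity that enters the construction: no element
    of the algebraic closure of K is closer to x than all elements of L. *)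
Lemma weakly_pure_dom c : weakly_pure v L x -> Kt c -> exists2 a, L a & v (x - c) <= v (x - a).
Proof.
move=> [[a La [_ ub]]|[I [le [z [pc tt pl]]]]] cK.
  by exists a => //; apply: ub; exists c => //; apply: algebraic_mono cK.
have [lim zL _] := pc.
have [i hi] := trans_type_cofinal lim pc pl KL tt cK.
by exists (z i).
Qed.
End PseudoCauchySequences.

(** * Tame extensions are separable *)

Section Tame.
Variables (F : closedFieldType) (G : oagType) (v : valuation F G).
Variables (K L : set F) (x : F).
Hypotheses (hK : subfield K) (hens : henselian v K) (trx : ~ algebraic_over K x).
Hypothesis algF : alg_closure (adjoin K [set x]) = setT.
Hypothesis tameL : tame v K L.
Local Notation v0 := (VFin 0 : value G).
Local Notation Kx := (adjoin K [set x]).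
Local Notation K_ a := (adjoin K [set a]).
Local Notation Kt := (alg_closure K).
Local Notation res := (residue_map v).
Local Notation rfield E := (@residue_field F G v E).

Lemma hKx : subfield Kx. Proof. exact: adjoin_subfield. Qed.
Lemma hKt : subfield Kt. Proof. exact: alg_closure_subfield. Qed.
Lemma algKx y : algebraic_over Kx y.
Proof. by have : alg_closure Kx y by rewrite algF. Qed.
Lemma K_Kx : K `<=` Kx. Proof. exact: adjoin_base. Qed.
Lemma K_Kt : K `<=` Kt. Proof. exact: alg_sub. Qed.

Lemma hL : subfield L. Proof. by case: tameL => -[]. Qed.
Lemma K_L : K `<=` L. Proof. by case: tameL => -[]. Qed.
Lemma L_Kt : L `<=` Kt. Proof. by case: tameL => -[]. Qed.
Lemma K_a_L a : L a -> K_ a `<=` L.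
Proof. by move=> La; apply: adjoin1_min => //; [exact: hL | exact: K_L]. Qed.
Lemma K_a_Kt a : Kt a -> K_ a `<=` Kt.
Proof. by move=> La; apply: adjoin1_min => //; [exact: hKt | exact: K_Kt]. Qed.

Lemma fix_K rho : fixes Kx rho -> fixes K rho.
Proof. by apply: fixes_mono; apply: K_Kx. Qed.
Lemma fix_x rho : fixes Kx rho -> rho x = x.
Proof. by apply; apply: adjoin_elt. Qed.
Lemma fix_val rho u : fixes Kx rho -> Kt u -> v (rho u) = v u.
Proof. by move=> /fix_K fr; apply: henselian_fix. Qed.

Lemma fix_Kt rho u : fixes K rho -> Kt u -> Kt (rho u).
Proof.
by move=> fr [p [pK p0] rp]; exists p => //; apply: (fixes_root hK fr pK rp).
Qed.

Lemma degKx a : Kt a -> deg Kx a = deg K a.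
Proof. by move=> aK; apply: (deg_trans hK trx) => //; exact: K_Kt. Qed.
Lemma minpKx a : Kt a -> minp Kx a = minp K a.
Proof. by move=> aK; apply: (minp_trans hK trx) => //; exact: K_Kt. Qed.

Lemma conj_Kt a c : Kt a -> c \in conjugates Kx a -> Kt c.
Proof. by move=> aK /(conjP hKx algKx) [rho /fix_K fr <-]; apply: fix_Kt. Qed.

Lemma alg_Ex E y : K `<=` E -> algebraic_over (adjoin E [set x]) y.
Proof.
by move=> KE; apply: algebraic_mono (algKx y); apply: adjoin_mono.
Qed.

(** The field F is not algebraic over E, so Galois theory is applied over E(x); no new
    element algebraic over K appears there. *)
Lemma fixed_in_alg E (cs : seq F) u : subfield E -> K `<=` E -> E `<=` Kt ->
  (forall c, c \in cs -> sep_over K c) -> adjoin E [set c | c \in cs] u ->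
  (forall rho, fixes (adjoin E [set x]) rho -> rho u = u) -> Kt u -> E u.
Proof.
move=> hE KE EK scs ucs fu uK.
apply: (adjoin_trans_alg hK hE EK trx uK).
apply: (@fixed_in F _ cs) => //; first exact: adjoin_subfield.
- by move=> y; apply: alg_Ex.
- move=> c /scs; apply: sep_over_mono; apply: subset_trans KE _.
  exact: adjoin_base.
- by move: u ucs {fu uK}; apply: adjoin_mono => //; apply: adjoin_base.
Qed.

Lemma sep_K a : Kt a -> sep_over Kx a -> sep_over K a.
Proof.
move=> aK /(sep_minp hKx algKx); rewrite minpKx // => s.
have hm := minpP hK aK.
by exists (minp K a); split=> //; [exact: minpoly_over hm | exact: minpoly_root hm].
Qed.

Lemma tame_ext a : L a -> exists e f : nat,
  [/\ group_index (value_group v K) (value_group v (K_ a)) e,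
      ext_degree (rfield K) (rfield (K_ a)) f,
      forall p, p \in [pchar (residue v)] -> ~~ (p %| e)%N,
      separable_ext (rfield K) (rfield (K_ a)) & deg K a = (e * f)%N].
Proof.
move=> La; case: tameL => _ /(_ (K_ a) (deg K a)); apply.
- exact: adjoin_subfield.
- exact: adjoin_base.
- exact: K_a_L.
- by apply: ext_degree_adjoin => //; apply: L_Kt.
Qed.

(** A tame extension has degree (ramification index) times (residue degree), so value
    group and residue field determine the degree. *)
Lemma deg_determined a b : L a -> L b ->
  value_group v (K_ a) = value_group v (K_ b) -> rfield (K_ a) = rfield (K_ b) ->
  deg K a = deg K b.
Proof.
move=> La Lb ev er.
have [e [f [ie df _ _ ->]]] := tame_ext La; have [e' [f' [ie' df' _ _ ->]]] := tame_ext Lb.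
rewrite -ev in ie'; rewrite -er in df'.
rewrite (ext_degree_uniq (residue_subfield v hK) df df'); congr (_ * _)%N.
apply/eqP; rewrite eqn_leq.
by rewrite (group_index_le _ ie ie') ?(group_index_le _ ie' ie) // => g h; apply: value_groupB.
Qed.

(** The residue of y is separable over Kv and purely inseparable over K(a^q)v. *)
Lemma res_power_in q a : q \in [pchar F] -> L a -> forall y, K_ a y -> v0 <= v y ->
  rfield (K_ (a ^+ q)) (res y ^+ q) -> rfield (K_ (a ^+ q)) (res y).
Proof.
move=> qc La y ya y0 ryq; have qr := res_pchar v qc.
have [e [f [_ _ _ sep _]]] := tame_ext La.
have [|p [pm pK rp _] sp] := sep (res y); first by exists y.
have hR : subfield (rfield (K_ (a ^+ q))) := residue_subfield v (adjoin_subfield _ _).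
have qX : q \in [pchar {poly residue v}] by rewrite pchar_poly.
apply: (@separable_insep_in _ _ _ (('X - (res y)%:P) ^+ q) p q hR) => //.
- have -> : ('X - (res y)%:P) ^+ q = 'X^q - (res y ^+ q)%:P.
    by rewrite -!(pFrobenius_autE qX) pFrobenius_autB_comm ?pFrobenius_autE ?polyC_exp //; apply: mulrC.
  by apply: (polB hR); [apply: (polXn hR); apply: polX | apply: polC].
- exact: prime_gt0 (pcharf_prime qc).
- by apply: pol_mono pK; apply: residue_field_mono; apply: adjoin_base.
Qed.

(** If a were inseparable, K(a^q) would have smaller degree than K(a). Yet both have the
    same residue field, since residues are separable, and the same value group, since
    its index is prime to q and the q-th powers of K(a) lie in K(a^q). *)
Lemma tame_sep a : L a -> sep_over K a.
Proof.
move=> La; have aK := L_Kt La; apply: sep_K => //; apply/not_notP => ns.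
have [q qc] := insep_power hKx algKx ns.
have Laq : L (a ^+ q) by apply: (sfX hL).
rewrite !degKx //; last exact: L_Kt.
have qp := pcharf_prime qc.
set b := a ^+ q in Laq *.
have ba : K_ b `<=` K_ a.
  apply: adjoin1_min; [exact: adjoin_subfield | exact: adjoin_base |].
  by apply: (sfX (adjoin_subfield _ _)); apply: adjoin_elt.
have pw y : K_ a y -> K_ b (y ^+ q).
  have hb : subfield (K_ b) by apply: adjoin_subfield.
  pose N := [set y | K_ b (y ^+ q)]; suff : K_ a `<=` N by apply.
  apply: adjoin1_min; last exact: adjoin_elt.
  - apply: subfieldP => [|y1 z1|y1 z1]; rewrite /N /=.
    + by rewrite expr1n; apply: sf1.
    + move=> h1 h2; have -> : (y1 - z1) ^+ q = y1 ^+ q - z1 ^+ q.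
        by rewrite -!(pFrobenius_autE qc) pFrobenius_autB_comm //; apply: mulrC.
      exact: (sfB hb).
    + by move=> h1 h2; rewrite exprMn exprVn; apply: (sf_div hb).
  - by move=> y1 Ky; rewrite /N /=; apply: adjoin_base; apply: (sfX hK).
rewrite (@deg_determined b a) ?ltnn //; apply/seteqP; split.
- exact: value_group_mono.
- move=> g [y ya ey].
  have [e [f [ie _ pe _ _]]] := tame_ext La.
  have vb : value_group v (K_ b) (g *+ q).
    by exists (y ^+ q); [exact: pw | exact: vX_VFin].
  have vK : value_group v (K_ b) (g *+ e).
    apply: (@value_group_mono _ _ v K); first exact: adjoin_base.
    apply: (group_index_mul _ _ ie); [| |by exists y].
      by move=> g1 h1; apply: value_groupB.
    by move=> g1 h1; apply: value_groupB; apply: adjoin_subfield.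
  have vB g1 h1 := @value_groupB _ _ v (K_ b) g1 h1 (adjoin_subfield _ _).
  have vb0 : value_group v (K_ b) 0.
    by exists 1; [apply: sf1; apply: adjoin_subfield | exact: Defs.val1].
  have vn g1 n : value_group v (K_ b) g1 -> value_group v (K_ b) (g1 *+ n).
    move=> h1; elim: n => [|n IH]; first by rewrite mulr0n.
    by rewrite mulrS -[g1 *+ n]opprK -[- (g1 *+ n)]add0r; do 2?apply: (vB).
  have cop : coprime q e by rewrite prime_coprime // pe // (res_pchar v qc).
  have e0 : (0 < e)%N.
    by rewrite lt0n; apply: contraNneq (pe q (res_pchar v qc)) => ->; apply: dvdn0.
  have /(coprimeP _ (prime_gt0 qp))[[u1 u2] /= eu] := cop.
  have -> : g = g *+ q *+ u1 - g *+ e *+ u2.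
    by rewrite -!mulrnA ![(_ * u1)%N]mulnC ![(_ * u2)%N]mulnC -mulrnBr ?eu //; lia.
  by apply: vB; apply: vn.
- exact: residue_field_mono.
- move=> _ [y [ya y0] <-]; apply: res_power_in => //.
  rewrite -resX //; exists (y ^+ q) => //; split; [exact: pw | exact: vX_ge0].
Qed.

Lemma sep_conj_K a c : L a -> c \in conjugates Kx a -> sep_over K c.
Proof.
move=> La; have [p [pK rp sp]] := tame_sep La.
move=> /(conjP hKx algKx) [rho fr <-]; exists p; split=> //.
exact: (fixes_root hK (fix_K fr) pK rp).
Qed.

(** Elements generated over K(b) by the conjugates of a are separable over K(b), as a is
    separable over K; those fixed by all embeddings over K(b) therefore lie in K(b). *)
Lemma conj_fixed_in a b u : L a -> Kt b ->
  adjoin (K_ b) [set c | c \in conjugates Kx a] u ->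
  (forall rho, fixes Kx rho -> rho b = b -> rho u = u) -> K_ b u.
Proof.
move=> La bK uC fu; apply: (@fixed_in_alg (K_ b) (conjugates Kx a)) => //.
- exact: adjoin_subfield.
- exact: adjoin_base.
- exact: K_a_Kt.
- by move=> c; apply: sep_conj_K.
- move=> rho fr; apply: fu.
    by apply: fixes_mono fr; apply: adjoin_mono => //; apply: adjoin_base.
  by apply: fr; apply: adjoin_base; apply: adjoin_elt.
move: u uC {fu}; apply: adjoin_min; [exact: hKt | exact: K_a_Kt |].
by move=> c /=; apply: conj_Kt; apply: L_Kt.
Qed.

(** * Integral elements with unit trace *)

Section Trace.
Variable a : F.
Hypothesis La : L a.
Local Notation C := (conjugates Kx a).
Let aK : Kt a := L_Kt La.

(** An integral element of K(a) is represented by a polynomial s with s(a) integral,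
    since its conjugates are then simply the values s(c) at the conjugates c of a. *)
Definition int_at s : Prop := s \is a polyOver (mem K) /\ v0 <= v s.[a].

(** The embeddings a -> c and a -> d of K(a) induce the same homomorphism on its residue
    field. *)
Definition same_res : rel F := fun c d => `[< forall s, int_at s -> v0 < v (s.[c] - s.[d]) >].

Lemma hor_Kt s c : s \is a polyOver (mem K) -> Kt c -> Kt s.[c].
Proof. by move=> sK cK; apply: (pol_horner hKt) => //; apply: pol_mono sK; apply: K_Kt. Qed.

Lemma conj_val s c : s \is a polyOver (mem K) -> c \in C -> v s.[c] = v s.[a].
Proof.
move=> sK /(conjP hKx algKx) [rho fr <-].
by rewrite -(fixes_horner a hK (fix_K fr) sK) fix_val //; apply: hor_Kt.
Qed.

Lemma int_conj s c : int_at s -> c \in C -> v0 <= v s.[c].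
Proof. by move=> [sK s0] cC; rewrite conj_val. Qed.

Lemma same_res_refl c : c \in C -> same_res c c.
Proof. by move=> _; apply/asboolP => s _; rewrite subrr Defs.val0 (v0_lt_Inf v). Qed.

Lemma same_res_sym c d : c \in C -> d \in C -> same_res c d -> same_res d c.
Proof. by move=> _ _ /asboolP h; apply/asboolP => s /h; rewrite vBC. Qed.

Lemma same_res_trans b c d : b \in C -> c \in C -> d \in C ->
  same_res b c -> same_res c d -> same_res b d.
Proof.
move=> _ _ _ /asboolP h1 /asboolP h2; apply/asboolP => s hs.
exact: vtri_gt (h1 s hs) (h2 s hs).
Qed.

Lemma same_res_fix rho c d : fixes Kx rho -> c \in C -> d \in C ->
  same_res (rho c) (rho d) = same_res c d.
Proof.
move=> fr cC dC; have cK := conj_Kt aK cC; have dK := conj_Kt aK dC.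
by apply/asboolP/asboolP => h s hs; have := h s hs; case: hs => sK _;
  rewrite -!(fixes_horner _ hK (fix_K fr) sK) -rmorphB fix_val //;
  apply: (sfB hKt); apply: hor_Kt.
Qed.

Local Notation uC := (conj_uniq Kx a).
Local Notation blkC := (blk C same_res).
Local Notation R := (breps C same_res).
Local Notation aC := (conj_self hKx algKx a).

Lemma trace_blk_map rho c : fixes Kx rho -> c \in C ->
  perm_eq (map rho (blkC c)) (blkC (rho c)).
Proof.
move=> fr cC; apply: blk_map => //; first exact: fmorph_inj.
  exact: (conj_perm hKx algKx a fr).
by move=> c1 d1; apply: same_res_fix.
Qed.

Lemma size_trace_blk c : c \in C -> size (blkC c) = size (blkC a).
Proof.
move=> /(conjP hKx algKx) [rho fr <-].
by rewrite -(perm_size (trace_blk_map fr aC)) size_map.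
Qed.

Local Notation m := (size (blkC a)).

Lemma size_conj_blk : deg K a = (size R * m)%N.
Proof.
rewrite -degKx // -(sep_size_conj hKx algKx); last first.
  by apply: sep_over_mono (tame_sep La); apply: K_Kx.
have := big_blocks same_res_refl same_res_sym same_res_trans addn (fun=> 1%N).
rewrite sum1_size => ->; rewrite big_seq (eq_bigr (fun=> m)); last first.
  by move=> r hr; rewrite sum1_size size_trace_blk //; apply: breps_sub hr; apply: same_res_refl.
by rewrite -big_seq big_const_seq count_predT iter_addn_0 mulnC.
Qed.

Lemma m_gt0 : (0 < m)%N.
Proof. by have := blk_self same_res_refl aC; case: (blkC a). Qed.

(** Dedekind's independence of characters for the embeddings of the residue field of
    K(a) given by distinct blocks: to shorten a relation, multiply it by s0(c0) and
    subtract the relation for s s0, where s0 has distinct residues at c0 and at some c. *)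
Lemma dedekind (cs : seq F) (w : F -> F) : uniq cs -> {subset cs <= C} ->
  (forall c d, c \in cs -> d \in cs -> same_res c d -> c = d) ->
  (forall c, v0 <= v (w c)) ->
  (forall s, int_at s -> v0 < v (\sum_(c <- cs) w c * s.[c])) ->
  forall c, c \in cs -> v0 < v (w c).
Proof.
elim: cs w => [//|c0 cs IH] w /= /andP[c0n ucs] sub neq w0 h.
have hc0 : c0 \in C by apply: sub; rewrite mem_head.
have subcs c : c \in cs -> c \in C by move=> hc; apply: sub; rewrite inE hc orbT.
have tail c : c \in cs -> v0 < v (w c).
  move=> ccs; have : ~~ same_res c0 c.
    apply/negP => /neq e; move: c0n; rewrite e ?ccs ?inE ?ccs ?eqxx ?orbT //.
  move=> /asboolPn /existsNP [s0 /not_implyP [hs0 nlt]].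
  have hs0c d : d \in C -> v0 <= v s0.[d] by apply: int_conj.
  have e0 : v (s0.[c0] - s0.[c]) = v0.
    have ge : v0 <= v (s0.[c0] - s0.[c]) by apply: vB_ge; apply: hs0c => //; apply: subcs.
    by apply: le_anti; rewrite ge andbT leNgt; apply/negP.
  pose w' d := if d \in cs then w d * (s0.[c0] - s0.[d]) else 0.
  have lt : v0 < v (w' c).
    apply: (IH w') => //.
    - by move=> d1 d2 h1 h2; apply: neq; rewrite inE ?h1 ?h2 orbT.
    - move=> d; rewrite /w'; case: ifP => hd; last exact: v00_ge0.
      by apply: vM_ge0 => //; apply: vB_ge; apply: hs0c => //; apply: subcs.
    move=> s hs.
    have hss : int_at (s * s0).
      case: hs hs0 {hs0c nlt} => [sK sa] [s0K s0a]; split; first exact: (polM hK).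
      by rewrite hornerM; apply: vM_ge0.
    have := vB_gt (vM_gt0r (hs0c _ hc0) (h s hs)) (h _ hss).
    rewrite !big_cons mulrDr opprD addrACA hornerM.
    rewrite [X in X + _](_ : _ = 0) ?add0r; last first.
      by apply/eqP; rewrite subr_eq0 [s.[c0] * _]mulrC mulrCA.
    rewrite mulr_sumr -sumrB.
    suff -> : \sum_(i <- cs) (s0.[c0] * (w i * s.[i]) - w i * (s * s0).[i]) =
      \sum_(i <- cs) w' i * s.[i] by [].
    apply: eq_big_seq => d hd; rewrite /w' hd hornerM mulrBr mulrBl.
    by congr (_ - _); [rewrite mulrCA mulrA mulrAC | rewrite [s.[d] * _]mulrC mulrA].
  by move: lt; rewrite /w' ccs mulrC vM0l.
move=> c; rewrite inE => /orP[/eqP ->|]; last exact: tail.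
have h1 : int_at 1 by split; [exact: pol1 | rewrite hornerC; exact: v1_ge0].
have := h 1 h1; rewrite big_cons; under eq_bigr do rewrite hornerC mulr1.
rewrite hornerC mulr1 => h0.
have h2 : v0 < v (\sum_(c <- cs) w c) by apply: vsum_gt_in => //; exact: (v0_lt_Inf v).
by have := vB_gt h0 h2; rewrite addrK.
Qed.

(** By independence, the sum of the distinct residue characters is not zero. *)
Lemma trace_reps : exists2 s, int_at s & v (\sum_(r <- R) s.[r]) = v0.
Proof.
have subR r : r \in R -> r \in C by apply: breps_sub; apply: same_res_refl.
have rR : brep C same_res a \in R by apply: brep_in; apply: aC.
apply/not_exists2P => nex.
have [] // : ~ (v0 < v (1 : F)) by rewrite Defs.val1 ltxx.
apply: (@dedekind R (fun=> 1) (undup_uniq _) subR _ _ _ _ rR).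
- by move=> c d; apply: breps_neq; [exact: same_res_refl|exact: same_res_sym|exact: same_res_trans].
- by move=> c; apply: v1_ge0.
move=> s hs; under eq_bigr do rewrite mul1r.
case: (nex s) => // ne; rewrite lt_neqAle eq_sym; apply/andP; split; first exact/eqP.
by apply: vsum_ge_in => r /subR; apply: int_conj.
Qed.

(** Modulo the maximal ideal, the trace of s is m times the sum over the blocks, where m
    is the number of conjugates in a block. *)
Lemma trace_unit_of_block : v m%:R = v0 ->
  exists2 s, int_at s & v (\sum_(c <- C) s.[c]) = v0.
Proof.
move=> vm; have [s hs es] := trace_reps; exists s => //.
have := big_blocks same_res_refl same_res_sym same_res_trans +%R (fun c => s.[c]).
move=> ->.
have subR r : r \in R -> r \in C by apply: breps_sub; apply: same_res_refl.
have key : v0 < v (\sum_(r <- R) \sum_(c <- blkC r) s.[c] - m%:R * \sum_(r <- R) s.[r]).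
  rewrite mulr_sumr -sumrB; apply: vsum_gt_in; first exact: (v0_lt_Inf v).
  move=> r rR; have -> : m%:R * s.[r] = \sum_(c <- blkC r) s.[r].
    by rewrite big_const_seq count_predT iter_addr_0 size_trace_blk ?subR // mulr_natl.
  rewrite -sumrB; apply: vsum_gt_in; first exact: (v0_lt_Inf v).
  move=> c; rewrite mem_filter => /andP[/asboolP h cC]; rewrite vBC; exact: h.
have e : v (m%:R * \sum_(r <- R) s.[r]) = v0 by apply: vM_eq0.
by rewrite -(subrK (m%:R * \sum_(r <- R) s.[r]) (\sum_(r <- R) _)) vD_ltr e.
Qed.

Let blk_sub c d : d \in blkC c -> d \in C.
Proof. by rewrite mem_filter => /andP[]. Qed.
Let subR r : r \in R -> r \in C.
Proof. by apply: breps_sub; apply: same_res_refl. Qed.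
Let repR c : c \in C -> brep C same_res c \in R.
Proof. exact: brep_in. Qed.
Let rep_same c : c \in C -> same_res c (brep C same_res c).
Proof. by move=> cC; have [] := brepP same_res_refl cC. Qed.
Let blkE c d : c \in C -> d \in C -> same_res c d -> blkC c = blkC d.
Proof. by apply: blk_eq; [exact: same_res_sym | exact: same_res_trans]. Qed.

(** The difference of two distinct conjugates of a with the same residue, or the inverse
    of a if a is not integral, has positive value; a power of it has the value of an
    element of K. *)
Lemma nontrivial_K : (1 < m)%N -> exists d, [/\ K d, d != 0 & v0 < v d].
Proof.
move=> m1; have ub : uniq (blkC a) by rewrite filter_uniq ?uC.
have [c cb ca] : exists2 c, c \in blkC a & c != a.
  move: m1 ub; case: (blkC a) => [|c1 [|c2 s]] //= _ /andP[].
  rewrite inE negb_or => /andP[c12 _] _; case: (eqVneq c1 a) => [e|n].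
    by exists c2; rewrite ?inE ?eqxx ?orbT // -e eq_sym.
  by exists c1; rewrite ?inE ?eqxx.
have cC := blk_sub cb; have cK := conj_Kt aK cC.
have pos u : Kt u -> u != 0 -> v0 < v u -> exists d, [/\ K d, d != 0 & v0 < v d].
  move=> uK u0 lt; have [k [d [k0 Kd d0 e]]] := val_torsion v hK uK u0.
  by exists d; split=> //; rewrite -e vX_gt0.
case: (leP v0 (v a)) => [a0|a0].
  apply: (pos (a - c)); first exact: (sfB hKt).
    by rewrite subr_eq0 eq_sym.
  move: cb; rewrite mem_filter => /andP[/asboolP /(_ 'X) h _].
  by move: h; rewrite !hornerX; apply; split; [exact: polX | rewrite hornerX].
have an0 : a != 0 by apply: vneq0_lt a0.
by apply: (pos a^-1); rewrite ?invr_eq0 ?vV_lt0 //; apply: (sfV hKt).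
Qed.

(** The powers of an element of positive value show that K is infinite. *)
Lemma nonroot_K (H : {poly F}) : (1 < m)%N -> H != 0 -> exists2 l, K l & ~~ root H l.
Proof.
move=> m1 H0; have [d [Kd d0 vd]] := nontrivial_K m1.
pose s := [seq d ^+ i | i <- iota 0 (size H)].
have us : uniq s.
  rewrite map_inj_in_uniq ?iota_uniq // => i j _ _ e.
  have mono k l : (k < l)%N -> v (d ^+ k) < v (d ^+ l).
    move=> kl; rewrite -(subnKC (ltnW kl)) exprD -{1}[d ^+ k]mulr1.
    by rewrite vltM2lE ?expf_neq0 // Defs.val1 vX_gt0 // subn_gt0.
  by case: (ltngtP i j) => // /mono; rewrite e ltxx.
have : ~~ all (root H) s.
  apply/negP => al; have := max_poly_roots H0 al us.
  by rewrite size_map size_iota ltnn.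
by case/allPn => l /mapP[i _ ->] n; exists (d ^+ i) => //; apply: (sfX hK).
Qed.

Definition blk_poly c : {poly F} := \prod_(d <- blkC c) ('X - d%:P).

Lemma blk_poly_fix rho c : fixes Kx rho -> c \in C ->
  map_poly rho (blk_poly c) = blk_poly (rho c).
Proof.
move=> fr cC; rewrite /blk_poly -(perm_big _ (trace_blk_map fr cC)) big_map rmorph_prod.
by apply: eq_bigr => d _; rewrite /= rmorphB /= map_polyX map_polyC.
Qed.

(** Evaluating the product of the X - d over the block d of a at a suitable point l of K
    yields an element b of K(a) whose conjugates correspond to the blocks, so that [K(a)
    : K(b)] = m. Both fields have the same residue field: for y in K(a), the product of
    the X - y' over the conjugates y' of y in the block has coefficients in K(b) and its
    reduction is a power of X - yv, whereas yv is separable. Hence m divides the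
    ramification index of K(a), which is prime to the residue characteristic. *)
Lemma block_size_unit : v m%:R = v0.
Proof.
case: (leqP m 1) => [m1|m1].
  have -> : m = 1%N by have := m_gt0; move: m1; case: (size _) => [|[|]].
  exact: Defs.val1.
(* A point of K that is not a root of H separates the block polynomials. *)
pose H := \prod_(r <- R) \prod_(r' <- R | r' != r) (blk_poly r - blk_poly r').
have H0 : H != 0.
  rewrite prodf_seq_neq0; apply/allP => r rR /=.
  rewrite prodf_seq_neq0; apply/allP => r' rR' /=; apply/implyP => rr.
  rewrite subr_eq0; apply/eqP => e.
  have : root (blk_poly r) r.
    by rewrite root_prod_XsubC; apply: blk_self => //; [exact: same_res_refl | exact: subR].
  rewrite e root_prod_XsubC mem_filter => /andP[er _].
  move/eqP: rr; apply; apply: breps_neq rR' rR er;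
    [exact: same_res_refl|exact: same_res_sym|exact: same_res_trans].
have [l Kl nl] := nonroot_K m1 H0.
pose b c := (blk_poly c).[l].
have binj r r' : r \in R -> r' \in R -> b r = b r' -> r = r'.
  move=> rR rR' e; apply/eqP/negPn/negP => ne; move: nl.
  rewrite rootE horner_prod prodf_seq_eq0 => /hasP; apply; exists r => //=.
  rewrite horner_prod prodf_seq_eq0; apply/hasP; exists r' => //=.
  by rewrite eq_sym ne hornerD hornerN -/(b r) -/(b r') e subrr eqxx.
have brho rho c : fixes Kx rho -> c \in C -> rho (b c) = b (rho c).
  by move=> fr cC; rewrite /b -(blk_poly_fix fr cC) -[X in _ = _.[X]](fix_K fr Kl) horner_map.
have same_blk c d : c \in C -> d \in C -> same_res c d -> b c = b d.
  by move=> cC dC /(blkE cC dC) e; rewrite /b /blk_poly e.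
have b_rep c : c \in C -> b c = b (brep C same_res c).
  by move=> cC; apply: same_blk (rep_same cC) => //; apply/subR/repR.
have b_same c d : c \in C -> d \in C -> b c = b d -> same_res c d.
  move=> cC dC; rewrite b_rep // [b d]b_rep // => /binj e.
  rewrite -(brep_eq same_res_refl same_res_sym same_res_trans) // e //; exact: repR.
have aCC : a \in C by exact: aC.
have CA e c : c \in C -> adjoin (K_ e) [set c | c \in C] c by move=> cC; apply: adjoin_gen.
have KA e u : K u -> adjoin (K_ e) [set c | c \in C] u by move=> Ku; do 2!apply: adjoin_base.
have ba : K_ a (b a).
  apply: (conj_fixed_in La) => // [|rho fr ra]; last by rewrite brho ?ra.
  have hA := adjoin_subfield (K_ a) [set c | c \in C].
  rewrite /b /blk_poly horner_prod; apply: (sf_prod hA) => d hd.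
  by rewrite hornerXsubC; apply: (sfB hA); [exact: KA | exact: CA (blk_sub hd)].
have Lb : L (b a) by apply: K_a_L ba.
have bK := L_Kt Lb.
have sub_ba : K_ (b a) `<=` K_ a.
  by apply: adjoin1_min => //; [exact: adjoin_subfield | exact: adjoin_base].
have degb : deg K (b a) = size R.
  rewrite -degKx // -(sep_size_conj hKx algKx); last first.
    by apply: sep_over_mono (tame_sep Lb); apply: K_Kx.
  rewrite -(size_map b R); apply: perm_size; apply: uniq_perm; first exact: conj_uniq.
    by rewrite map_inj_in_uniq ?undup_uniq // => r r'; apply: binj.
  move=> y; apply/idP/mapP => [/(conjP hKx algKx)[rho fr <-]|[r rR ->]].
    have rC : rho a \in C := conj_hom hKx algKx fr aCC.
    by exists (brep C same_res (rho a)); [exact: repR | rewrite brho // b_rep].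
  have [rho fr <-] := conjP hKx algKx (subR rR).
  by rewrite -brho //; apply: (conj_hom hKx algKx fr); apply: conj_self hKx algKx _.
have rbE : rfield (K_ (b a)) = rfield (K_ a).
  apply/seteqP; split; first exact: residue_field_mono.
  move=> _ [y [ya y0] <-].
  have [s [sK _ ey]] := adjoin_alg hK aK ya.
  have hs : int_at s by split; rewrite -?ey.
  pose P := \prod_(c <- blkC a) ('X - (s.[c])%:P).
  have hb : subfield (K_ (b a)) by apply: adjoin_subfield.
  have Pb i : K_ (b a) P`_i.
    apply: (conj_fixed_in La) => // [|rho fr rb].
      have hA := adjoin_subfield (K_ (b a)) [set c | c \in C].
      suff : P \is a polyOver (mem (adjoin (K_ (b a)) [set c | c \in C])).
        by move/(polyE hA); apply.
      rewrite /P big_seq; elim/big_ind: _ => [|p q hp hq|c /blk_sub cC]; first exact: (pol1 hA).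
        by apply: (polM hA).
      apply: (polB hA); first exact: (polX hA).
      apply: (polC hA); apply: (pol_horner hA); last exact: CA.
      by apply: pol_mono sK => u; apply: KA.
    have rC : rho a \in C := conj_hom hKx algKx fr aCC.
    have e : same_res (rho a) a by apply: b_same => //; rewrite -brho.
    rewrite -coef_map; suff -> : map_poly rho P = P by [].
    rewrite /P rmorph_prod /=.
    transitivity (\prod_(c <- map rho (blkC a)) ('X - (s.[c])%:P)).
      rewrite big_map; apply: eq_bigr => c _.
      by rewrite rmorphB /= map_polyX map_polyC /= (fixes_horner c hK (fix_K fr) sK).
    by rewrite (perm_big _ (trace_blk_map fr aCC)) (blkE rC aCC e).
  have Pint i : v0 <= v P`_i.
    rewrite /P -(big_map (fun c => s.[c]) xpredT (fun z => 'X - z%:P)).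
    apply: prod_XsubC_ge0 => z /mapP[c /blk_sub cC ->]; exact: int_conj.
  have [e [f [_ _ _ sep _]]] := tame_ext La.
  have [|q [qm qK rq _] sq] := sep (res y); first by exists y.
  have hR := residue_subfield v hb.
  apply: (@separable_insep_in _ _ _ (map_poly res P) q m hR) => //.
  - apply/(polyE hR) => i; rewrite coef_map_id0 ?res0 //.
    by exists P`_i => //; split; [exact: Pb | exact: Pint].
  - rewrite /P -(big_map (fun c => s.[c]) xpredT (fun z => 'X - z%:P)) res_prod_XsubC.
      rewrite big_map big_seq (eq_bigr (fun=> 'X - (res y)%:P)).
        by rewrite -big_seq big_const_seq count_predT iter_mulr_1.
      move=> c; rewrite mem_filter => /andP[/asboolP /(_ s hs) h cC].
      congr ('X - _%:P); apply/res_eq => //; first exact: int_conj.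
      by rewrite ey vBC.
    by move=> z /mapP[c /blk_sub cC ->]; exact: int_conj.
  - exact: m_gt0.
  - by apply: pol_mono qK; apply: residue_field_mono; apply: adjoin_base.
have [e [f [_ df pe _ ef]]] := tame_ext La.
have [e' [f' [_ df' _ _ ef']]] := tame_ext Lb.
rewrite rbE in df'; have ff := ext_degree_uniq (residue_subfield v hK) df df'.
rewrite size_conj_blk -degb ef' -ff in ef.
have ap : (0 < deg K a)%N by apply: deg_gt0.
have f0 : (0 < f)%N.
  by move: ap; rewrite size_conj_blk -degb ef' -ff !muln_gt0 => /andP[/andP[]].
have em : e = (e' * m)%N.
  by apply/eqP; rewrite -(eqn_pmul2r f0) -ef mulnAC.
apply: vnat_unit; last exact: m_gt0.
by move=> p /pe; rewrite em; apply: contra; apply: dvdn_mull.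
Qed.

(** The analogue for tame extensions of the surjectivity of the trace of integral
    elements. *)
Theorem trace_unit : exists2 s, int_at s & v (\sum_(c <- C) s.[c]) = v0.
Proof. exact: trace_unit_of_block block_size_unit. Qed.

End Trace.

(** * Centres of balls *)

Section Ball.
(** A ball around y consists of the z with U (v (y - z)). With an arbitrary final
    segment U of values this covers closed and open balls and also the intersections of
    balls that the limit case requires. *)
Variable U : value G -> Prop.
Hypotheses (Uup : forall g h, U g -> g <= h -> U h) (UInf : U VInf).

Lemma UD y z : U (v y) -> U (v z) -> U (v (y + z)).
Proof.
move=> hy hz; apply: Uup (Defs.valD v y z).
by rewrite minEle; case: ifP.
Qed.

Lemma UBC y z : U (v (y - z)) -> U (v (z - y)). Proof. by rewrite vBC. Qed.

Lemma Utri y z t : U (v (y - z)) -> U (v (z - t)) -> U (v (y - t)).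
Proof.
move=> h1 h2; have -> : y - t = (y - z) + (z - t) by rewrite addrA subrK.
exact: UD.
Qed.

Lemma U0 y : U (v (y - y)). Proof. by rewrite subrr Defs.val0. Qed.

Lemma Usum (T : eqType) (s : seq T) (f : T -> F) :
  (forall c, c \in s -> U (v (f c))) -> U (v (\sum_(c <- s) f c)).
Proof.
move=> h; rewrite big_seq; elim/big_ind: _ => //; first by rewrite Defs.val0.
exact: UD.
Qed.

Lemma fix_U rho y : fixes Kx rho -> Kt y -> U (v y) -> U (v (rho y)).
Proof. by move=> fr yK; rewrite fix_val. Qed.

(** The trace over the conjugates of a in its ball of an s with unit trace is a unit:
    the full trace is a sum of such partial traces, and these are conjugate to each
    other. So the average of these conjugates with weights s(c) lies in the ball, and it
    is fixed by all embeddings that map the ball into itself. *)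
Lemma descend a : L a -> exists b, [/\ K_ a b, U (v (a - b)) &
  forall rho, fixes Kx rho -> U (v (rho a - a)) -> rho b = b].
Proof.
move=> La; have aK := L_Kt La; set C := conjugates Kx a.
have aC : a \in C := conj_self hKx algKx a.
have CK c : c \in C -> Kt c by apply: conj_Kt.
have [s [sK s0] ts] := trace_unit La; rewrite -/C in ts.
pose e : rel F := fun c d => `[< U (v (c - d)) >].
have er c : c \in C -> e c c by move=> _; apply/asboolP; apply: U0.
have es c d : c \in C -> d \in C -> e c d -> e d c.
  by move=> _ _ /asboolP h; apply/asboolP; apply: UBC.
have et b c d : b \in C -> c \in C -> d \in C -> e b c -> e c d -> e b d.
  by move=> _ _ _ /asboolP h1 /asboolP h2; apply/asboolP; apply: Utri h1 h2.
have ef rho c d : fixes Kx rho -> c \in C -> d \in C -> e (rho c) (rho d) = e c d.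
  move=> fr cC dC; rewrite /e -rmorphB fix_val //.
  by apply: (sfB hKt); apply: CK.
have bm rho c : fixes Kx rho -> c \in C -> perm_eq (map rho (blk C e c)) (blk C e (rho c)).
  move=> fr cC; apply: blk_map => //; first exact: fmorph_inj.
    exact: (conj_perm hKx algKx a fr).
  by move=> c1 d1; apply: ef.
pose B := blk C e a.
have BC c : c \in B -> c \in C by rewrite mem_filter => /andP[].
pose T c := \sum_(d <- blk C e c) s.[d].
have Tr rho : fixes Kx rho -> rho (T a) = T (rho a).
  move=> fr; rewrite /T -(perm_big _ (bm rho a fr aC)) big_map rmorph_sum.
  by apply: eq_bigr => c _; rewrite /= (fixes_horner c hK (fix_K fr) sK).
have sc c : c \in C -> v0 <= v s.[c] by move=> cC; rewrite (conj_val La sK cC).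
have TK : Kt (T a).
  by apply: (sf_sum hKt) => c /BC cC; apply: hor_Kt sK (CK c cC).
have T0 : v (T a) = v0.
  apply: le_anti; rewrite (vsum_ge_in (v := v) (r := B)) ?andbT; last by move=> c /BC /sc.
  rewrite leNgt; apply/negP => lt; move: ts; rewrite (big_blocks er es et).
  have : v0 < v (\sum_(r <- breps C e) T r).
    apply: vsum_gt_in => [|r /(breps_sub er) rC]; first exact: (v0_lt_Inf v).
    have [rho fr <-] := conjP hKx algKx rC.
    by rewrite -Tr // fix_val.
  by move=> + e0; rewrite e0 ltxx.
pose b := (\sum_(c <- B) s.[c] * c) / T a.
have Ta0 := vneq0 T0.
have fb rho : fixes Kx rho -> U (v (rho a - a)) -> rho b = b.
  move=> fr h; have rC : rho a \in C := conj_hom hKx algKx fr aC.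
  have eB : blk C e (rho a) = B by apply: blk_eq => //; apply/asboolP.
  have eT : T (rho a) = T a by rewrite /T eB.
  rewrite /b fmorph_div Tr // eT; congr (_ / _).
  rewrite rmorph_sum; transitivity (\sum_(c <- map rho B) s.[c] * c).
    rewrite big_map; apply: eq_bigr => c _.
    by rewrite /= rmorphM (fixes_horner c hK (fix_K fr) sK).
  by rewrite (perm_big _ (bm rho a fr aC)) eB.
exists b; split=> //; last first.
  have -> : a - b = (\sum_(c <- B) s.[c] * (a - c)) / T a.
    apply: (mulIf Ta0); rewrite divfK // mulrBl divfK // {1}/T mulr_sumr -sumrB.
    by apply: eq_bigr => c _; rewrite mulrBr [a * _]mulrC.
  rewrite mulrC vM0l; last exact: vV0.
  apply: Usum => c; rewrite mem_filter => /andP[/asboolP h /sc c0].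
  exact: Uup h (vleMr _ c0).
apply: (conj_fixed_in La) => // [|rho fr ra]; last by apply: fb => //; rewrite ra; apply: U0.
have hA := adjoin_subfield (K_ a) [set c | c \in C].
have sA c : c \in C -> adjoin (K_ a) [set c | c \in C] s.[c].
  move=> cC; apply: (pol_horner hA); last exact: adjoin_gen.
  by apply: pol_mono sK => u Ku; do 2!apply: adjoin_base.
apply: (sf_div hA); apply: (sf_sum hA) => c /BC cC; last exact: sA.
by apply: (sfM hA); [exact: sA | apply: adjoin_gen].
Qed.
End Ball.

Hypothesis dom : forall c, Kt c -> exists2 a, L a & v (x - c) <= v (x - a).

Lemma center_in b c : L b -> Kt c ->
  (forall rho, fixes Kx rho -> rho c = c -> rho b = b) -> K_ c b.
Proof.
move=> Lb cK; apply: (conj_fixed_in Lb) => //.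
by apply: adjoin_gen; apply: conj_self hKx algKx b.
Qed.

(** Some a in L lies in the ball around x, because L comes as close to x as the given
    c0. The descent of a to the fixed field of the stabilizer of the ball gives b. An
    embedding over K(c), with c in the ball, maps the ball to itself and hence fixes b. *)
Lemma center (U : value G -> Prop) c0 : (forall g h, U g -> g <= h -> U h) -> U VInf ->
  Kt c0 -> U (v (x - c0)) ->
  exists b, [/\ L b, U (v (x - b)), forall c, Kt c -> U (v (x - c)) -> K_ c b &
    forall rho, fixes Kx rho -> U (v (rho b - b)) -> rho b = b].
Proof.
move=> Uup UInf c0K Uc0; have [a La va] := dom c0K.
have Ua : U (v (x - a)) := Uup _ _ Uc0 va.
have [b [bKa Uab fb]] := descend Uup UInf La.
have aK := L_Kt La; have Lb : L b by apply: K_a_L bKa.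
have bK := L_Kt Lb.
have tri y z t := @Utri U Uup y z t.
exists b; split=> //.
- exact: tri Ua Uab.
- move=> c cK Uc; apply: center_in => // rho fr rc; apply: fb => //.
  have Uac : U (v (a - c)) by apply: tri Uc; apply: UBC.
  apply: (tri _ c); last exact: UBC.
  by rewrite -{1}rc -rmorphB; apply: fix_U => //; apply: (sfB hKt).
- move=> rho fr Ub; apply: fb => //.
  apply: (tri _ (rho b)); last by apply: tri Ub _; apply: UBC.
  by rewrite -rmorphB; apply: fix_U => //; apply: (sfB hKt).
Qed.

(** * Minimal elements *)

Definition minimal_elt c : Prop :=
  Kt c /\ forall c', Kt c' -> (deg K c' < deg K c)%N -> v (x - c') < v (x - c).

(** Let b be the centre of the ball around x on whose boundary c lies. Then K(b) is
    contained in K(c), and by minimality of c it is not smaller. So K(c) = K(b), and c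
    shares the properties of b. *)
Lemma minimal_props c : minimal_elt c ->
  [/\ L c, forall rho, fixes Kx rho -> v (x - c) <= v (x - rho c) -> rho c = c &
    forall c', Kt c' -> v (x - c) <= v (x - c') -> K_ c' c].
Proof.
move=> [cK cmin]; pose U g := v (x - c) <= g.
have [||//|//|b [Lb Ub hb fb]] := @center U c.
- by move=> g h; apply: le_trans.
- exact: vVInf_max.
- exact: lexx.
have bc : K_ c b by apply: hb => //; exact: lexx.
have bK := L_Kt Lb.
have dcb : (deg K c <= deg K b)%N.
  by rewrite leqNgt; apply/negP => /(cmin _ bK); rewrite ltNge => /negP; apply.
have cb := adjoin_deg_eq hK cK bc dcb.
have cKb : K_ b c by apply: cb; apply: adjoin_elt.
have Lc : L c by apply: K_a_L cKb.
split=> //.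
- move=> rho fr h.
  have rb : rho b = b.
    apply: fb => //; apply: (@vtri_ge _ _ v _ _ (rho c)).
      rewrite -rmorphB fix_val //; last exact: (sfB hKt).
      by apply: (@vtri_ge _ _ v _ _ x) => //; rewrite vBC.
    apply: (@vtri_ge _ _ v _ _ c).
      by apply: (@vtri_ge _ _ v _ _ x) => //; rewrite vBC.
    by apply: (@vtri_ge _ _ v _ _ x) => //; rewrite vBC.
  by apply: (@fixes_agree _ K b rho idfun) => //; apply: fix_K.
- move=> c' c'K h; have bc' := hb _ c'K h.
  have sub : K_ b `<=` K_ c'.
    by apply: adjoin1_min => //; [exact: adjoin_subfield | exact: adjoin_base].
  exact: sub.
Qed.

Lemma deg_pos c : Kt c -> (0 < deg K c)%N. Proof. exact: deg_gt0. Qed.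

Lemma dom_minimal c : Kt c -> exists c', [/\ minimal_elt c', (deg K c' <= deg K c)%N
  & v (x - c) <= v (x - c')].
Proof.
move=> cK; pose P n := `[< exists c', [/\ Kt c', deg K c' = n & v (x - c) <= v (x - c')] >].
have exP : exists n, P n by exists (deg K c); apply/asboolP; exists c.
case: (ex_minnP exP) => n /asboolP[c' [c'K dn le]] nmin; exists c'; split=> //.
  split=> // c'' c''K lt; rewrite ltNge; apply/negP => le'.
  have := nmin (deg K c''); rewrite leqNgt -dn lt => /(_ _)/negP; case=> //.
  by apply/asboolP; exists c''; split=> //; apply: le_trans le'.
by rewrite dn; apply: nmin; apply/asboolP; exists c.
Qed.

(** Of two minimal elements, the one farther from x generates a subfield of the field
    generated by the other. If this is the one of larger degree, both fields coincide. *)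
Lemma minimal_sub c c' : minimal_elt c -> minimal_elt c' -> (deg K c <= deg K c')%N ->
  K_ c `<=` K_ c'.
Proof.
move=> mc mc' le; have [cK _] := mc; have [c'K hc'] := mc'.
case: (leP (v (x - c)) (v (x - c'))) => h.
  have [_ _ /(_ c' c'K h) cc'] := minimal_props mc.
  by apply: adjoin1_min => //; [exact: adjoin_subfield | exact: adjoin_base].
have [_ _ /(_ c cK (ltW h)) c'c] := minimal_props mc'.
exact: (adjoin_deg_eq hK cK c'c).
Qed.

Lemma minimal_lt c c' : minimal_elt c -> minimal_elt c' -> (deg K c < deg K c')%N ->
  v (x - c) < v (x - c').
Proof. by move=> [cK _] [_ h]; apply: h. Qed.

Definition of_degree d c : Prop := minimal_elt c /\ deg K c = d.
Definition top_of d c : Prop :=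
  of_degree d c /\ forall c', of_degree d c' -> v (x - c') <= v (x - c).

(** Otherwise let b be the centre of the intersection of the balls around x defined by
    the minimal elements of degree d, an intersection that contains e. Those of the
    finitely many conjugates of b that are outside it are already outside one of these
    balls. So a sufficiently good c of degree d is moved by every embedding that moves
    b, whence b lies in K(c). Then b has degree at most d and is closer to x than all
    minimal elements of degree d, which is absurd. *)
Lemma top_exists d e : (exists c, of_degree d c) -> Kt e ->
  (forall c, of_degree d c -> v (x - c) < v (x - e)) -> exists c, top_of d c.
Proof.
move=> [c0 hc0] eK he; apply/not_notP => ntop.
have nomax c : of_degree d c -> exists2 c', of_degree d c' & v (x - c) < v (x - c').
  move=> hc; apply/not_notP => h; apply: ntop; exists c; split=> // c' hc'.
  by rewrite leNgt; apply/negP => lt; apply: h; exists c'.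
pose U g := forall c, of_degree d c -> v (x - c) < g.
have [||//|//|b [Lb Ub _ fb]] := @center U e.
- by move=> g h Ug gh c hc; apply: lt_le_trans (Ug c hc) gh.
- by move=> c hc; apply: lt_le_trans (he c hc) _; apply: vVInf_max.
have bK := L_Kt Lb.
have [c1 hc1 far] : exists2 c1, of_degree d c1 &
    forall r, r \in conjugates Kx b -> ~ U (v (r - b)) -> v (r - b) <= v (x - c1).
  elim: (conjugates Kx b) => [|r s [c1 hc1 IH]]; first by exists c0.
  case: (pselect (U (v (r - b)))) => [Ur|nUr].
    by exists c1 => // r'; rewrite inE => /orP[/eqP -> //|]; apply: IH.
  move: nUr => /existsNP[c2 /not_implyP[hc2 /negP]]; rewrite -leNgt => le.
  case: (leP (v (x - c1)) (v (x - c2))) => h.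
    exists c2 => // r'; rewrite inE => /orP[/eqP -> //|r's nU].
    exact: le_trans (IH _ r's nU) h.
  exists c1 => // r'; rewrite inE => /orP[/eqP -> _|r's nU]; last exact: IH.
  exact: le_trans le (ltW h).
have [c2 hc2 lt12] := nomax c1 hc1.
have c2K : Kt c2 by case: hc2 => -[].
have bc2 : K_ c2 b.
  apply: center_in => // rho fr rc; apply: fb => //; apply/not_notP => nU.
  have rb : rho b \in conjugates Kx b.
    by apply: (conj_hom hKx algKx fr); apply: (conj_self hKx algKx).
  have := far _ rb nU; rewrite leNgt => /negP; apply; apply: lt_le_trans lt12 _.
  have le : v (x - c2) <= v (b - c2).
    by apply: (@vtri_ge _ _ v _ _ x) => //; rewrite vBC; apply: ltW; apply: Ub.
  apply: (@vtri_ge _ _ v _ _ c2); last by rewrite vBC.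
  by rewrite -{2}rc -rmorphB fix_val //; apply: (sfB hKt).
have dle := deg_adjoin_le hK c2K bc2.
have [mc2 dc2] := hc2.
have db : deg K b = d.
  apply/eqP; rewrite eqn_leq -{1}dc2 dle leqNgt; apply/negP; rewrite -dc2 => lt.
  case: mc2 => _ /(_ b bK lt) h; have := Ub c2 hc2.
  by move/(lt_trans h); rewrite ltxx.
have hb : of_degree d b.
  split=> //; split=> // c' c'K; rewrite db -dc2 => lt.
  by case: (mc2) => _ /(_ c' c'K lt) h; apply: lt_trans h (Ub c2 hc2).
by have := Ub b hb; rewrite ltxx.
Qed.

Definition Dset d : Prop := exists c, of_degree d c.

Lemma Dset1 : Dset 1.
Proof.
have d0 : deg K 0 = 1%N by apply: deg1 => //; apply: (sf0 hK).
exists 0; split=> //; split=> [|c cK]; first by apply: K_Kt; apply: (sf0 hK).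
by rewrite d0 ltnS leqn0 => /eqP d; have := deg_pos cK; rewrite d.
Qed.

Lemma Dset_pos d : Dset d -> (0 < d)%N.
Proof. by move=> [c [[cK _] <-]]; apply: deg_pos. Qed.

(** A best minimal element of degree d if there is one, and an arbitrary minimal element
    of degree d otherwise. *)
Definition pick_elt d : F := xget (xget 0 (of_degree d)) (top_of d).

Lemma pick_deg d : Dset d -> of_degree d (pick_elt d).
Proof.
move=> h; rewrite /pick_elt; case: xgetP => [c _ [] //|_].
exact: xgetPex.
Qed.

Lemma pick_top d : (exists c, top_of d c) -> top_of d (pick_elt d).
Proof. exact: xgetPex. Qed.

Lemma pick_top_lt d d' : Dset d -> Dset d' -> (d < d')%N -> top_of d (pick_elt d).
Proof.
move=> Dd [e [me de]] lt; apply: pick_top; apply: (@top_exists d e) => //; first by case: me.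
by move=> c [mc dc]; apply: minimal_lt; rewrite ?dc ?de.
Qed.

(** * The implicit constant field *)

Section ImplicitConstants.
Variable A : set F.
Hypothesis Amin : forall a, A a -> minimal_elt a.
Local Notation L0 := (adjoin K A).
Hypothesis Adom : forall c, Kt c -> exists2 b, L0 b & v (x - c) <= v (x - b).
Local Notation L0x := (adjoin L0 [set x]).

Lemma L0_sub : subfield L0. Proof. exact: adjoin_subfield. Qed.
Lemma K_L0 : K `<=` L0. Proof. exact: adjoin_base. Qed.
Lemma L0_Kt : L0 `<=` Kt.
Proof.
by apply: adjoin_min; [exact: hKt | exact: K_Kt | move=> a /Amin []].
Qed.
Lemma L0_L : L0 `<=` L.
Proof.
apply: adjoin_min; [exact: hL | exact: K_L |].
by move=> a /Amin /minimal_props[].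
Qed.

Lemma Kx_L0x : Kx `<=` L0x. Proof. by apply: adjoin_mono => //; apply: K_L0. Qed.

(** Krasner's lemma for minimal elements: a is the only one of its conjugates that is as
    close to x as a. *)
Lemma val_fixed_center rho a : minimal_elt a -> fixes Kx rho ->
  v (rho (x - a)) = v (x - a) -> rho a = a.
Proof.
move=> ma fr e; have [_ h _] := minimal_props ma.
by apply: h => //; rewrite -e rmorphB (fix_x fr).
Qed.

(** Let E' be a henselian field containing K(x). Its embeddings preserve the value of x
    - a, hence fix the minimal element a, which is separable; so a lies in E'. *)
Lemma IC_sup : L0 `<=` implicit_constant_field v Kx K.
Proof.
have hH : subfield (henselization v Kx).
  apply: subfieldP => [E' [[h _] _]|y z hy hz E' hE'|y z hy hz E' hE'].
  - exact: (sf1 h).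
  - by case: (hE') => -[h _] _; apply: (sfB h); [apply: hy | apply: hz].
  - by case: (hE') => -[h _] _; apply: (sf_div h); [apply: hy | apply: hz].
apply: adjoin_min.
- apply: subfieldP => [|y z [y1 y2] [z1 z2]|y z [y1 y2] [z1 z2]]; split.
  + exact: (sf1 hH).
  + exact: (sf1 hKt).
  + exact: (sfB hH).
  + exact: (sfB hKt).
  + exact: (sf_div hH).
  + exact: (sf_div hKt).
- move=> y Ky; split; last exact: K_Kt.
  by move=> E' [_ sub]; apply: sub; apply: K_Kx.
move=> a Aa; have ma := Amin Aa; split; last by case: ma.
move=> E' [[hE' hens'] sub].
have algE' y : algebraic_over E' y by apply: algebraic_mono (algKx y).
apply: (fixed_sep hE' algE').
  apply: sep_over_mono (tame_sep _); first exact: subset_trans K_Kx sub.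
  by have [] := minimal_props ma.
move=> rho fr; apply: val_fixed_center => //; first exact: fixes_mono fr.
by apply: (henselian_fix hE' hens' fr); apply: algE'.
Qed.

Definition decomposition (rho : {rmorphism F -> F}) : Prop :=
  fixes Kx rho /\ forall u, v (rho u) = v u.
(** The decomposition field of v over K(x). In positive characteristic it is in general
    only a purely inseparable extension of the henselization of K(x). *)
Definition decfield : set F := [set u | forall rho, decomposition rho -> rho u = u].

Lemma decfield_sub : subfield decfield.
Proof.
apply: subfieldP => [rho _|y z hy hz rho h|y z hy hz rho h].
- exact: rmorph1.
- by rewrite rmorphB hy ?hz.
- by rewrite fmorph_div hy ?hz.
Qed.

Lemma L0x_decfield : L0x `<=` decfield.
Proof.
apply: adjoin1_min; first exact: decfield_sub; last by move=> rho [/fix_x].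
apply: adjoin_min; first exact: decfield_sub.
  by move=> y Ky rho [fr _]; apply: fix_K.
move=> a Aa rho [fr vr]; apply: val_fixed_center => //; exact: Amin.
Qed.

(** The orbit of u under the decomposition group is finite, so it is the set of roots of
    a polynomial over the decomposition field; an embedding over that field therefore
    maps u into the orbit. *)
Lemma fix_decfield_val rho u : fixes decfield rho -> v (rho u) = v u.
Proof.
move=> fr; pose O := [seq c <- conjugates Kx u | `[< exists r, decomposition r /\ r u = c >]].
have OP c : c \in O -> exists r, decomposition r /\ r u = c.
  by rewrite mem_filter => /andP[/asboolP].
have inO r : decomposition r -> r u \in O.
  move=> dr; rewrite mem_filter; apply/andP; split; first by apply/asboolP; exists r.
  by case: dr => fr' _; apply: (conj_hom hKx algKx fr'); apply: (conj_self hKx algKx).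
pose P := \prod_(c <- O) ('X - c%:P).
have PH : P \is a polyOver (mem decfield).
  apply/(polyE decfield_sub) => i r dr; rewrite -coef_map.
  suff -> : map_poly r P = P by [].
  have pO : perm_eq (map r O) O.
    apply: perm_map_closed; [by rewrite filter_uniq ?conj_uniq | exact: fmorph_inj |].
    move=> _ /OP[s [[fs vs] <-]]; case: (dr) => fr' vr.
    apply: (inO (r \o s : {rmorphism F -> F})); split.
      by move=> w Kw; rewrite /= fs // fr'.
    by move=> w; rewrite /= vr vs.
  transitivity (\prod_(c <- map r O) ('X - c%:P)); last by rewrite (perm_big _ pO).
  rewrite rmorph_prod big_map; apply: eq_bigr => c _.
  by rewrite /= rmorphB /= map_polyX map_polyC.
have : root P u.
  by rewrite root_prod_XsubC; apply: (inO idfun).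
move/(fixes_root decfield_sub fr PH); rewrite root_prod_XsubC => /OP[r [[_ vr] <-]].
exact: vr.
Qed.

(** Choose b in K(A) at least as close to x as c. Since rho preserves v(b - c), it
    cannot change v(x - c). *)
Lemma val_x_conj rho c : fixes L0x rho -> Kt c -> v (x - rho c) = v (x - c).
Proof.
move=> fr cK; have frK : fixes Kx rho by apply: fixes_mono fr; apply: Kx_L0x.
have rcK : Kt (rho c) by apply: fix_Kt cK; apply: fix_K.
have fL0 b : L0 b -> rho b = b by move=> Lb; apply: fr; apply: adjoin_base.
have eq b : L0 b -> v (b - rho c) = v (b - c).
  move=> Lb; rewrite -{1}(fL0 b Lb) -rmorphB fix_val //.
  by apply: (sfB hKt) => //; apply: L0_Kt.
apply: le_anti; apply/andP; split.
  rewrite leNgt; apply/negP => lt; have [b Lb le] := Adom rcK.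
  have lt' : v (x - c) < v (b - c).
    rewrite -eq //; apply: lt_le_trans lt _.
    by apply: (@vtri_ge _ _ v _ _ x) => //; rewrite vBC.
  by have := vtri_gt (lt_le_trans lt le) lt'; rewrite ltxx.
have [b Lb le] := Adom cK.
apply: (@vtri_ge _ _ v _ _ b) => //; rewrite eq //.
by apply: (@vtri_ge _ _ v _ _ x) => //; rewrite vBC.
Qed.

(** A polynomial over the algebraic closure of K splits into linear factors x - c. *)
Lemma val_Ktx rho u : fixes L0x rho -> adjoin Kt [set x] u -> v (rho u) = v u.
Proof.
move=> fr /(adjoin_frac hKt)[p [q [pK qK _ ->]]].
have rx : rho x = x by apply: fr; apply: adjoin_elt.
have frK : fixes Kx rho by apply: fixes_mono fr; apply: Kx_L0x.
suff key p' : p' \is a polyOver (mem Kt) -> v (rho p'.[x]) = v p'.[x].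
  by rewrite fmorph_div; apply: veqM; [exact: key | apply: vV_eq; exact: key].
move=> pK'; have [r e] := closed_field_poly_normal p'.
have [->|p0] := eqVneq p' 0; first by rewrite horner0 rmorph0.
have lK : Kt (lead_coef p') by move/(polyE hKt): pK'; apply.
have rK c : c \in r -> Kt c.
  move=> cr; apply: (alg_trans hK); exists p' => //.
  by rewrite e rootZ ?lead_coef_eq0 // root_prod_XsubC.
rewrite e hornerZ horner_prod rmorphM rmorph_prod; apply: veqM; first exact: fix_val.
apply: vprod_eq => c /rK cK; rewrite /= hornerXsubC rmorphB rx.
exact: val_x_conj.
Qed.

(** As rho preserves v on the compositum of x with the algebraic closure of K, it
    becomes compatible with v on F after composition with an embedding that fixes this
    compositum, and hence y. The result belongs to the decomposition group. *)
Lemma decfield_fixed y : Kt y -> decfield y -> forall rho, fixes L0x rho -> rho y = y.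
Proof.
move=> yK yH rho fr; have hM := adjoin_subfield Kt [set x].
have frK : fixes Kx rho by apply: fixes_mono fr; apply: Kx_L0x.
have algM z : algebraic_over (adjoin Kt [set x]) z.
  by apply: alg_Ex; apply: K_Kt.
have [|tau [ft vt]] := val_conj (v := v) (w := pullback v rho) hM algM.
  by move=> u /= hu; apply: val_Ktx.
have ty : tau y = y by apply: ft; apply: adjoin_base.
rewrite -{1}ty; apply: (yH (rho \o tau : {rmorphism F -> F})); split => [u Ku|u].
  rewrite /= ft ?frK //; move: u Ku; apply: adjoin_mono => //; exact: K_Kt.
exact: vt.
Qed.

(** Suppose that an element y of the implicit constant field is not in K(A), and let E
    be maximal among the fields between K(A)(x) and the decomposition field that do not
    contain y. An element of the decomposition field that is separable over E lies in E:
    otherwise y would be separable over E, and being fixed by the embeddings over E it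
    would lie in E. So the decomposition field is purely inseparable over E, embeddings
    over E preserve v, and E is henselian. Thus E contains y, a contradiction. *)
Lemma IC_inf : implicit_constant_field v Kx K `<=` L0.
Proof.
move=> y [yh yK]; apply/not_notP => nL0.
have algH z : algebraic_over decfield z.
  by apply: algebraic_mono (algKx z); apply: subset_trans L0x_decfield; apply: Kx_L0x.
have hensP E : subfield E -> Kx `<=` E -> (forall rho u, fixes E rho -> v (rho u) = v u) -> E y.
  move=> hE sub inv; apply: yh; split=> //; split=> //.
  by apply: henselian_crit => // z; apply: algebraic_mono (algKx z).
have KxH : Kx `<=` decfield by apply: subset_trans L0x_decfield; apply: Kx_L0x.
have yH : decfield y.
  by apply: hensP => //; [exact: decfield_sub | move=> rho u; apply: fix_decfield_val].
have yfix := decfield_fixed yK yH.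
pose good E := [/\ subfield E, L0x `<=` E, E `<=` decfield & ~ E y].
have good0 : good L0x.
  split=> //; [exact: adjoin_subfield | exact: L0x_decfield |].
  by move/(adjoin_trans_alg hK L0_sub L0_Kt trx yK).
pose T := {E : set F | good E}.
pose R (s t : T) := `[< sval s `<=` sval t >].
have [|||t tmax] := @ZL_preorder T (exist _ L0x good0) R.
- by move=> s; apply/asboolP.
- by move=> r s t /asboolP h1 /asboolP h2; apply/asboolP; apply: subset_trans h2.
- move=> Ch tot; case: (pselect (exists s, Ch s)) => [[s0 Cs0]|n]; last first.
    by exists (exist _ L0x good0) => s Cs; case: n; exists s.
  pose M u := exists s, Ch s /\ sval s u.
  have pair u w : M u -> M w -> exists s, [/\ Ch s, sval s u & sval s w].
    move=> [s [Cs su]] [t [Ct tw]]; case: (tot s t Cs Ct) => /asboolP sub.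
      by exists t; split=> //; apply: sub.
    by exists s; split=> //; apply: sub.
  have gM : good M.
    split.
    - apply: subfieldP => [|u w /pair h /h [s [Cs su sw]]|u w /pair h /h [s [Cs su sw]]].
      + by exists s0; split=> //; case: (svalP s0) => h _ _ _; apply: (sf1 h).
      + by exists s; split=> //; case: (svalP s) => h' _ _ _; apply: (sfB h').
      + by exists s; split=> //; case: (svalP s) => h' _ _ _; apply: (sf_div h').
    - by move=> u hu; exists s0; split=> //; case: (svalP s0) => _ h _ _; apply: h.
    - by move=> u [s [_ su]]; case: (svalP s) => _ _ h _; apply: h.
    - by move=> [s [_ sy]]; case: (svalP s) => _ _ _; apply.
  by exists (exist _ M gM) => s Cs; apply/asboolP => u su; exists s.
case: t tmax => E /= gE tmax; have [hE sL0 sH nEy] := gE.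
have KxE : Kx `<=` E by apply: subset_trans sL0; apply: Kx_L0x.
have algE z : algebraic_over E z by apply: algebraic_mono (algKx z).
have insep u : decfield u -> ~ E u -> ~ sep_over E u.
  move=> Hu nEu su; set E' := adjoin E [set u].
  have EE' : E `<=` E' by apply: adjoin_base.
  case: (pselect (E' y)) => [E'y|nE'y].
    apply: nEy; apply: (fixed_simple hE algE su E'y) => rho fr.
    by apply: yfix; apply: fixes_mono fr.
  have gE' : good E'.
    split=> //; [exact: adjoin_subfield | exact: subset_trans EE' |].
    by apply: adjoin1_min => //; exact: decfield_sub.
  have /asboolP h := tmax (exist _ E' gE') (introT (asboolP _) EE').
  by apply: nEu; apply: h; apply: adjoin_elt.
have fixH rho : fixes E rho -> fixes decfield rho.
  move=> fr u Hu; have [n] := ubnP (deg E u).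
  elim: n u Hu => // n IH u Hu; rewrite ltnS => le.
  case: (pselect (E u)) => [|nEu]; first exact: fr.
  have [q qc lt] := insep_power hE algE (insep u Hu nEu).
  have e : rho (u ^+ q) = u ^+ q.
    by apply: IH; [apply: (sfX decfield_sub) | apply: leq_trans le].
  have : (rho u - u) ^+ q = 0.
    rewrite -(pFrobenius_autE qc) pFrobenius_autB_comm; last exact: mulrC.
    by rewrite !pFrobenius_autE -rmorphXn e subrr.
  by move/eqP; rewrite expf_eq0 subr_eq0 => /andP[_ /eqP].
by apply: nEy; apply: hensP => // rho u /fixH; apply: fix_decfield_val.
Qed.

Theorem IC_eq : implicit_constant_field v Kx K = L0.
Proof. by apply/seteqP; split; [exact: IC_inf | exact: IC_sup]. Qed.
End ImplicitConstants.

(** * Immediate and valuation algebraic extensions *)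

Section Immediate.
Variable E : set F.
Hypotheses (hE : subfield E) (KE : K `<=` E) (EK : E `<=` Kt).
(** Every algebraic element is surpassed by an element of E in approximating x: the
    limit case. *)
Hypothesis cof : forall c, Kt c -> exists2 b, E b & v (x - c) < v (x - b).

Lemma one_unitM y z : v0 < v (y - 1) -> v0 < v (z - 1) -> v0 < v (y * z - 1).
Proof.
move=> h1 h2; have y0 : v0 <= v y.
  by rewrite -(subrK 1 y); apply: vD_ge; [exact: ltW | exact: v1_ge0].
have -> : y * z - 1 = y * (z - 1) + (y - 1) by rewrite mulrBr mulr1 addrA subrK.
by apply: vD_gt => //; apply: vM_gt0r.
Qed.

Lemma one_unit_eq y z : z != 0 -> v0 < v (y / z - 1) -> v y = v z /\ v z < v (y - z).
Proof.
move=> z0 h; have e : y - z = z * (y / z - 1) by rewrite mulrBr mulr1 mulrC divfK.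
have lt : v z < v (y - z).
  by rewrite e -{1}[z]mulr1 vltM2lE // Defs.val1.
by split=> //; rewrite -{1}(subrK z y) vD_ltr.
Qed.

(** If b' is closer to x than c, then (x - c) / (b' - c) is a one-unit. *)
Lemma approx_roots (r : seq F) : (forall c, c \in r -> Kt c) -> exists2 b, E b &
  forall b', E b' -> v (x - b) <= v (x - b') -> \prod_(c <- r) (b' - c) != 0 /\
    v0 < v (\prod_(c <- r) (x - c) / \prod_(c <- r) (b' - c) - 1).
Proof.
elim: r => [|c r IH] rK.
  exists 0; first exact: sf0.
  by move=> b' _ _; rewrite !big_nil divr1 subrr oner_neq0 Defs.val0 (v0_lt_Inf v).
have [|b1 E1 h1] := IH; first by move=> d dr; apply: rK; rewrite inE dr orbT.
have [b2 E2 h2] := cof (rK c (mem_head _ _)).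
have key b' : E b' -> v (x - b1) <= v (x - b') -> v (x - b2) <= v (x - b') ->
    \prod_(c <- c :: r) (b' - c) != 0 /\
    v0 < v (\prod_(c <- c :: r) (x - c) / \prod_(c <- c :: r) (b' - c) - 1).
  move=> Eb' l1 l2; have [n0 h] := h1 b' Eb' l1.
  have lt : v (x - c) < v (x - b') := lt_le_trans h2 l2.
  have e : v (b' - c) = v (x - c) by rewrite vBC [RHS]vBC; apply: vtri_eq; rewrite vBC.
  have bc0 : b' - c != 0 by apply: vneq0_lt (_ : v (b' - c) < v (x - b')); rewrite e.
  rewrite !big_cons mulf_neq0 //; split=> //.
  rewrite invfM mulrACA; apply: one_unitM => //.
  have -> : (x - c) / (b' - c) - 1 = (x - b') / (b' - c).
    by apply: (mulIf bc0); rewrite mulrBl !divfK // mul1r opprB addrA subrK.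
  by rewrite vdiv_gt0 // e.
case: (leP (v (x - b1)) (v (x - b2))) => l12.
  exists b2 => // b' Eb' l; apply: key => //; exact: le_trans l12 l.
exists b1 => // b' Eb' l; apply: key => //; exact: le_trans (ltW l12) l.
Qed.

Lemma approx_poly p : p \is a polyOver (mem E) -> p != 0 -> exists2 b, E b &
  forall b', E b' -> v (x - b) <= v (x - b') -> p.[b'] != 0 /\ v0 < v (p.[x] / p.[b'] - 1).
Proof.
move=> pE p0; have [r e] := closed_field_poly_normal p.
have l0 : lead_coef p != 0 by rewrite lead_coef_eq0.
have [|b Eb hb] := @approx_roots r.
  move=> c cr; apply: (alg_trans hK); exists p.
    by split=> //; apply: pol_mono pE.
  by rewrite e rootZ // root_prod_XsubC.
have hor y : p.[y] = lead_coef p * \prod_(c <- r) (y - c).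
  rewrite {1}e hornerZ horner_prod; congr (_ * _).
  by apply: eq_bigr => c _; rewrite hornerXsubC.
exists b => // b' Eb' l; have [n0 h] := hb b' Eb' l.
by rewrite !hor mulf_neq0 //; split=> //; rewrite -mulf_div divff // mul1r.
Qed.

(** The value f(x) of a rational function differs from f(b), b in E close to x, by a
    one-unit factor. *)
Lemma approx_elt u : adjoin E [set x] u -> exists u', [/\ E u', v u = v u' &
  v0 <= v u -> v0 < v (u - u')].
Proof.
move=> /(adjoin_frac hE)[p [q [pE qE qx ->]]].
have [->|p0] := eqVneq p 0.
  by exists 0; rewrite horner0 mul0r subrr Defs.val0 (v0_lt_Inf v); split=> //; apply: sf0.
have q0 : q != 0 by apply: contraNneq qx => ->; rewrite horner0.
have [b1 E1 h1] := approx_poly pE p0; have [b2 E2 h2] := approx_poly qE q0.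
have [b [Eb l1 l2]] : exists b, [/\ E b, v (x - b1) <= v (x - b) & v (x - b2) <= v (x - b)].
  by case: (leP (v (x - b1)) (v (x - b2))) => l12; [exists b2 | exists b1]; split=> //; exact: ltW.
have [pb hp] := h1 b Eb l1; have [qb hq] := h2 b Eb l2.
have [ep lp] := one_unit_eq pb hp; have [eq lq] := one_unit_eq qb hq.
have en : v (p.[x] / q.[x]) = v (p.[b] / q.[b]).
  by apply: veqM => //; apply: vV_eq.
exists (p.[b] / q.[b]); split=> //.
  by apply: (sf_div hE); apply: (pol_horner hE).
move=> hu; have -> : p.[x] / q.[x] - p.[b] / q.[b] =
    (p.[x] - p.[b]) / q.[x] - (p.[b] / q.[b]) * ((q.[x] - q.[b]) / q.[x]).
  rewrite mulrA -mulrBl mulrBr (divfK qb) opprB addrA subrK.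
  by rewrite mulrBl (mulfK qx).
have g : v0 <= v (p.[b] / q.[b]) by rewrite -en.
have qpx : v q.[x] <= v p.[x] by rewrite -vdiv_ge0.
apply: vB_gt.
  by rewrite vdiv_gt0 //; apply: le_lt_trans qpx _; rewrite ep.
by apply: vM_gt0r => //; rewrite vdiv_gt0 // eq.
Qed.

Lemma immediate_cof : immediate v E (adjoin E [set x]).
Proof.
have sub : E `<=` adjoin E [set x] by apply: adjoin_base.
split; apply/seteqP; split.
- move=> g [y /approx_elt[y' [Ey' e _]] ey]; exists y' => //; by rewrite -e.
- exact: value_group_mono.
- move=> _ [y [/approx_elt[y' [Ey' e lt]] y0] <-].
  exists y'; first by split=> //; rewrite /= -e.
  apply/res_eq; rewrite -?e //; rewrite vBC; exact: lt.
- exact: residue_field_mono.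
Qed.

Lemma valuation_algebraic_cof : valuation_algebraic v K Kx.
Proof.
have [ev er] := immediate_cof.
have sub : Kx `<=` adjoin E [set x] by apply: adjoin_mono.
split=> [g hg|r hr].
  have : value_group v E g by rewrite -ev; apply: value_group_mono hg.
  move=> [y Ey ey]; have [k [d [k0 Kd d0 e]]] := val_torsion v hK (EK Ey) (vneq0 ey).
  by exists k => //; exists d => //; rewrite -e; apply: vX_VFin.
have : rfield E r by rewrite -er; apply: residue_field_mono hr.
by move=> [y [Ey y0] <-]; apply: res_alg => //; apply: EK.
Qed.
End Immediate.

(** If v(x - a) is torsion over vK, it is the value of some algebraic c, and the residue
    of (x - a) / c is algebraic over Kv. The latter is a root of the reduction of a
    polynomial f over K, so some root z of f has the same residue as (x - a) / c, and a
    + c z is closer to x than a. *)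
Lemma not_valuation_algebraic a : Kt a -> (forall c, Kt c -> v (x - c) <= v (x - a)) ->
  ~ valuation_algebraic v K Kx.
Proof.
move=> aK amax [tor ralg].
have xa0 : x - a != 0 by apply: x_neq trx _ aK.
have [k [d [k0 Kd d0 e]]] := val_torsion v hKx (algKx (x - a)) xa0.
have [h eh] := val_fin v d0.
have [n n0 [d' Kd' ed']] := tor h (ex_intro2 _ _ d Kd eh).
have ekn : v ((x - a) ^+ (k * n)) = v d'.
  by rewrite exprM (vX_eq n e) ed'; apply: vX_VFin.
have kn0 : (0 < k * n)%N by rewrite muln_gt0 k0.
have [c /rootP hc] : exists c, root ('X^(k * n) - d'%:P) c.
  apply/closed_rootP; rewrite size_XnsubC // eqSS -lt0n //.
have ec : c ^+ (k * n) = d'.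
  by move/eqP: hc; rewrite hornerD hornerN hornerXn hornerC subr_eq0 => /eqP.
have cK : Kt c.
  exists ('X^(k * n) - d'%:P).
    split; last by rewrite -size_poly_gt0 size_XnsubC.
    by apply: (polB hK); [apply: (polXn hK); apply: (polX hK) | apply: (polC hK)].
  by rewrite rootE hornerD hornerN hornerXn hornerC ec subrr.
have vc : v (x - a) = v c by apply: (vX_inj kn0); rewrite ec.
have c0 : c != 0 by rewrite -(vlt_Inf v) -vc vlt_Inf.
pose u := (x - a) / c.
have vu : v u = v0 by apply/vdiv_eq0.
have ru : algebraic_over (alg_closure (rfield K)) (res u).
  apply: algebraic_mono ralg _; apply: res_alg; [exact: hKx | exact: algKx |].
  by rewrite vu.
have [P [PK P0] rP] := alg_trans (residue_subfield v hK) ru.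
have [f [fK fi sf rf]] := res_lift hK PK.
have f0 : f != 0 by rewrite -size_poly_gt0 sf size_poly_gt0.
have vl : v (lead_coef f) = v0.
  have el : res (lead_coef f) = lead_coef P.
    by rewrite !lead_coefE -sf -rf coef_map_id0 ?res0.
  apply: le_anti; rewrite fi andbT leNgt; apply/negP => /(res_eq0 (fi _)).
  by rewrite -lead_coefE el => /eqP; rewrite lead_coef_eq0 (negPf P0).
have fu : v0 < v f.[u].
  apply/res_eq0; rewrite ?res_horner ?vu ?rf //; last exact: rootP.
  rewrite horner_coef; apply: vsum_ge => i _; apply: vM_ge0; first exact: fi.
  by apply: vX_ge0; rewrite vu.
have [r er] := closed_field_poly_normal f.
move: fu; rewrite er hornerZ horner_prod vM0l //.
apply/negP; rewrite -leNgt -(Defs.val1 v).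
suff : v (\prod_(z <- r) ('X - z%:P).[u]) <= v (\prod_(z <- r) (1 : F)) by rewrite big1_eq.
apply: vprod_le => z zr; rewrite hornerXsubC Defs.val1 leNgt; apply/negP => lt.
have zK : Kt z by exists f => //; rewrite er rootZ ?lead_coef_eq0 // root_prod_XsubC.
have wK : Kt (a + c * z) by apply: (sfD hKt) => //; apply: (sfM hKt).
have := amax _ wK; rewrite leNgt => /negP; apply.
have -> : x - (a + c * z) = c * (u - z) by rewrite /u mulrBr [c * (_ / _)]mulrC divfK // opprD addrA.
by rewrite vc -{1}[c]mulr1 vltM2lE // Defs.val1.
Qed.

(** * Key polynomials *)

(** The maximum that defines delta is attained unless p has no roots. *)
Lemma delta_cases y p : p != 0 ->
  (forall a, root p a -> v (y - a) <= delta v y p) /\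
  (delta v y p = VNInf \/ exists2 a, root p a & delta v y p = v (y - a)).
Proof.
move=> p0; rewrite /delta; case: closed_field_poly_normal => r /= e.
have rP a : root p a = (a \in r) by rewrite e rootZ ?lead_coef_eq0 // root_prod_XsubC.
have [h1 h2] : (forall a, a \in r -> v (y - a) <= \big[Order.max/VNInf]_(a <- r) v (y - a)) /\
    (\big[Order.max/VNInf]_(a <- r) v (y - a) = VNInf \/
     exists2 a, a \in r & \big[Order.max/VNInf]_(a <- r) v (y - a) = v (y - a)).
  elim: (r) => [|b s [IH1 IH2]]; first by rewrite big_nil; split=> //; left.
  rewrite big_cons; split.
    move=> a; rewrite inE le_max => /orP[/eqP ->|/IH1 -> //]; last by rewrite orbT.
    by rewrite lexx.
  right; case: (leP (v (y - b)) (\big[Order.max/VNInf]_(a <- s) v (y - a))) => h.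
    case: IH2 => [e0|[a as_ ea]]; last by exists a => //; rewrite inE as_ orbT.
    by move: h; rewrite e0 leNgt vgtNInf.
  by exists b => //; rewrite mem_head.
split=> [a|]; first by rewrite rP; apply: h1.
by case: h2 => [->|[a ar ea]]; [left | right; exists a; rewrite ?rP].
Qed.

Lemma delta_ub y p a : p != 0 -> root p a -> v (y - a) <= delta v y p.
Proof. by move=> p0; have [h _] := delta_cases y p0; apply: h. Qed.

Lemma root_Kt p c : p \is a polyOver (mem K) -> p != 0 -> root p c -> Kt c.
Proof. by move=> pK p0 rc; exists p. Qed.

Lemma minp_roots c b : Kt c -> root (minp K c) b -> exists2 rho, fixes Kx rho & rho c = b.
Proof.
move=> cK; rewrite -minpKx // => /(conj_exists hKx algKx) [rho h1 h2].
by exists rho.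
Qed.

Lemma minp_key y c : Kt c ->
  (forall c', Kt c' -> (deg K c' < deg K c)%N -> v (y - c') < v (y - c)) ->
  key_polynomial v K y (minp K c).
Proof.
move=> cK h; have hm := minpP hK cK.
split; [exact: minpoly_monic hm | exact: minpoly_over hm |].
move=> f fK f0; rewrite size_minp // ltnS => sf.
have ub := delta_ub y (minpoly_neq0 hm) (minpoly_root hm).
have [_ [->|[b rb ->]]] := delta_cases y f0.
  exact: lt_le_trans (vgtNInf v _) ub.
apply: lt_le_trans ub; apply: h; first exact: root_Kt rb.
exact: leq_trans (deg_root hK fK f0 rb) sf.
Qed.

(** It suffices to dominate algebraic elements c instead of polynomials: a polynomial f
    has a root c with v(y - c) = delta(f), and the degree of c is at most that of f. *)
Lemma complete_of y (P : set {poly F}) : P `<=` key_polynomial v K y ->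
  (forall c, Kt c -> exists c0, [/\ Kt c0, P (minp K c0), (deg K c0 <= deg K c)%N &
     v (y - c) <= v (y - c0)]) -> complete_key_polynomials v K y P.
Proof.
move=> hP h; split=> // f fK sf.
have f0 : f != 0 by rewrite -size_poly_gt0 ltnW.
have [ub [e|[b rb e]]] := delta_cases y f0.
  have /closed_rootP[b rb] : size f != 1%N by rewrite neq_ltn sf orbT.
  by have := ub b rb; rewrite e leNgt vgtNInf.
have [c0 [c0K Pc0 le1 le2]] := h b (root_Kt fK f0 rb).
have hm := minpP hK c0K.
exists (minp K c0); split=> //.
  by rewrite size_minp //; apply: leq_ltn_trans le1 (deg_root hK fK f0 rb).
by rewrite e; apply: le_trans le2 (delta_ub y (minpoly_neq0 hm) (minpoly_root hm)).
Qed.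

Lemma minimal_delta c : minimal_elt c -> delta v x (minp K c) = v (x - c).
Proof.
move=> mc; have [cK _] := mc; have hm := minpP hK cK.
have ub := delta_ub x (minpoly_neq0 hm) (minpoly_root hm).
have [_ [e|[b rb e]]] := delta_cases x (minpoly_neq0 hm).
  by move: ub; rewrite e leNgt vgtNInf.
have [rho fr rc] := minp_roots cK rb; have [_ h _] := minimal_props mc.
by rewrite e -rc h // rc -e.
Qed.

Lemma minimal_unique c : minimal_elt c -> unique_maximal_root v x (minp K c) c.
Proof.
move=> mc; have [cK _] := mc; have hm := minpP hK cK.
split; first by split; [exact: minpoly_root hm | exact: minimal_delta].
move=> b [rb]; rewrite minimal_delta // => e.
have [rho fr rc] := minp_roots cK rb; have [_ h _] := minimal_props mc.
by rewrite -rc; apply: h => //; rewrite rc e.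
Qed.

Lemma minimal_key c : minimal_elt c -> key_polynomial v K x (minp K c).
Proof. by move=> [cK h]; apply: minp_key. Qed.

Lemma minp_irr c : Kt c -> minp K c \is monic /\ irreducible_over K (minp K c).
Proof.
move=> cK; have hm := minpP hK cK.
by split; [exact: minpoly_monic hm | exact: minpoly_irr hm].
Qed.

Lemma top_max d c c' : top_of d c -> Kt c' -> (deg K c' <= d)%N -> v (x - c') <= v (x - c).
Proof.
move=> [[mc dc] tc] c'K le; have [c'' [mc'' le2 h]] := dom_minimal c'K.
apply: le_trans h _; have := leq_trans le2 le; rewrite leq_eqVlt => /orP[/eqP e|lt].
  exact: tc.
by apply: ltW; apply: minimal_lt => //; rewrite dc.
Qed.

(** * The sequences of minimal elements *)

(** Either every degree has a best minimal element and Om is empty, or Om indexes a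
    cofinal sequence of minimal elements of the last degree. *)
Definition limit_part (S : set nat) (en : nat -> nat) (Om : Type) (leO : rel Om)
    (z : Om -> F) : Prop :=
  ((Om -> False) /\ forall d, Dset d -> top_of d (pick_elt d)) \/
  (limit_ordinal leO /\ exists n, [/\ (0 < n)%N, S = segment n,
     forall nu, of_degree (en n) (z nu),
     forall i j, wlt leO i j -> v (x - z i) < v (x - z j) &
     forall c, of_degree (en n) c -> exists nu, v (x - c) < v (x - z nu)]).

Section Assemble.
Variables (S : set nat) (en : nat -> nat).
Hypotheses (initS : initial_segment S) (S1 : S 1%N) (en1 : en 1%N = 1%N).
Hypothesis SD : forall i, S i -> (0 < i)%N /\ Dset (en i).
Hypothesis Spred : forall i, S i -> (1 < i)%N -> S i.-1 /\ (en i.-1 < en i)%N.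
Hypothesis Ssurj : forall d, Dset d -> exists2 i, S i & en i = d.
Variables (Om : Type) (leO : rel Om) (z : Om -> F).
Hypothesis HOm : limit_part S en leO z.

Let a i : F := pick_elt (en i).

Lemma S_mono i j : S j -> (0 < i < j)%N -> S i /\ (en i < en j)%N.
Proof.
elim: j => [_|j IH Sj /andP[i0]]; first by rewrite ltn0 andbF.
rewrite ltnS => ij.
have j1 : (1 < j.+1)%N by rewrite ltnS (leq_trans i0).
have [/= Sj' lt] := Spred Sj j1.
move: ij; rewrite leq_eqVlt => /orP[/eqP ->|ij]; first by split.
have [|Si l] := IH Sj'; first by rewrite i0.
by split=> //; apply: ltn_trans lt.
Qed.

Lemma S_down i j : S j -> (0 < i <= j)%N -> S i.
Proof.
move=> Sj /andP[i0]; rewrite leq_eqVlt => /orP[/eqP -> //|ij].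
by have [] := S_mono Sj (i := i); rewrite ?i0.
Qed.

Lemma en_lt i j : S i -> S j -> (en i < en j)%N -> (i < j)%N.
Proof.
move=> Si Sj lt; rewrite ltnNge leq_eqVlt; apply/negP => /orP[/eqP e|ji].
  by rewrite e ltnn in lt.
have [j0 _] := SD Sj; have [|_] := S_mono Si (i := j); first by rewrite j0.
by rewrite ltnNge ltnW.
Qed.

Lemma aP i : S i -> minimal_elt (a i) /\ deg K (a i) = en i.
Proof. by move=> Si; have [_ /pick_deg] := SD Si. Qed.

Lemma aKt i : S i -> Kt (a i). Proof. by move=> /aP[[]]. Qed.

Lemma a_lt i j : S j -> (0 < i < j)%N -> v (x - a i) < v (x - a j).
Proof.
move=> Sj ij; have [Si lt] := S_mono Sj ij.
have [mi di] := aP Si; have [mj dj] := aP Sj.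
by apply: minimal_lt => //; rewrite di dj.
Qed.

Lemma a_sub i j : S j -> (0 < i <= j)%N -> K_ (a i) `<=` K_ (a j).
Proof.
move=> Sj ij; have Si := S_down Sj ij; have [mi di] := aP Si; have [mj dj] := aP Sj.
apply: minimal_sub => //; rewrite di dj.
move: ij => /andP[i0]; rewrite leq_eqVlt => /orP[/eqP -> //|ij].
by have [|_ /ltnW] := S_mono Sj (i := i); rewrite ?i0.
Qed.

Lemma a_top i : S i -> (exists2 j, S j & (i < j)%N) \/ (Om -> False) -> top_of (en i) (a i).
Proof.
move=> Si [[j Sj ij]|nO].
  have [i0 Di] := SD Si; have [_ Dj] := SD Sj.
  have [|_ lt] := S_mono Sj (i := i); first by rewrite i0.
  exact: pick_top_lt Di Dj lt.
case: HOm => [[_ h]|[[_ [o] _] _]]; last by case: (nO o).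
by apply: h; have [] := SD Si.
Qed.

(** Replace c by a minimal element that dominates it, and this by the best one of its
    degree, or by a member of the limit part if there is no best one. *)
Lemma domination c : Kt c ->
  (exists i, [/\ S i, (en i <= deg K c)%N, v (x - c) <= v (x - a i) & top_of (en i) (a i)]) \/
  (exists n nu, [/\ (0 < n)%N /\ S = segment n, of_degree (en n) (z nu), (en n <= deg K c)%N &
     v (x - c) < v (x - z nu)]).
Proof.
move=> cK; have [c' [mc' le1 le2]] := dom_minimal cK.
have [i Si ei] : exists2 i, S i & en i = deg K c' by apply: Ssurj; exists c'.
have top : top_of (en i) (a i) -> exists i, [/\ S i, (en i <= deg K c)%N,
    v (x - c) <= v (x - a i) & top_of (en i) (a i)].
  move=> t; exists i; rewrite ei; split=> //; last by rewrite -ei.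
  by apply: le_trans le2 _; apply: t.2.
case: HOm => [[_ h]|[_ [n [n0 eS hz _ cz]]]].
  by left; apply/top/h; have [] := SD Si.
case: (ltnP i n) => [lt|ge].
  left; apply/top/a_top => //; left; exists n => //.
  by rewrite eS /segment /= n0 leqnn.
right; have ein : i = n.
  by apply/eqP; rewrite eqn_leq ge andbT; move: Si; rewrite eS => /andP[].
have [nu hnu] := cz c' (conj mc' (esym (etrans (congr1 en (esym ein)) ei))).
exists n, nu; split=> //; first by rewrite -ein ei.
exact: le_lt_trans le2 hnu.
Qed.

Local Notation L0 := (adjoin K (a @` S)).

Lemma A_min b : (a @` S) b -> minimal_elt b.
Proof. by move=> [i Si <-]; have [] := aP Si. Qed.

Lemma K_a_L0 i : S i -> K_ (a i) `<=` L0.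
Proof. by move=> Si; apply: adjoin_mono => // _ ->; exists i. Qed.

Lemma in_segment n : (0 < n)%N -> S = segment n -> S n.
Proof. by move=> n0 ->; rewrite /segment /= n0 leqnn. Qed.

Lemma z_in n nu : S n -> of_degree (en n) (z nu) -> K_ (a n) (z nu).
Proof.
move=> Sn [mz dz]; have [ma da] := aP Sn.
by apply: (@minimal_sub (z nu)); rewrite ?dz ?da //; apply: adjoin_elt.
Qed.

Lemma A_dom c : Kt c -> exists2 b, L0 b & v (x - c) <= v (x - b).
Proof.
move=> /domination[[i [Si _ le _]]|[n [nu [[n0 eS] hz _ lt]]]].
  by exists (a i) => //; apply: adjoin_gen; exists i.
exists (z nu); last exact: ltW.
have Sn := in_segment n0 eS.
by apply: (K_a_L0 Sn); apply: z_in.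
Qed.

Lemma IC_L0 : implicit_constant_field v Kx K = L0.
Proof. exact: IC_eq A_min A_dom. Qed.

Lemma L0_seg n : (0 < n)%N -> S = segment n -> L0 = K_ (a n).
Proof.
move=> n0 eS; have Sn := in_segment n0 eS.
apply/seteqP; split; last exact: K_a_L0.
apply: adjoin_min; [exact: adjoin_subfield | exact: adjoin_base |].
move=> _ [i Si <-]; apply: (@a_sub i) => //; last exact: adjoin_elt.
by move: Si; rewrite eS.
Qed.

Lemma index_cases : [\/ S = [set i | (0 < i)%N] /\ (Om -> False),
  inhabited Om | exists n, [/\ (0 < n)%N, S = segment n & Om -> False]].
Proof.
case: (pselect (inhabited Om)) => [h|nO]; first exact: Or32.
have nO' : Om -> False by move=> o; apply: nO.
by case: initS => [e|[n n0 e]]; [apply: Or31 | apply: Or33; exists n].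
Qed.

Lemma Om_data : inhabited Om -> limit_ordinal leO /\ exists n, [/\ (0 < n)%N, S = segment n,
     forall nu, of_degree (en n) (z nu),
     forall i j, wlt leO i j -> v (x - z i) < v (x - z j) &
     forall c, Kt c -> exists nu, v (x - c) < v (x - z nu)].
Proof.
move=> [o]; case: HOm => [[nO _]|[lim [n [n0 eS hz inc cz]]]]; first by case: (nO o).
split=> //; exists n; split=> // c cK.
have [c' [mc' le1 le2]] := dom_minimal cK.
have [i Si ei] : exists2 i, S i & en i = deg K c' by apply: Ssurj; exists c'.
have Sn := in_segment n0 eS; have [i0 _] := SD Si.
have := Si; rewrite eS => /andP[_]; rewrite leq_eqVlt => /orP[/eqP e|lt].
  by have [|nu h] := cz c' _; [rewrite -e | exists nu; apply: le_lt_trans h].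
exists o; apply: le_lt_trans le2 _; have [mz dz] := hz o.
apply: minimal_lt => //; rewrite -ei dz.
by have [|] := S_mono Sn (i := i); rewrite ?i0.
Qed.

Lemma cofinal_L0 : S = [set i | (0 < i)%N] \/ inhabited Om ->
  forall c, Kt c -> exists2 b, L0 b & v (x - c) < v (x - b).
Proof.
move=> [eS|/Om_data[_ [n [n0 eS hz _ cz]]]] c cK; last first.
  have [nu h] := cz c cK; exists (z nu) => //.
  have Sn := in_segment n0 eS.
  by apply: (K_a_L0 Sn); apply: z_in.
have Sall i : (0 < i)%N -> S i by rewrite eS.
case: (domination cK) => [[i [Si _ le _]]|[n [nu [[n0 eS'] _ _ _]]]]; last first.
  by have := Sall n.+1 isT; rewrite eS' => /andP[]; rewrite ltnn.
have [i0 _] := SD Si.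
exists (a i.+1); first by apply: adjoin_gen; exists i.+1 => //; apply: Sall.
by apply: le_lt_trans le _; apply: a_lt; [apply: Sall | rewrite i0 /=].
Qed.

Lemma nat_cofinal : S = [set i | (0 < i)%N] ->
  forall c, Kt c -> exists i, v (x - c) < v (x - a i.+1).
Proof.
move=> eS c cK; have Sall i : (0 < i)%N -> S i by rewrite eS.
case: (domination cK) => [[i [Si _ le _]]|[n [nu [[n0 eS'] _ _ _]]]]; last first.
  by have := Sall n.+1 isT; rewrite eS' => /andP[]; rewrite ltnn.
have [i0 _] := SD Si; exists i.
by apply: le_lt_trans le _; apply: a_lt; [apply: Sall | rewrite i0 /=].
Qed.

Lemma max_seg n : (0 < n)%N -> S = segment n -> (Om -> False) ->
  forall c, Kt c -> v (x - c) <= v (x - a n).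
Proof.
move=> n0 eS nO c cK; have Sn := in_segment n0 eS.
case: (domination cK) => [[i [Si _ le _]]|[m [nu _]]]; last by case: (nO nu).
apply: le_trans le _; have := Si; rewrite eS => /andP[i0].
rewrite leq_eqVlt => /orP[/eqP -> //|lt].
by apply: ltW; apply: a_lt => //; rewrite i0.
Qed.

Lemma nat_sequence : S = [set i | (0 < i)%N] ->
  let a' i := a i.+1 in
  [/\ pseudo_cauchy v leq L0 a', transcendental_type v leq L0 a' & pc_limit v leq a' x].
Proof.
move=> eS a'; have Sall i : S i.+1 by rewrite eS.
have inc i j : wlt leq i j -> v (x - a' i) < v (x - a' j).
  by rewrite /wlt -ltnNge => ij; apply: a_lt.
split.
- apply: (inc_pc limit_ordinal_nat inc) => i.
  by apply: adjoin_gen; exists i.+1.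
- apply: (inc_trans_type hK limit_ordinal_nat inc).
  + exact: adjoin_subfield.
  + exact: adjoin_base.
  + exact: L0_Kt A_min.
  + exact: nat_cofinal.
- exact: (inc_limit inc).
Qed.

Lemma Om_sequence n E : S = segment n -> (0 < n)%N -> inhabited Om -> subfield E ->
  E `<=` Kt -> K_ (a n) `<=` E ->
  [/\ pseudo_cauchy v leO E z, transcendental_type v leO E z & pc_limit v leO z x].
Proof.
move=> eS n0 iO hE EK aE.
have [lim [n' [n0' eS' hz inc cz]]] := Om_data iO.
have Sn' := in_segment n0' eS'.
have zE nu : E (z nu).
  apply: aE; have h := z_in Sn' (hz nu).
  apply: (@a_sub n' n) => //; first exact: in_segment.
  by move: (Sn'); rewrite {1}eS.
split.
- exact: (inc_pc lim inc).
- apply: (inc_trans_type hK lim inc) => //.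
  by apply: subset_trans aE; apply: adjoin_base.
- exact: (inc_limit inc).
Qed.

(** The three possibilities for the index sets are the three ways to be weakly pure: by
    the sequence of the a_i, by the sequence of the z_nu, and by the last a_i as a best
    approximation. *)
Lemma weakly_pure_L0 : weakly_pure v L0 x.
Proof.
have eA : alg_closure L0 = Kt.
  by apply: alg_closure_inter => //; [exact: adjoin_base | exact: L0_Kt A_min].
case: index_cases => [[eS nO]|iO|[n [n0 eS nO]]].
- by right; have [h1 h2 h3] := nat_sequence eS; exists nat, leq, (fun i => a i.+1).
- right; have [_ [n [n0 eS _ _ _]]] := Om_data iO.
  have [|h1 h2 h3] := Om_sequence eS n0 iO (adjoin_subfield K (a @` S)) (L0_Kt A_min).
    by apply: K_a_L0; apply: in_segment.
  by exists Om, leO, z.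
left; exists (a n); first by apply: adjoin_gen; exists n => //; apply: in_segment.
rewrite eA; split; first by exists (a n) => //; apply: aKt; apply: in_segment.
by move=> _ [c cK <-]; apply: max_seg.
Qed.

Lemma va_iff : valuation_algebraic v K Kx <-> S = [set i | (0 < i)%N] \/ inhabited Om.
Proof.
split=> [va|h].
  case: index_cases => [[eS nO]|iO|[n [n0 eS nO]]]; [by left | by right |].
  have Sn := in_segment n0 eS.
  by case: (not_valuation_algebraic (aKt Sn) (max_seg n0 eS nO) va).
apply: (@valuation_algebraic_cof L0) => //.
- exact: adjoin_subfield.
- exact: adjoin_base.
- exact: L0_Kt A_min.
- exact: cofinal_L0.
Qed.

(** If a_k is closer to x than c, then c sees a_k and x at the same distance. So the
    approximation of a_k below its own degree reproduces that of x. *)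
Lemma close_eq k c : v (x - c) < v (x - a k) -> v (a k - c) = v (x - c).
Proof. by move=> h; rewrite vBC [RHS]vBC; apply: vtri_eq; rewrite vBC. Qed.

(** For elements c of degree less than that of a_k, v(a_k - c) = v(x - c), so
    completeness for x carries over. In the remaining degrees a_k itself is at distance
    0. *)
Lemma complete_at k : S k ->
  complete_key_polynomials v K (a k) ((fun i => minp K (a i)) @` segment k).
Proof.
move=> Sk; have [mk dk] := aP Sk; have [k0 _] := SD Sk.
have akK := aKt Sk.
apply: complete_of => [_ [i ik <-]|c cK].
  have Si := S_down Sk ik; have [mi di] := aP Si; apply: minp_key; first exact: aKt.
  move=> c' c'K lt; move: ik => /andP[i0]; rewrite leq_eqVlt => /orP[/eqP e|ik].
    rewrite e subrr Defs.val0 vlt_Inf subr_eq0; apply: contraTneq lt => <-.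
    by rewrite e ltnn.
  have l1 : v (x - a i) < v (x - a k) by apply: a_lt => //; rewrite i0.
  have l2 : v (x - c') < v (x - a i) by case: mi => _; apply.
  by rewrite !close_eq //; apply: lt_trans l2 l1.
case: (leqP (en k) (deg K c)) => [le|lt].
  exists (a k); split=> //; last by rewrite subrr Defs.val0 vVInf_max.
    by exists k => //; rewrite /segment /= k0 leqnn.
  by rewrite dk.
have [c' [mc' le1 le2]] := dom_minimal cK.
have [i Si ei] : exists2 i, S i & en i = deg K c' by apply: Ssurj; exists c'.
have [mi di] := aP Si; have [i0 _] := SD Si.
have ik : (i < k)%N by apply: en_lt => //; rewrite ei; apply: leq_ltn_trans lt.
have [_ tI] : top_of (en i) (a i) by apply: a_top => //; left; exists k.
have l1 : v (x - a i) < v (x - a k) by apply: a_lt => //; rewrite i0.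
have l2 : v (x - c) <= v (x - a i) by apply: le_trans le2 _; apply: tI.
exists (a i); split; first exact: aKt.
- by exists i => //; rewrite /segment /= i0 ltnW.
- by rewrite di ei.
- by rewrite !close_eq //; apply: le_lt_trans l2 l1.
Qed.

Lemma limit_minimal nu : minimal_elt (z nu).
Proof. by have [_ [n [_ _ hz _ _]]] := Om_data (inhabits nu); have [] := hz nu. Qed.

Lemma complete_x :
  complete_key_polynomials v K x
    ((fun i => minp K (a i)) @` S `|` range (fun nu => minp K (z nu))).
Proof.
apply: complete_of => [_ [[i Si <-]|[nu _ <-]]|c cK].
- by apply: minimal_key; have [] := aP Si.
- exact: minimal_key (limit_minimal nu).
case: (domination cK) => [[i [Si le1 le2 _]]|[n [nu [_ [m d] le1 lt]]]].
  exists (a i); split=> //; first exact: aKt.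
    by left; exists i.
  by have [_ ->] := aP Si.
exists (z nu); split=> //; first by case: m.
- by right; exists nu.
- by rewrite d.
- exact: ltW.
Qed.

End Assemble.

(** * The limit part, and the theorem *)

(** Well-order F and keep the minimal elements of degree m that are closer to x than all
    their predecessors. These records are cofinal, since the first element closer to x
    than a given c is a record. *)
Lemma record_sequence m : Dset m -> ~ (exists c, top_of m c) ->
  exists (Om : Type) (leO : rel Om) (z : Om -> F), [/\ limit_ordinal leO,
    forall nu, of_degree m (z nu),
    forall i j, wlt leO i j -> v (x - z i) < v (x - z j) &
    forall c, of_degree m c -> exists nu, v (x - c) < v (x - z nu)].
Proof.
move=> [c0 hc0] ntop; have [R wo] := well_ordering_principle F.
pose rec c := of_degree m c /\ forall c', of_degree m c' -> wlt R c' c -> v (x - c') < v (x - c).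
pose Om := {c : F | `[< rec c >]}; pose z (s : Om) : F := val s.
pose leO : rel Om := fun s t => R (z s) (z t).
have zP s : rec (z s) by apply/asboolP; apply: (valP s).
have inc i j : wlt leO i j -> v (x - z i) < v (x - z j).
  by move=> h; have [_] := zP j; apply=> //; have [] := zP i.
have cof c : of_degree m c -> exists nu, v (x - c) < v (x - z nu).
  move=> hc; have [c1 hc1 lt1] : exists2 c1, of_degree m c1 & v (x - c) < v (x - c1).
    apply/not_notP => h; apply: ntop; exists c; split=> // c1 hc1.
    by rewrite leNgt; apply/negP => lt; apply: h; exists c1.
  have [c2 [[hc2 lt2] c2min]] := wo_min wo (P := fun c' => of_degree m c' /\ v (x - c) < v (x - c'))
    (ex_intro _ c1 (conj hc1 lt1)).
  have rc2 : rec c2.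
    split=> // c' hc' /negP n; apply: le_lt_trans lt2; rewrite leNgt; apply/negP => lt.
    by apply: n; apply: c2min.
  by exists (exist _ c2 (introT (asboolP _) rc2)).
have woO : well_order leO.
  apply: antisymmetric_well_order => [s t /andP[h1 h2]|A [s sA]].
    by apply: val_inj; exact: (wo_anti wo h1 h2).
  have [c [[t [tA <-]] tmin]] := wo_min wo (P := fun c => exists t, t \in A /\ z t = c)
    (ex_intro _ _ (ex_intro _ s (conj sA (erefl _)))).
  by exists t; split=> // u uA; apply: tmin; exists u.
exists Om, leO, z; split=> //; last by move=> nu; have [] := zP nu.
split=> //.
  by have [nu _] := cof c0 hc0; exists.
move=> i; have [hi _] := zP i; have [j lt] := cof _ hi; exists j.
apply/negP => ji; case: (le_eq_wlt woO ji) => [e|/inc lt']; first by rewrite e ltxx in lt.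
by have := lt_trans lt lt'; rewrite ltxx.
Qed.

(** A degree without best minimal element is the last one, since minimal elements of
    larger degree would force the existence of a best one. *)
Lemma limit_part_exists S en : initial_segment S ->
  (forall i, S i -> (0 < i)%N /\ Dset (en i)) ->
  (forall i, S i -> (1 < i)%N -> S i.-1 /\ (en i.-1 < en i)%N) ->
  (forall d, Dset d -> exists2 i, S i & en i = d) ->
  exists (Om : Type) (leO : rel Om) (z : Om -> F), limit_part S en leO z.
Proof.
move=> initS SD Spred Ssurj.
case: (pselect (forall d, Dset d -> exists c, top_of d c)) => [top|].
  by exists False, (fun _ _ => true), (False_rect _); left; split=> // d Dd; apply/pick_top/top.
move=> /existsNP[m /not_implyP[Dm ntop]].
have [Om [leO [z [lim hz inc cof]]]] := record_sequence Dm ntop.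
exists Om, leO, z; right; split=> //.
have [n Sn en_n] := Ssurj m Dm; have [n0 _] := SD n Sn.
exists n; rewrite en_n; split=> //.
have last j : S j -> (j <= n)%N.
  move=> Sj; rewrite leqNgt; apply/negP => nj; apply: ntop.
  have [|_ lt] := S_mono Spred Sj (i := n); first by rewrite n0.
  have [_ Dj] := SD j Sj; exists (pick_elt m).
  by apply: (pick_top_lt Dm Dj); rewrite -en_n.
case: initS => [eS|[k k0 eS]].
  by have := last n.+1; rewrite eS ltnn => /(_ isT).
have kn : (k <= n)%N by apply: last; rewrite eS /segment /= k0 leqnn.
move: Sn; rewrite eS => /andP[_ nk].
by congr segment; apply/eqP; rewrite eqn_leq kn.
Qed.
End Tame.

(** The numerous shared hypotheses of the preceding lemmas are found in the context. *)
Ltac use lemma := eapply lemma; try eassumption.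

Theorem theorem3 (F : closedFieldType) (G : oagType) (v : valuation F G)
    (K L' : set F) (x : F)
    (K_subfield : subfield K)
    (K_henselian : henselian v K)
    (x_transcendental : ~ algebraic_over K x)
    (F_closure : alg_closure (adjoin K [set x]) = setT)
    (L'_tame : tame v K L')
    (L'_weakly_pure : weakly_pure v L' x) :
  exists (S : set nat) (Om : Type) (leO : rel Om)
         (Q : nat -> {poly F}) (QO : Om -> {poly F})
         (a : nat -> F) (z : Om -> F),
  let L := implicit_constant_field v (adjoin K [set x]) K in
  let K_ i := adjoin K [set a i] in
  [/\ initial_segment S,
      (Om -> False) \/ limit_ordinal leO,
      (forall i, S i -> Q i \is monic /\ irreducible_over K (Q i))
    & (forall nu, QO nu \is monic /\ irreducible_over K (QO nu))]
  /\
  (* (i)-(v) *)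
  [/\ complete_key_polynomials v K x (Q @` S `|` range QO),
      size (Q 1%N) = 2%N,
      (forall i, S i -> unique_maximal_root v x (Q i) (a i)) /\
        (forall nu, unique_maximal_root v x (QO nu) (z nu)),
      (forall i, S i -> (1 < i)%N ->
         K_ i.-1 `<` K_ i /\ (size (Q i.-1) < size (Q i))%N)
    & (forall i, S i -> (1 < i)%N -> v (x - a i.-1) < v (x - a i))]
  /\
  (* (vi)-(x) *)
  [/\ (forall i, S i -> (exists2 j, S j & (i < j)%N) \/ (Om -> False) ->
         is_max (vdist v x (K_ i)) (v (x - a i))),
      (forall n, (0 < n)%N -> S = segment n -> (Om -> False) ->
         is_max (vdist v x (alg_closure K)) (v (x - a n))),
      (inhabited Om -> exists n, [/\ (0 < n)%N, S = segment n,
         pseudo_cauchy v leO (K_ n) z,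
         transcendental_type v leO (K_ n) z
       & forall nu, size (QO nu) = size (Q n)]),
      L = adjoin K (a @` S) /\
        (forall n, (0 < n)%N -> S = segment n -> L = K_ n)
    & (forall k, S k -> complete_key_polynomials v K (a k) (Q @` segment k))]
  /\
  [/\ weakly_pure v L x,
      valuation_algebraic v K (adjoin K [set x]) <->
        S = [set i | (0 < i)%N] \/ inhabited Om,
      (S = [set i | (0 < i)%N] \/ inhabited Om ->
         immediate v L (adjoin L [set x])),
      (S = [set i | (0 < i)%N] ->
         let a' i := a i.+1 in
         [/\ pseudo_cauchy v leq L a', transcendental_type v leq L a'
           & pc_limit v leq a' x])
    & L `<=` L'].
Proof.
have hK := K_subfield; have [[_ _ KL' _ _] _] := L'_tame.
have dom c : alg_closure K c -> exists2 b, L' b & v (x - c) <= v (x - b).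
  exact: weakly_pure_dom L'_weakly_pure.
have [S [en [initS [S1 en1] SD Spred Ssurj]]] :=
  enum_nat (Dset1 v x K_subfield) (@Dset_pos F G v K x K_subfield).
have [Om [leO [z HOm]]] : exists (Om : Type) (leO : rel Om) (z : Om -> F),
  limit_part v K x S en leO z by use limit_part_exists.
pose a i := pick_elt v K x (en i).
have aP i : S i -> minimal_elt v K x (a i) /\ deg K (a i) = en i by use aP.
have aKt i : S i -> alg_closure K (a i) by move=> /aP[[]].
have mz nu : minimal_elt v K x (z nu) by use limit_minimal.
have sQ i : S i -> size (minp K (a i)) = (en i).+1.
  by move=> Si; have [_ <-] := aP i Si; apply: size_minp => //; apply: aKt.
have eL : implicit_constant_field v (adjoin K [set x]) K = adjoin K (a @` S) by use IC_L0.
have Amin b : (a @` S) b -> minimal_elt v K x b by move=> [i Si <-]; have [] := aP i Si.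
exists S, Om, leO, (fun i => minp K (a i)), (fun nu => minp K (z nu)), a, z.
split; [|split; [|split]]; last rewrite /= eL; split=> //.
- by case: HOm => [[h _]|[h _]]; [left | right].
- by move=> i Si; apply: minp_irr => //; apply: aKt.
- by move=> nu; apply: minp_irr => //; have [] := mz nu.
- by use complete_x.
- by rewrite sQ // en1.
- split=> [i Si|nu]; last by use minimal_unique.
  by have [mi _] := aP i Si; use minimal_unique.
- move=> i Si i1; have [Si' lt] := Spred i Si i1.
  have [mi di] := aP i Si; have [mi' di'] := aP _ Si'.
  rewrite !sQ // ltnS; split=> //; split.
    by use minimal_sub; rewrite di di' ltnW.
  move=> sub; have h : adjoin K [set a i.-1] (a i) by apply: sub; apply: adjoin_elt.
  by have := deg_adjoin_le hK (aKt _ Si') h; rewrite di di' leqNgt lt.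
- by move=> i Si i1; use a_lt; lia.
- move=> i Si h; have [mi di] := aP i Si.
  have t : top_of v K x (en i) (a i) by use a_top.
  split; first by exists (a i) => //; apply: adjoin_elt.
  move=> _ [c ci <-]; have cK : alg_closure K c by apply: K_a_Kt ci => //; apply: aKt.
  have le : (deg K c <= en i)%N by rewrite -di; apply: deg_adjoin_le => //; apply: aKt.
  by use top_max.
- move=> n n0 eS nO; have Sn := in_segment n0 eS.
  split; first by exists (a n) => //; apply: aKt.
  by move=> _ [c cK <-]; use max_seg.
- move=> iO; have [[nO _]|[_ [n [n0 eS hz _ _]]]] := HOm; first by case: (iO) => /nO.
  have Sn := in_segment n0 eS; exists n.
  have [h1 h2 _] : [/\ pseudo_cauchy v leO (adjoin K [set a n]) z,
      transcendental_type v leO (adjoin K [set a n]) z & pc_limit v leO z x].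
    by use Om_sequence; [exact: adjoin_subfield | apply: K_a_Kt => //; apply: aKt |].
  split=> // nu; rewrite sQ //; have [[nuK _] <-] := hz nu.
  exact: (size_minp hK nuK).
- by split=> // n n0 eS; rewrite eL; use L0_seg.
- by use complete_at.
- by use weakly_pure_L0.
- by use va_iff.
- move=> h; apply: (immediate_cof hK (adjoin_subfield _ _)); first by use L0_Kt.
  by use cofinal_L0.
- by use nat_sequence.
- by use L0_L.
Qed.
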